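(* Let $n\in\mathbb N$, $c\in\mathbb C$, $\eta\in\mathbb C$, and let $\Gamma\subset\mathbb C$ be the lattice generated by $1$ and $\tau$, $\mathrm{Im}\,\tau>0$. Let $F_0=\mathbb C$ and, for $\alpha\ge1$, let $F_\alpha$ be the space of holomorphic symmetric functions $f(z_1,\dots,z_\alpha)$ on $\mathbb C^\alpha$ such that $$f(z_1+1,z_2,\dots,z_\alpha)=f(z_1,\dots,z_\alpha),\qquad f(z_1+\tau,z_2,\dots,z_\alpha)=(-1)^ne^{-2\pi i(nz_1-c-(\alpha-1)n\eta)}f(z_1,\dots,z_\alpha).$$ For $f\in F_\alpha$, $g\in F_\beta$ put $$f*g(z_1,\dots,z_{\alpha+\beta})=\frac1{\alpha!\beta!}\sum_{\sigma\in S_{\alpha+\beta}}f(z_{\sigma_1},\dots,z_{\sigma_\alpha})\,g(z_{\sigma_{\alpha+1}}-2\alpha\eta,\dots,z_{\sigma_{\alpha+\beta}}-2\alpha\eta)\prod_{\substack{1\le i\le\alpha\\ \alpha+1\le j\le\alpha+\beta}}\frac{\theta(z_{\sigma_i}-z_{\sigma_j}-n\eta)}{\theta(z_{\sigma_i}-z_{\sigma_j})}.$$ If $f\in F_\alpha$ and $g\in F_\beta$, then $f*g\in F_{\alpha+\beta}$. The operation $*$ defines an associative multiplication on the space $\bigoplus_{\alpha\ge0}F_\alpha$.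
   Context: $\theta(z)=\sum_{\alpha\in\mathbb Z}(-1)^\alpha e^{2\pi i\left(\alpha z+\frac{\alpha(\alpha-1)}2\tau\right)}$; it satisfies $\theta(z+1)=\theta(z)$, $\theta(z+\tau)=-e^{-2\pi iz}\theta(z)$, $\theta(-z)=-e^{-2\pi iz}\theta(z)$, and its only zeros are simple zeros at the points of $\Gamma$. *)

(* Defs.v *)
From mathcomp Require Export all_boot all_order all_algebra all_fingroup.
From mathcomp Require Export all_classical all_reals all_analysis.
From mathcomp Require Export complex.

Set Implicit Arguments.
Unset Strict Implicit.
Unset Printing Implicit Defensive.

Import Order.TTheory GRing.Theory Num.Theory.
Import numFieldNormedType.Exports.

Local Open Scope classical_set_scope.
Local Open Scope ring_scope.

(* [R[i]] as a bundled [numClosedFieldType]: this is what gives it, and the row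
   vectors over it, the topology of the complex modulus. *)
Definition Cplx (R : realType) : numClosedFieldType := R[i].

Section ThetaFunction.
Variable R : realType.
Local Notation C := (Cplx R).

Definition cexp (z : C) : C :=
  Complex (expR (complex.Re z) * cos (complex.Im z))
          (expR (complex.Re z) * sin (complex.Im z)).

Definition e2ipi (z : C) : C := cexp (2 * Complex 0 pi * z).

Definition theta_term (tau z : C) (k : int) : C :=
  (-1) ^ k * e2ipi (k%:~R * z + k%:~R * (k%:~R - 1) / 2 * tau).

(* The series over Z converges absolutely when [0 < Im tau]; its sum is taken
   here as the limit of the partial sums over [- N <= k < N]. *)
Definition theta (tau z : C) : C :=
  lim ((fun N : nat =>
    \sum_(k < N) (theta_term tau z k%:Z + theta_term tau z (- k.+1%:Z))) @ \oo).

Definition lattice (tau : C) : set C :=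
  [set z | exists p q : int, z = p%:~R + q%:~R * tau].

End ThetaFunction.

Section FSpaces.
Variables (R : realType) (n : nat) (tau c eta : Cplx R).
Local Notation C := (Cplx R).

Definition holomorphic (a : nat) (f : 'rV[C]_a -> C) : Prop :=
  forall z, differentiable f z.

(* The two last conditions concern the first variable only.  For [a = 0] they
   are void and every function on the one-point space qualifies, so that
   [Fspace 0] is C. *)
Definition Fspace (a : nat) : set ('rV[C]_a -> C) :=
  [set f | [/\ holomorphic f,
    forall (s : 'S_a) z, f (col_perm s z) = f z,
    forall (i : 'I_a) z, i = 0%N :> nat -> f (z + delta_mx 0 i) = f z &
    forall (i : 'I_a) z, i = 0%N :> nat ->
      f (z + tau *: delta_mx 0 i) =
      (-1) ^+ n * e2ipi (- (n%:R * z 0 i - c - (a%:R - 1) * n%:R * eta)) * f z]].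

Definition star_sum (a b : nat) (f : 'rV[C]_a -> C) (g : 'rV[C]_b -> C)
    (z : 'rV[C]_(a + b)) : C :=
  (a`! * b`!)%:R^-1 * \sum_(s : 'S_(a + b))
    (f (\row_i z 0 (s (lshift b i))) *
     g (\row_j (z 0 (s (rshift a j)) - 2 * a%:R * eta)) *
     \prod_(i < a) \prod_(j < b)
       (theta tau (z 0 (s (lshift b i)) - z 0 (s (rshift a j)) - n%:R * eta) /
        theta tau (z 0 (s (lshift b i)) - z 0 (s (rshift a j))))).

(* No denominator of [star_sum] vanishes at such points, the zeros of [theta tau]
   being exactly the lattice points. *)
Definition generic (m : nat) : set 'rV[C]_m :=
  [set z | forall i j, i != j -> ~ lattice tau (z 0 i - z 0 j)].

(* The poles of the summands along the divisors z_i - z_j in the lattice cancel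
   in the sum; as [star_sum] itself divides by zero there, the product is taken
   as its extension by limits along generic points. *)
Definition star (a b : nat) (f : 'rV[C]_a -> C) (g : 'rV[C]_b -> C)
    (z : 'rV[C]_(a + b)) : C :=
  lim (star_sum f g @ within (@generic (a + b)) (nbhs z)).

(* Elements of the direct sum of the spaces F_a: families of homogeneous
   components, almost all zero. *)
Definition family := forall a : nat, 'rV[C]_a -> C.

Definition dsum : set family :=
  [set u | (forall a, @Fspace a (u a)) /\
           exists N, forall a, (N <= a)%N -> forall z, u a z = 0].

Definition lincomb (x : C) (u v : family) : family :=
  fun a z => x * u a z + v a z.

(* Bilinear extension of [star]: the component of degree m is the sum of the
   [star (u k) (v (m - k))], transported along k + (m - k) = m. *)
Definition dsum_mul (u v : family) : family := fun m z =>
  \sum_(k < m.+1)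
    star (u k) (v (m - k)%N) (castmx (erefl, esym (subnKC (leq_ord k))) z).

End FSpaces.

(* Main.v *)
Require Import Defs.
From mathcomp Require Import ring lra zify.
Import Order.TTheory GRing.Theory Num.Theory.
Import numFieldNormedType.Exports.
Local Open Scope classical_set_scope.
Local Open Scope ring_scope.

Set Implicit Arguments.
Unset Strict Implicit.
Unset Printing Implicit Defensive.

(** Write [theta1 u = e(- u / 2) theta u] with [e = e2ipi]. This is an odd entire function
    with the zeros of [theta], and the product [vdm z] of the [theta1 (z_i - z_j)] over
    [i < j] is antisymmetric. Multiplying [star_sum f g] by [vdm] clears the denominators:
    the result [numer] is entire and antisymmetric ([numer_generic], [numer_col_perm]).
    Under a translation of one variable by [1] or [tau] all the summands of [numer] get one
    and the same multiplier ([cleared_shift]): in the quotients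
    [theta (u - n eta) / theta u] each translation by [tau] leaves a factor [e(n eta)] or its
    inverse, and these factors, together with the translation by [2 a eta] of the arguments
    of [g], turn the multipliers of [F_a] and [F_b] into the one of [F_(a+b)].
    An antisymmetric function vanishes where two variables coincide, hence [numer] vanishes
    on all the divisors [z_i - z_j] in the lattice ([numer_vanish]). As [theta] has simple
    zeros there, [numer] is the product of [vdm] and an entire function ([divide_pairs]),
    which agrees with [star_sum] at generic points and therefore is [star f g]; dividing the
    symmetries of [numer] by those of [vdm] puts it in [F_(a+b)] ([star_spec]).

    All the identities between products only have to be checked at generic points, which are
    dense ([eq_generic]). There both [(u * v) * w] and [u * (v * w)] are sums over
    permutations of all the variables and permutations of a block of consecutive ones; the
    latter are absorbed by the former ([sum_extend]), which leaves in both cases the same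
    symmetric expression in three blocks ([triple], [nest_left], [nest_right]).

    The complex analysis rests on a single integral theorem. Goursat's bisection argument,
    applied to [g o exp] on a parallelogram of height [2 pi], gives the mean value property
    on the unit circle for functions with a removable singularity at the centre
    ([mean_value]). Applied to difference quotients this expresses derivatives as integrals
    ([derive_mean]), which yields the differentiability of derivatives and of parameter
    integrals, Hadamard's lemma ([hadamard]), differentiability in several variables
    ([entire_differentiable]) and stability under uniform limits ([entire_limit]). That
    [theta] vanishes on the lattice only, and simply, follows from the lower bound
    [theta_lower], a consequence of the finite form [jacobi_finite] of the triple product,
    itself an instance of the q-binomial theorem. *)


(** * The modulus and limits of complex functions *)

Section ComplexTopology.
Variable R : realType.
Local Notation C := (Cplx R).
Local Notation Re := (@complex.Re R).
Local Notation Im := (@complex.Im R).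

Definition rc (x : R) : C := Complex x 0.

Lemma rcD x y : rc (x + y) = rc x + rc y.
Proof. by rewrite /rc; apply/eqP; rewrite eq_complex /= addr0 !eqxx. Qed.
Lemma rcN x : rc (- x) = - rc x.
Proof. by rewrite /rc; apply/eqP; rewrite eq_complex /= oppr0 !eqxx. Qed.
Lemma rcB x y : rc (x - y) = rc x - rc y.
Proof. by rewrite rcD rcN. Qed.
Lemma rcM x y : rc (x * y) = rc x * rc y.
Proof. by rewrite /rc; apply/eqP; rewrite eq_complex /= !mul0r !mulr0 subr0 addr0 !eqxx. Qed.
Lemma rc0 : rc 0 = 0. Proof. by []. Qed.
Lemma rc1 : rc 1 = 1. Proof. by []. Qed.
Lemma rcV x : rc x^-1 = (rc x)^-1.
Proof.
have [->|x0] := eqVneq x 0; first by rewrite invr0 rc0 invr0.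
apply: (@mulfI _ (rc x)); first by rewrite eq_complex /= negb_and x0.
by rewrite -rcM !mulfV// eq_complex /= negb_and x0.
Qed.
Lemma rcX x n : rc (x ^+ n) = rc x ^+ n.
Proof. by elim: n => [|n ih]; rewrite ?expr0// !exprS rcM ih. Qed.
Lemma rcn n : rc n%:R = n%:R.
Proof. by elim: n => [|n ih]//; rewrite !mulrS rcD ih. Qed.
Lemma lec_rc x y : (rc x <= rc y) = (x <= y).
Proof. exact: lecR. Qed.
Lemma ltc_rc x y : (rc x < rc y) = (x < y).
Proof. exact: ltcR. Qed.

Lemma gt0_rcP (e : C) : 0 < e -> exists2 e', 0 < e' & e = rc e'.
Proof.
case: e => a b; rewrite ltcE /= => /andP[/eqP -> a0]; by exists a.
Qed.

Lemma ReD (z w : C) : Re (z + w) = Re z + Re w. Proof. by case: z; case: w. Qed.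
Lemma ImD (z w : C) : Im (z + w) = Im z + Im w. Proof. by case: z; case: w. Qed.
Lemma ReN (z : C) : Re (- z) = - Re z. Proof. by case: z. Qed.
Lemma ImN (z : C) : Im (- z) = - Im z. Proof. by case: z. Qed.
Lemma ReM (z w : C) : Re (z * w) = Re z * Re w - Im z * Im w.
Proof. by case: z; case: w. Qed.
Lemma ImM (z w : C) : Im (z * w) = Re z * Im w + Im z * Re w.
Proof. by case: z; case: w. Qed.

(** The norm of C is C-valued; estimates need a value in an ordered field. *)
Definition mod_ (z : C) : R := Re `|z|.

Lemma modE z : `|z| = rc (mod_ z).
Proof. by apply/esym; exact: (RRe_real (normr_real _)). Qed.
Lemma mod_ge0 z : 0 <= mod_ z.
Proof. by rewrite -lec_rc -modE normr_ge0. Qed.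
Lemma modD z w : mod_ (z + w) <= mod_ z + mod_ w.
Proof. by rewrite -lec_rc rcD -!modE ler_normD. Qed.
Lemma modM z w : mod_ (z * w) = mod_ z * mod_ w.
Proof. by apply: (@complexI R); rewrite -![real_complex_def _ _]/(rc _) rcM -!modE normrM. Qed.
Lemma modN z : mod_ (- z) = mod_ z.
Proof. by rewrite /mod_ normrN. Qed.
Lemma modB z w : mod_ (z - w) <= mod_ z + mod_ w.
Proof. by rewrite -(modN w) modD. Qed.
Lemma mod_distC z w : mod_ (z - w) = mod_ (w - z).
Proof. by rewrite -modN opprB. Qed.
Lemma mod0 : mod_ 0 = 0.
Proof. by rewrite /mod_ normr0. Qed.
Lemma mod1 : mod_ 1 = 1.
Proof. by rewrite /mod_ normr1. Qed.
Lemma mod_eq0 z : (mod_ z == 0) = (z == 0).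
Proof. by rewrite -(normr_eq0 z) modE -(inj_eq (@complexI R)). Qed.
Lemma mod_gt0 z : (0 < mod_ z) = (z != 0).
Proof. by rewrite lt_neqAle mod_ge0 andbT eq_sym mod_eq0. Qed.
Lemma modV z : mod_ z^-1 = (mod_ z)^-1.
Proof. by apply: (@complexI R); rewrite -![real_complex_def _ _]/(rc _) rcV -!modE normfV. Qed.
Lemma modX z n : mod_ (z ^+ n) = mod_ z ^+ n.
Proof. by elim: n => [|n ih]; rewrite ?expr0 ?mod1// !exprS modM ih. Qed.
Lemma mod_rc x : mod_ (rc x) = `|x|.
Proof. by rewrite /mod_ normc_def /= expr0n /= addr0 sqrtr_sqr. Qed.
Lemma mod_dist_ge z w : mod_ z - mod_ w <= mod_ (z - w).
Proof. by rewrite lerBlDr -{1}(subrK w z) modD. Qed.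
Lemma mod_sum (I : Type) (r : seq I) (P : pred I) (F : I -> C) :
  mod_ (\sum_(i <- r | P i) F i) <= \sum_(i <- r | P i) mod_ (F i).
Proof.
elim/big_rec2: _ => [|i x y _ h]; first by rewrite mod0.
by apply: le_trans (modD _ _) _; rewrite lerD2l.
Qed.
Lemma mod_prod (I : Type) (r : seq I) (P : pred I) (F : I -> C) :
  mod_ (\prod_(i <- r | P i) F i) = \prod_(i <- r | P i) mod_ (F i).
Proof. by elim/big_rec2: _ => [|i x y _ h]; rewrite ?mod1// modM h. Qed.

Lemma Re_le_mod z : `|Re z| <= mod_ z.
Proof. by rewrite -lec_rc -modE; exact: (normc_ge_Re z). Qed.
Lemma Im_le_mod z : `|Im z| <= mod_ z.
Proof.
have := Re_le_mod (- (Complex 0 1 * z)); rewrite modN modM ReN ReM /=.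
by rewrite mul0r mul1r add0r opprK /mod_ normc_def /= expr0n expr1n add0r sqrtr1 mul1r.
Qed.
Lemma mod_le_ReIm z : mod_ z <= `|Re z| + `|Im z|.
Proof.
have -> : z = rc (Re z) + Complex 0 1 * rc (Im z).
  by case: z => a b; rewrite /rc; apply/eqP; rewrite eq_complex /=
    !(mul0r, mul1r, mulr0, subr0, addr0, add0r) !eqxx.
apply: le_trans (modD _ _) _; rewrite modM !mod_rc ReD ImD ReM ImM /=.
rewrite /mod_ normc_def /= expr0n expr1n add0r sqrtr1 /=.
by rewrite !(mul0r, mulr0, mul1r, subr0, addr0, add0r).
Qed.

Lemma cvgCP (T : Type) (F : set_system T) {FF : Filter F} (f : T -> C) (l : C) :
  f @ F --> l <-> forall e : R, 0 < e -> \forall x \near F, mod_ (f x - l) < e.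
Proof.
split=> [/cvgrPdist_lt h e e0|h].
  have := h (rc e); rewrite ltc_rc => /(_ e0); apply: filterS => x.
  by rewrite distrC modE ltc_rc.
apply/cvgrPdist_lt => _ /gt0_rcP[e e0 ->]; have := h e e0.
by apply: filterS => x; rewrite distrC modE ltc_rc.
Qed.

Lemma continuous_Re : continuous (Re : C -> R).
Proof.
move=> z; apply: (proj2 (@cvgrPdist_lt _ _ _ _ (nbhs_filter z) _ _)) => e e0; near=> w.
apply: le_lt_trans (_ : mod_ (w - z) < e).
  by rewrite distrC -ReN -ReD Re_le_mod.
by near: w; apply: (proj1 (@cvgCP _ _ (nbhs_filter z) id z)).
Unshelve. all: end_near. Qed.

Lemma continuous_Im : continuous (Im : C -> R).
Proof.
move=> z; apply: (proj2 (@cvgrPdist_lt _ _ _ _ (nbhs_filter z) _ _)) => e e0; near=> w.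
apply: le_lt_trans (_ : mod_ (w - z) < e).
  by rewrite distrC -ImN -ImD Im_le_mod.
by near: w; apply: (proj1 (@cvgCP _ _ (nbhs_filter z) id z)).
Unshelve. all: end_near. Qed.

Lemma cvg_Complex (T : Type) (F : set_system T) {FF : Filter F} (f g : T -> R) (a b : R) :
  f @ F --> a -> g @ F --> b -> (fun x => Complex (f x) (g x) : C) @ F --> (Complex a b : C).
Proof.
move=> /cvgrPdist_lt fa /cvgrPdist_lt gb; apply/cvgCP => e e0.
have e2 : 0 < e / 2 by rewrite divr_gt0.
near=> x; apply: le_lt_trans (mod_le_ReIm _) _.
rewrite [e]splitr ltrD// distrC; near: x; [exact: fa|exact: gb].
Unshelve. all: end_near. Qed.

Lemma continuous_rc : continuous rc.
Proof. by move=> x; apply: cvg_Complex; [exact: cvg_id|exact: cvg_cst]. Qed.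

Lemma ReIm_eq (z w : C) : Re z = Re w -> Im z = Im w -> z = w.
Proof. by case: z; case: w => a b c d /= -> ->. Qed.

End ComplexTopology.

(** * Integration over the unit interval *)

Section UnitIntegral.
Variable R : realType.
Local Notation C := (Cplx R).
Local Notation Re := (@complex.Re R).
Local Notation Im := (@complex.Im R).

(** A condition on the unit interval alone would not make sense at its end points,
    derivatives being two-sided. *)
Definition primitive (F f : R -> R) :=
  forall t : R, -1 < t < 2 -> is_derive t 1 F (f t).

Lemma primitive_exists (f : R -> R) (cf : continuous f) : exists F, primitive F f.
Proof.
exists (fun x => \int[lebesgue_measure]_(t in [set` `[(-2 : R), x] ]) f t)%R.
move=> t /andP[t1 t2].
have ft : {for t, continuous f} by exact: cf.
have it : lebesgue_measure.-integrable [set` `[(-2 : R), 2] ] (EFin \o f).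
  apply: continuous_compact_integrable; first exact: segment_compact.
  exact: continuous_subspaceT.
have lt : (BLeft ((-2)%R : R) < BRight t)%E by rewrite lte_fin; lra.
have [d e] := continuous_FTC1 t2 it lt ft.
exact: (DeriveDef d (etrans (esym (derive1E _ _)) e)).
Qed.

Lemma primitive_bound (F f : R -> R) M : primitive F f ->
  (forall t, 0 <= t <= 1 -> `|f t| <= M) -> `|F 1 - F 0| <= M.
Proof.
move=> Ff fM.
have [x||c] := @MVT R F f 0 1 ltr01.
- by rewrite in_itv /= => /andP[? ?]; apply: Ff; lra.
- apply: derivable_within_continuous => x; rewrite in_itv /= => /andP[? ?].
  by apply: (@ex_derive _ _ _ _ _ _ (f x)); apply: Ff; lra.
rewrite in_itv /= => /andP[c0 c1] ->.
by rewrite subr0 mulr1; apply: fM; lra.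
Qed.

Lemma primitive_unique (F G f : R -> R) : primitive F f -> primitive G f ->
  F 1 - F 0 = G 1 - G 0.
Proof.
move=> Ff Gf; apply/eqP; rewrite -subr_eq0 -normr_le0.
have -> : F 1 - F 0 - (G 1 - G 0) = (F - G) 1 - (F - G) 0 by rewrite !fctE; ring.
apply: (@primitive_bound _ (fun=> 0)) => [t ht|t _]; last by rewrite normr0.
have := Ff t ht; have := Gf t ht => h1 h2.
by rewrite -(subrr (f t)); exact: is_deriveB.
Qed.

(** The integral over the unit interval as the increment of any primitive: its rules
    then are those of differentiation. *)
Definition rint01 (f : R -> R) : R := let F := xget (fun=> 0) [set F | primitive F f] in F 1 - F 0.

Lemma rint01_prim (F f : R -> R) : primitive F f -> rint01 f = F 1 - F 0.
Proof.
move=> Ff; apply: (@primitive_unique _ _ f) => //.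
by case: (xgetP (fun=> 0) [set F | primitive F f]) => [G _ hG|nF]; [exact: hG|case: (nF F Ff)].
Qed.

Lemma rint01D (f g : R -> R) : continuous f -> continuous g -> rint01 (fun t => f t + g t) =
  rint01 f + rint01 g.
Proof.
move=> /primitive_exists[F Ff] /primitive_exists[G Gg].
rewrite (rint01_prim Ff) (rint01_prim Gg) (@rint01_prim (F + G)) ?fctE; first ring.
move=> t ht; have h1 := Ff t ht; have h2 := Gg t ht; exact: is_deriveD.
Qed.

Lemma rint01Z k (f : R -> R) : continuous f -> rint01 (fun t => k * f t) = k * rint01 f.
Proof.
move=> /primitive_exists[F Ff].
rewrite (rint01_prim Ff) (@rint01_prim (k \*: F)) /= ?fctE; first by rewrite mulrBr.
by move=> t ht; have h1 := Ff t ht; apply: is_deriveZ.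
Qed.

Lemma rint01_bound (f : R -> R) M : continuous f -> (forall t, 0 <= t <= 1 -> `|f t| <= M) ->
  `|rint01 f| <= M.
Proof.
by move=> /primitive_exists[F Ff] h; rewrite (rint01_prim Ff); apply: primitive_bound Ff h.
Qed.

Lemma rint01_split (f : R -> R) : continuous f ->
  rint01 f = 2^-1 * (rint01 (fun t => f (2^-1 * t)) + rint01 (fun t => f (2^-1 * t + 2^-1))).
Proof.
move=> /primitive_exists[F Ff]; rewrite (rint01_prim Ff).
have h b (G := (2 \*: (F \o (fun t => 2^-1 * t + b)))) :
    b \in `[0, 2^-1] -> primitive G (fun t => f (2^-1 * t + b)).
  rewrite in_itv /= => /andP[b0 b1] t /andP[t1 t2].
  have h1 : is_derive t (1 : R) (fun t : R => 2^-1 * t + b) 2^-1.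
    have e : 2^-1 = 2^-1 *: 1 + 0 :> R by rewrite addr0 /GRing.scale /= mulr1.
    rewrite [X in is_derive _ _ _ X]e.
    exact: (@is_deriveD _ _ _ (2^-1 \*: id) (cst b)).
  have -> : f (2^-1 * t + b) = 2 * (f (2^-1 * t + b) * 2^-1) by field.
  apply: is_deriveZ; apply: is_derive1_comp => //=.
  by apply: Ff; apply/andP; split; lra.
have p0 : primitive (2 \*: (F \o (fun t => 2^-1 * t + 0))) (fun t => f (2^-1 * t)).
  by rewrite (_ : (fun t => f _) = fun t => f (2^-1 * t + 0)); [apply: h;
    rewrite in_itv /= lexx invr_ge0 ler0n|apply/funext => t; rewrite addr0].
have p1 : primitive (2 \*: (F \o (fun t => 2^-1 * t + 2^-1))) (fun t => f (2^-1 * t + 2^-1)).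
  by apply: h; rewrite in_itv /= lexx invr_ge0 ler0n.
rewrite (rint01_prim p0) (rint01_prim p1) /= /GRing.scale /= !mulr1 !mulr0 !addr0 !add0r.
have -> : 2^-1 + 2^-1 = 1 :> R by lra.
by field.
Qed.

Definition cint01 (f : R -> C) : C := Complex (rint01 (Re \o f)) (rint01 (Im \o f)).

Lemma cRe (f : R -> C) : continuous f -> continuous (Re \o f).
Proof. by move=> cf t; apply: (cvg_comp _ _ (cf t) (@continuous_Re R (f t))). Qed.
Lemma cIm (f : R -> C) : continuous f -> continuous (Im \o f).
Proof. by move=> cf t; apply: (cvg_comp _ _ (cf t) (@continuous_Im R (f t))). Qed.

Lemma cint01D (f g : R -> C) : continuous f -> continuous g -> cint01 (fun t => f t + g t) =
  cint01 f + cint01 g.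
Proof.
move=> cf cg; rewrite /cint01; apply: ReIm_eq; rewrite ?ReD ?ImD /=.
  rewrite -rint01D; [|exact: cRe|exact: cRe].
  by congr rint01; apply/funext => t /=; rewrite ReD.
rewrite -rint01D; [|exact: cIm|exact: cIm].
by congr rint01; apply/funext => t /=; rewrite ImD.
Qed.

Lemma cint01Z k (f : R -> C) : continuous f -> cint01 (fun t => k * f t) = k * cint01 f.
Proof.
move=> cf; rewrite /cint01; have cr := cRe cf; have ci := cIm cf.
have crZ a : continuous (fun t => a * (Re \o f) t).
  by move=> t; apply: cvgM; [exact: cvg_cst|exact: cr].
have ciZ a : continuous (fun t => a * (Im \o f) t).
  by move=> t; apply: cvgM; [exact: cvg_cst|exact: ci].
apply: ReIm_eq; rewrite ?ReM ?ImM /=.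
  rewrite -mulNr -!rint01Z// -rint01D//.
  by congr rint01; apply/funext => t /=; rewrite ReM mulNr.
rewrite -!rint01Z// -rint01D//.
by congr rint01; apply/funext => t /=; rewrite ImM.
Qed.

Lemma cint01N (f : R -> C) : continuous f -> cint01 (fun t => - f t) = - cint01 f.
Proof.
move=> cf; rewrite -mulN1r -cint01Z//; congr cint01; apply/funext => t; by rewrite mulN1r.
Qed.

Lemma cint01B (f g : R -> C) : continuous f -> continuous g -> cint01 (fun t => f t - g t) =
  cint01 f - cint01 g.
Proof.
move=> cf cg; rewrite -(cint01N cg); apply: (cint01D cf) => t.
exact: (@cvgN _ _ _ _ (nbhs_filter t) _ _ (cg t)).
Qed.

(** The two components are estimated separately, whence the factor [2]. *)
Lemma cint01_bound (f : R -> C) M : continuous f ->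
  (forall t, 0 <= t <= 1 -> mod_ (f t) <= M) -> mod_ (cint01 f) <= 2 * M.
Proof.
move=> cf h; apply: le_trans (mod_le_ReIm _) _; rewrite mulr_natl mulr2n.
apply: lerD; apply: rint01_bound.
- exact: cRe.
- by move=> t /h; apply: le_trans; exact: Re_le_mod.
- exact: cIm.
- by move=> t /h; apply: le_trans; exact: Im_le_mod.
Qed.

Lemma cint01_split (f : R -> C) : continuous f ->
  cint01 f = 2^-1 * (cint01 (fun t => f (2^-1 * t)) + cint01 (fun t => f (2^-1 * t + 2^-1))).
Proof.
move=> cf; rewrite /cint01 -(rcn R 2) -rcV; apply: ReIm_eq;
  rewrite ?ReM ?ImM /= ?mul0r ?subr0 ?addr0.
  exact: rint01_split (cRe cf).
exact: rint01_split (cIm cf).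
Qed.

Lemma cint01_cst k : cint01 (fun=> k) = k.
Proof.
have h x : rint01 (fun=> x) = x.
  rewrite (@rint01_prim (x \*: id)) /= ?fctE; first by rewrite /GRing.scale /= mulr1 mulr0 subr0.
  move=> t _; rewrite -[X in is_derive _ _ _ X]mulr1.
  exact: (@is_deriveZ _ _ _ id).
by case: k => a b; rewrite /cint01 /comp /= !h.
Qed.

(** Stated on components, since C is a normed space over itself while the variable is
    real. *)
Definition cprim (F f : R -> C) := forall t : R,
  is_derive t 1 (Re \o F) (Re (f t)) /\ is_derive t 1 (Im \o F) (Im (f t)).

Lemma cint01_prim F f : cprim F f -> cint01 f = F 1 - F 0.
Proof.
move=> h; rewrite /cint01; apply: ReIm_eq; rewrite ?ReD ?ImD ?ReN ?ImN /=.
  by apply: (@rint01_prim (Re \o F)) => t _; have [] := h t.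
by apply: (@rint01_prim (Im \o F)) => t _; have [] := h t.
Qed.

End UnitIntegral.

Section Curves.
Variable R : realType.
Local Notation C := (Cplx R).
Local Notation Re := (@complex.Re R).
Local Notation Im := (@complex.Im R).

Lemma rc_dnbhs0 : @rc R @ 0^' --> (0 : C)^'.
Proof.
move=> A; rewrite /dnbhs /= => -[e /gt0_rcP[e' e'0 ->] h].
exists e' => //= x; rewrite /ball_ /= sub0r normrN => xe x0.
apply: h => /=; last by apply: contra_neq x0; case.
by rewrite sub0r normrN modE mod_rc ltc_rc.
Qed.

Lemma curve_derive (V : normedModType C) (f : V -> C) (z v : V) (d : V -> C) :
  (forall x, is_derive x v f (d x)) ->
  cprim (fun t => f (z + rc t *: v)) (fun t => d (z + rc t *: v)).
Proof.
move=> h t.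
pose x := z + rc t *: v.
have hx : h0^-1 *: (f (h0 *: v + x) - f x) @[h0 --> (0 : C)^'] --> d x.
  have [dx] := h x; rewrite /derive => <-.
  exact/cvg_ex/cvg_ex/cvg_cst || exact: dx.
have hr : (rc h0)^-1 *: (f (rc h0 *: v + x) - f x) @[h0 --> (0 : R)^'] --> d x.
  exact: (cvg_comp _ _ rc_dnbhs0 hx).
have xE h0 : z + rc (h0 *: 1 + t) *: v = rc h0 *: v + x.
  have -> : h0 *: 1 = h0 :> R by rewrite /GRing.scale /= mulr1.
  by rewrite rcD scalerDl /x addrCA.
have hre : h0^-1 *: ((Re \o (fun t => f (z + rc t *: v))) (h0 *: 1 + t) -
    (Re \o (fun t => f (z + rc t *: v))) t) @[h0 --> (0 : R)^'] --> Re (d x).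
  have := cvg_comp _ _ hr (@continuous_Re R (d x)).
  apply: cvg_trans; apply: near_eq_cvg; apply: nearW => h0 /=.
  by rewrite xE -rcV ReM /= mul0r subr0 ReD ReN.
have him : h0^-1 *: ((Im \o (fun t => f (z + rc t *: v))) (h0 *: 1 + t) -
    (Im \o (fun t => f (z + rc t *: v))) t) @[h0 --> (0 : R)^'] --> Im (d x).
  have := cvg_comp _ _ hr (@continuous_Im R (d x)).
  apply: cvg_trans; apply: near_eq_cvg; apply: nearW => h0 /=.
  by rewrite xE -rcV ImM /= mul0r addr0 ImD ImN.
split; apply: DeriveDef.
- by apply/cvg_ex; exists (Re (d x)).
- exact/cvg_lim.
- by apply/cvg_ex; exists (Im (d x)).
- exact/cvg_lim.
Qed.

End Curves.

(** * Continuity rules and parameter integrals *)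

Section Continuity.
Variable R : realType.
Local Notation C := (Cplx R).

Lemma ccvgD (T : Type) (F : set_system T) {FF : Filter F} (f g : T -> C) (a b : C) : f @ F -->
  a -> g @ F --> b -> (fun x => f x + g x) @ F --> a + b.
Proof. exact: cvgD. Qed.
Lemma ccvgN (T : Type) (F : set_system T) {FF : Filter F} (f : T -> C) (a : C) : f @ F --> a ->
  (fun x => - f x) @ F --> - a.
Proof. exact: cvgN. Qed.
Lemma ccvgB (T : Type) (F : set_system T) {FF : Filter F} (f g : T -> C) (a b : C) : f @ F -->
  a -> g @ F --> b -> (fun x => f x - g x) @ F --> a - b.
Proof. exact: cvgB. Qed.
Lemma ccvgM (T : Type) (F : set_system T) {FF : Filter F} (f g : T -> C) (a b : C) : f @ F -->
  a -> g @ F --> b -> (fun x => f x * g x) @ F --> a * b.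
Proof. exact: cvgM. Qed.
Lemma ccvgV (T : Type) (F : set_system T) {FF : Filter F} (f : T -> C) (a : C) : a != 0 ->
  f @ F --> a -> (fun x => (f x)^-1) @ F --> a^-1.
Proof. exact: cvgV. Qed.

Lemma ccvg_sum (T : Type) (F : set_system T) {FF : Filter F} (I : Type) (r : seq I)
    (f : I -> T -> C) (l : I -> C) : (forall i, f i @ F --> l i) ->
  (fun x => \sum_(i <- r) f i x) @ F --> \sum_(i <- r) l i.
Proof.
move=> h; elim: r => [|i r ih].
  rewrite big_nil (_ : (fun x => _) = fun=> 0); first exact: cvg_cst.
  by apply/funext => x; rewrite big_nil.
rewrite big_cons (_ : (fun x => _) = fun x => f i x + \sum_(j <- r) f j x).
  exact: ccvgD (h i) ih.
by apply/funext => x; rewrite big_cons.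
Qed.

Section Functions.
Variable T : topologicalType.
Implicit Types f g : T -> C.

Lemma contD f g : continuous f -> continuous g -> continuous (fun x => f x + g x).
Proof. by move=> cf cg x; apply: ccvgD; [exact: cf|exact: cg]. Qed.
Lemma contN f : continuous f -> continuous (fun x => - f x).
Proof. by move=> cf x; apply: ccvgN; exact: cf. Qed.
Lemma contB f g : continuous f -> continuous g -> continuous (fun x => f x - g x).
Proof. by move=> cf cg x; apply: ccvgB; [exact: cf|exact: cg]. Qed.
Lemma contM f g : continuous f -> continuous g -> continuous (fun x => f x * g x).
Proof. by move=> cf cg x; apply: ccvgM; [exact: cf|exact: cg]. Qed.
Lemma cont_cst (k : C) : continuous (fun _ : T => k).
Proof. by move=> x; exact: cvg_cst. Qed.
Lemma cont_comp (U W : topologicalType) (h : U -> W) (k : T -> U) :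
  continuous h -> continuous k -> continuous (fun x => h (k x)).
Proof. by move=> ch ck x; apply: (cvg_comp _ _ (ck x) (ch (k x))). Qed.
Lemma cont_pair (U W : topologicalType) (h : T -> U) (k : T -> W) :
  continuous h -> continuous k -> continuous (fun x => (h x, k x)).
Proof. by move=> ch ck x; apply: cvg_pair; [exact: ch|exact: ck]. Qed.
End Functions.

Lemma cont_fst (U W : topologicalType) : continuous (fun p : U * W => p.1).
Proof. by move=> p; exact: cvg_fst. Qed.
Lemma cont_snd (U W : topologicalType) : continuous (fun p : U * W => p.2).
Proof. by move=> p; exact: cvg_snd. Qed.
Lemma cont_id (U : topologicalType) : continuous (fun p : U => p).
Proof. by move=> p; exact: cvg_id. Qed.

(** Compactness of the unit interval makes the convergence of the integrands uniform. *)
Lemma cint01_continuous (T : topologicalType) (F : R * T -> C) : continuous F ->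
  continuous (fun x => cint01 (fun t => F (t, x))).
Proof.
move=> cF x0; have cFx x : continuous (fun t => F (t, x)).
  exact: (cont_comp cF (cont_pair (@cont_id R) (fun t => cvg_cst x))).
apply/cvgCP => e e0; have e4 : 0 < e / 6 by rewrite divr_gt0.
have [cov _] := compact_near_coveringP (`[0, 1]%classic : set R).
have /cov := @segment_compact R 0 1.
move=> /(_ T (nbhs x0) (fun x t => mod_ (F (t, x) - F (t, x0)) < e / 3) (nbhs_filter x0)) h.
have {}h : \forall x \near x0, `[0, 1]%classic `<=` (fun t => mod_ (F (t, x) - F (t, x0)) < e / 3).
  apply: h => t _.
  have h1 : \forall p \near (t, x0), mod_ (F p - F (t, x0)) < e / 6.
    exact: (proj1 (cvgCP _ _) (cF (t, x0))).
  have h2 : \forall s \near t, mod_ (F (s, x0) - F (t, x0)) < e / 6.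
    exact: (proj1 (cvgCP _ _) (cFx x0 t)).
  have h3 : \forall p \near (t, x0), mod_ (F (p.1, x0) - F (t, x0)) < e / 6.
    exact: (cvg_fst h2).
  near=> p; rewrite -(subrKA (F (t, x0))).
  apply: le_lt_trans (modD _ _) _.
  rewrite (_ : e / 3 = e / 6 + e / 6); last by field.
  apply: ltrD; last rewrite mod_distC.
    by rewrite -surjective_pairing; near: p.
  by near: p.
near=> x.
have hx : `[0, 1]%classic `<=` (fun t => mod_ (F (t, x) - F (t, x0)) < e / 3) by near: x.
rewrite -cint01B//.
apply: le_lt_trans (_ : 2 * (e / 3) < e); last by lra.
apply: cint01_bound; first exact: contB.
by move=> t t01; apply/ltW/hx; rewrite /= in_itv.
Unshelve. all: end_near. Qed.

End Continuity.

(** * Goursat's lemma for parallelograms *)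

Section Goursat.
Variable R : realType.
Local Notation C := (Cplx R).

Lemma cont_line (a u : C) : continuous (fun t : R => a + rc t * u).
Proof.
apply: contD; first exact: cont_cst.
apply: contM; [exact: continuous_rc|exact: cont_cst].
Qed.

(** The integrals of [f] along the segment from [a] to [a + u] and, below, along the
    boundary of the parallelogram with vertex [a] and sides [u] and [v]. *)
Definition segI (f : C -> C) (a u : C) : C := u * cint01 (fun t => f (a + rc t * u)).

Definition boundI (f : C -> C) (a u v : C) : C :=
  segI f a u + segI f (a + u) v - segI f (a + v) u - segI f a v.

Lemma segI_split (f : C -> C) a u : continuous f ->
  segI f a u = segI f a (2^-1 * u) + segI f (a + 2^-1 * u) (2^-1 * u).
Proof.
move=> cf; rewrite /segI (cint01_split (cont_comp cf (@cont_line a u))).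
rewrite mulrA [u * _]mulrC mulrDr; congr (_ * cint01 _ + _ * cint01 _); apply/funext => t; congr f.
  by rewrite rcM rcV rcn; ring.
by rewrite rcD rcM rcV rcn; ring.
Qed.

(** The inner sides of the four quarters are travelled twice, in opposite directions. *)
Lemma boundI_split (f : C -> C) a u v (u' := 2^-1 * u) (v' := 2^-1 * v) : continuous f ->
  boundI f a u v = boundI f a u' v' + boundI f (a + u') u' v' +
    boundI f (a + v') u' v' + boundI f (a + u' + v') u' v'.
Proof.
move=> cf; rewrite /boundI (segI_split a u)// (segI_split (a + u) v)//
  (segI_split (a + v) u)// (segI_split a v)// -/u' -/v'.
have uE : u = u' + u' by rewrite /u'; field.
have vE : v = v' + v' by rewrite /v'; field.
have -> : a + u = a + u' + u' by rewrite uE addrA.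
have -> : a + v = a + v' + v' by rewrite vE addrA.
have -> : a + v' + v' + u' = a + u' + v' + v' by ring.
have -> : a + u' + u' + v' = a + u' + v' + u' by ring.
have -> : a + v' + u' = a + u' + v' by ring.
ring.
Qed.

Lemma segIB (f g : C -> C) a u : continuous f -> continuous g ->
  segI (fun z => f z - g z) a u = segI f a u - segI g a u.
Proof.
move=> cf cg; rewrite /segI -mulrBr; congr (_ * _).
exact: (cint01B (cont_comp cf (@cont_line a u)) (cont_comp cg (@cont_line a u))).
Qed.

Lemma boundIB (f g : C -> C) a u v : continuous f -> continuous g ->
  boundI (fun z => f z - g z) a u v = boundI f a u v - boundI g a u v.
Proof. by move=> cf cg; rewrite /boundI !segIB//; ring. Qed.

Lemma cont_affine (p q : C) : continuous (fun z : C => p + q * z).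
Proof.
apply: contD; first exact: cont_cst.
apply: contM; [exact: cont_cst|exact: cont_id].
Qed.

(** An affine function has a primitive, so its integrals around closed contours
    vanish. *)
Lemma boundI_affine p q a u v : boundI (fun z => p + q * z) a u v = 0.
Proof.
have h b w : segI (fun z => p + q * z) b w = w * (p + q * b + q * w * cint01 (@rc R)).
  rewrite /segI; congr (_ * _).
  rewrite -(cint01Z (q * w) (@continuous_rc R)) -[X in X + _](cint01_cst (p + q * b)) -cint01D.
  - by congr cint01; apply/funext => t; ring.
  - exact: cont_cst.
  - by apply: contM; [exact: cont_cst|exact: continuous_rc].
by rewrite /boundI !h; ring.
Qed.

Lemma segI_bound (f : C -> C) a u M : continuous f ->
  (forall t, 0 <= t <= 1 -> mod_ (f (a + rc t * u)) <= M) -> mod_ (segI f a u) <= 2 * M * mod_ u.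
Proof.
move=> cf h; rewrite /segI modM mulrC; apply: ler_wpM2r; first exact: mod_ge0.
by apply: cint01_bound h; exact: (cont_comp cf (@cont_line a u)).
Qed.

Lemma boundI_bound (f : C -> C) a u v M : continuous f ->
  (forall s t, 0 <= s <= 1 -> 0 <= t <= 1 -> mod_ (f (a + rc s * u + rc t * v)) <= M) ->
  mod_ (boundI f a u v) <= 4 * M * (mod_ u + mod_ v).
Proof.
move=> cf h; have i0 : 0 <= (0 : R) <= 1 by rewrite lexx ler01.
have i1 : 0 <= (1 : R) <= 1 by rewrite lexx ler01.
have h1 : mod_ (segI f a u) <= 2 * M * mod_ u.
  apply: segI_bound => // t t01; have := h t 0 t01 i0; by rewrite rc0 mul0r addr0.
have h2 : mod_ (segI f (a + u) v) <= 2 * M * mod_ v.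
  apply: segI_bound => // t t01; have := h 1 t i1 t01; by rewrite rc1 mul1r.
have h3 : mod_ (segI f (a + v) u) <= 2 * M * mod_ u.
  by apply: segI_bound => // t t01; have := h t 1 t01 i1; rewrite rc1 mul1r addrAC.
have h4 : mod_ (segI f a v) <= 2 * M * mod_ v.
  apply: segI_bound => // t t01; have := h 0 t i0 t01; by rewrite rc0 mul0r addr0.
rewrite /boundI; apply: le_trans (modB _ _) _.
apply: le_trans (lerD (modB _ _) (lexx _)) _.
apply: le_trans (lerD (lerD (modD _ _) (lexx _)) (lexx _)) _.
lra.
Qed.

Lemma nested_intervals (x : nat -> R) (l : nat -> R) :
  (forall n, 0 <= l n) -> (forall n, x n <= x n.+1) ->
  (forall n, x n.+1 + l n.+1 <= x n + l n) ->
  exists y, forall n, x n <= y <= x n + l n.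
Proof.
move=> l0 xi xd.
have xm m n : (m <= n)%N -> x m <= x n.
  by elim: n => [|n ih]; [rewrite leqn0 => /eqP ->|rewrite leq_eqVlt => /orP[/eqP -> //|/ih h];
    exact: le_trans h (xi n)].
have ym m n : (m <= n)%N -> x n + l n <= x m + l m.
  by elim: n => [|n ih]; [rewrite leqn0 => /eqP ->|rewrite leq_eqVlt => /orP[/eqP -> //|/ih h];
    exact: le_trans (xd n) h].
have ub n : ubound (range x) (x n + l n).
  move=> _ [m _ <-]; have [mn|/ltnW nm] := leqP m n.
    by apply: le_trans (xm _ _ mn) _; rewrite lerDl.
  by apply: le_trans _ (ym _ _ nm); rewrite lerDl.
exists (sup (range x)) => n; apply/andP; split.
  by apply: ub_le_sup; [exists (x 0 + l 0); exact: ub|exists n].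
by apply: ge_sup; [exists (x 0); exists 0|exact: ub].
Qed.

Lemma derivable_remainder (f : C -> C) (p : C) : derivable f p 1 ->
  exists d : C, forall e : R, 0 < e -> exists2 r : R, 0 < r &
    forall z, mod_ (z - p) < r -> mod_ (f z - f p - d * (z - p)) <= e * mod_ (z - p).
Proof.
move=> /cvg_ex[/= d hd]; exists d => e e0.
have := proj1 (cvgCP _ _) hd e e0.
move=> [r0 /= /gt0_rcP[r r_gt0 ->] hr]; exists r => // z zr.
have [->|zp] := eqVneq z p; first by rewrite !subrr mulr0 subr0 mod0 mulr0.
have zp0 : z - p != 0 by rewrite subr_eq0.
have := hr (z - p); rewrite /ball_ /= sub0r normrN modE ltc_rc => /(_ zr zp0).
rewrite /GRing.scale /= mulr1 subrK => h.
have -> : f z - f p - d * (z - p) = ((z - p)^-1 * (f z - f p) - d) * (z - p).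
  by field.
by rewrite modM ler_wpM2r ?mod_ge0// ltW.
Qed.

Section Bisection.
Variables (f : C -> C) (a u v : C).
Hypothesis cf : continuous f.

Let vertex (p : R * R) : C := a + rc p.1 * u + rc p.2 * v.
Let piece n (p : R * R) : R := mod_ (boundI f (vertex p) (2^-1 ^+ n * u) (2^-1 ^+ n * v)).

(** If all four quarters had a smaller integral, they would add up to less than the
    whole. *)
Lemma bisection_step n p : exists q : R * R,
  [/\ q.1 = p.1 \/ q.1 = p.1 + 2^-1 ^+ n.+1, q.2 = p.2 \/ q.2 = p.2 + 2^-1 ^+ n.+1 &
      piece n p <= 4 * piece n.+1 q].
Proof.
pose h : R := 2^-1 ^+ n.+1.
have hE : rc h = 2^-1 ^+ n.+1 by rewrite rcX rcV rcn.
apply: contrapT => no.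
have lt i j : piece n.+1 (p.1 + (if i then h else 0), p.2 + (if j then h else 0)) < 4^-1 * piece n
  p.
  rewrite ltNge; apply/negP => le; apply: no.
  exists (p.1 + (if i then h else 0), p.2 + (if j then h else 0)); split => /=.
  - by case: i {le}; [right|left; rewrite addr0].
  - by case: j {le}; [right|left; rewrite addr0].
  - by lra.
have := boundI_split (vertex p) (2^-1 ^+ n * u) (2^-1 ^+ n * v) cf.
rewrite !mulrA -!exprS -hE => e.
have h00 := lt false false; have h10 := lt true false.
have h01 := lt false true; have h11 := lt true true.
rewrite /piece /vertex /= -!hE !addr0 in h00 h10 h01 h11.
have s1 : a + rc (p.1 + h) * u + rc p.2 * v = vertex p + rc h * u.
  by rewrite /vertex rcD; ring.
have s2 : a + rc p.1 * u + rc (p.2 + h) * v = vertex p + rc h * v.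
  by rewrite /vertex rcD; ring.
have s3 : a + rc (p.1 + h) * u + rc (p.2 + h) * v = vertex p + rc h * u + rc h * v.
  by rewrite /vertex !rcD; ring.
rewrite s1 in h10; rewrite s2 in h01; rewrite s3 in h11.
suff : piece n p < piece n p by rewrite ltxx.
rewrite {1}/piece e; apply: le_lt_trans (modD _ _) _.
apply: le_lt_trans (lerD (modD _ _) (lexx _)) _.
apply: le_lt_trans (lerD (lerD (modD _ _) (lexx _)) (lexx _)) _.
move: h00 h10 h01 h11; rewrite -/(vertex p).
set x1 := mod_ _; set x2 := mod_ _; set x3 := mod_ _; set x4 := mod_ _.
rewrite /x1 /x2 /x3 /x4 /piece; lra.
Qed.

(** Quarters of largest integral shrink to a point [p]. Up to an error [o(|z - p|)]
    the function is affine near [p], so the integral around the n-th quarter is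
    [o(4^-n)], while it is at least [4^-n] times the one around the whole
    parallelogram. *)
Lemma goursat : (forall z, derivable f z 1) -> boundI f a u v = 0.
Proof.
move=> df.
have [g hg] := choice (fun np : nat * (R * R) => bisection_step np.1 np.2).
pose s := fix s n : R * R := if n is m.+1 then g (m, s m) else (0, 0).
have sS n : s n.+1 = g (n, s n) by [].
have h0 n : 0 <= 2^-1 ^+ n :> R by rewrite exprn_ge0// invr_ge0.
have hS n : 2^-1 ^+ n = 2^-1 ^+ n.+1 + 2^-1 ^+ n.+1 :> R by rewrite exprS; lra.
have h1 n := (hg (n, s n)).
have [x hx] : exists x, forall n, (s n).1 <= x <= (s n).1 + 2^-1 ^+ n.
  apply: (nested_intervals (x := fun n => (s n).1) (l := fun n => 2^-1 ^+ n)) => // n;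
    have h0S := h0 n.+1; have hSn := hS n;
  rewrite sS; have [[->|->] _ _] := h1 n => /=; lra.
have [y hy] : exists y, forall n, (s n).2 <= y <= (s n).2 + 2^-1 ^+ n.
  apply: (nested_intervals (x := fun n => (s n).2) (l := fun n => 2^-1 ^+ n)) => // n;
    have h0S := h0 n.+1; have hSn := hS n;
  rewrite sS; have [_ [->|->] _] := h1 n => /=; lra.
have growth n : mod_ (boundI f a u v) <= 4 ^+ n * piece n (s n).
  elim: n => [|n ih]; first by rewrite /piece /vertex /= rc0 !mul0r !addr0 !expr0 !mul1r.
  apply: le_trans ih _; rewrite exprSr -mulrA; apply: ler_wpM2l; first exact: exprn_ge0.
  by rewrite sS; have [_ _] := h1 n.
pose p := vertex (x, y); pose L := mod_ u + mod_ v + 1.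
have L1 : 1 <= L by rewrite /L; have := mod_ge0 u; have := mod_ge0 v; lra.
have [d hd] := derivable_remainder (df p).
apply/eqP; rewrite -mod_eq0 eq_le mod_ge0 andbT; apply/ler_addgt0Pl => e e0.
rewrite addr0.
have e1 : 0 < e / (4 * L ^+ 2) by rewrite divr_gt0// mulr_gt0// exprn_gt0//; lra.
have [r r0 hr] := hd _ e1.
have [n hn] : exists n, 2^-1 ^+ n * L < r.
  have : (fun n => 2^-1 ^+ n * L) @ \oo --> (0 * L : R).
    apply: cvgM; last exact: cvg_cst.
    by apply: cvg_expr; rewrite ger0_norm ?invr_ge0//; lra.
  rewrite mul0r => /cvgrPdist_lt/(_ _ r0)[n _ /(_ n)] /(_ (leqnn _)).
  by rewrite sub0r normrN => h; exists n; exact: le_lt_trans (ler_norm _) h.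
apply: le_trans (growth n) _.
pose aff z := (f p - d * p) + d * z.
have ca : continuous aff by exact: cont_affine.
have -> : piece n (s n) = mod_
  (boundI (fun z => f z - aff z) (vertex (s n)) (2^-1 ^+ n * u) (2^-1 ^+ n * v)).
  by rewrite (boundIB _ _ _ cf ca) boundI_affine subr0.
have hE : rc (2^-1 ^+ n : R) = 2^-1 ^+ n by rewrite rcX rcV rcn.
have : mod_ (boundI (fun z => f z - aff z) (vertex (s n)) (2^-1 ^+ n * u) (2^-1 ^+ n * v)) <=
    4 * (e / (4 * L ^+ 2) * (2^-1 ^+ n * L)) * (mod_ (2^-1 ^+ n * u) + mod_ (2^-1 ^+ n * v)).
  apply: (boundI_bound (contB cf ca)).
  move=> s' t' /andP[s0 s1] /andP[t0 t1].
  set w := _ + _ + _.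
  have wp : mod_ (w - p) <= 2^-1 ^+ n * L.
    have -> : w - p = rc ((s n).1 + s' * 2^-1 ^+ n - x) * u + rc ((s n).2 + t' * 2^-1 ^+ n - y) * v.
      by rewrite /w /p /vertex /= !rcB !rcD !rcM hE; ring.
    apply: le_trans (modD _ _) _; rewrite !modM !mod_rc.
    have b1 : `|(s n).1 + s' * 2^-1 ^+ n - x| <= 2^-1 ^+ n.
      have /andP[k1 k2] := hx n; have h0n := h0 n; rewrite ler_norml; apply/andP; split; nra.
    have b2 : `|(s n).2 + t' * 2^-1 ^+ n - y| <= 2^-1 ^+ n.
      have /andP[k1 k2] := hy n; have h0n := h0 n; rewrite ler_norml; apply/andP; split; nra.
    have m1 := mod_ge0 u; have m2 := mod_ge0 v.
    apply: le_trans (lerD (ler_wpM2r m1 b1) (ler_wpM2r m2 b2)) _.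
    by rewrite -mulrDr ler_wpM2l// /L lerDl.
  have -> : f w - aff w = f w - f p - d * (w - p) by rewrite /aff; ring.
  apply: le_trans (hr _ (le_lt_trans wp hn)) _.
  by apply: ler_wpM2l => //; exact: ltW.
rewrite !modM -hE mod_rc ger0_norm//.
set k := 2^-1 ^+ n; set q := mod_ _ => hq.
have k4 : 4 ^+ n * (k * k) = 1.
  by rewrite /k -exprMn -exprMn (_ : 4 * (2^-1 * 2^-1) = 1) ?expr1n//; field.
have qb : q <= e * (k * k).
  apply: le_trans hq _.
  have -> : 4 * (e / (4 * L ^+ 2) * (k * L)) * (k * mod_ u + k * mod_ v) =
    (e * (k * k)) * ((mod_ u + mod_ v) / L) by field; lra.
  apply: ler_piMr.
    by rewrite (mulr_ge0 (ltW e0))// mulr_ge0 ?h0.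
  by rewrite ler_pdivrMr; [rewrite mul1r /L lerDl|lra].
apply: le_trans (ler_wpM2l _ qb) _; first exact: exprn_ge0.
by rewrite mulrCA k4 mulr1.
Qed.

End Bisection.
End Goursat.

(** * The exponential and the mean value property *)

Section ComplexExponential.
Variable R : realType.
Local Notation C := (Cplx R).
Local Notation Re := (@complex.Re R).
Local Notation Im := (@complex.Im R).
Implicit Types z w : C.

Lemma cexpD z w : cexp (z + w) = cexp z * cexp w.
Proof.
apply: ReIm_eq; rewrite /cexp ?ReM ?ImM /= ReD ImD expRD ?cosD ?sinD; ring.
Qed.

Lemma cexp0 : cexp (0 : C) = 1.
Proof. by rewrite /cexp /= expR0 cos0 sin0 mulr1 mulr0. Qed.

Lemma mod_cexp z : mod_ (cexp z) = expR (Re z).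
Proof.
rewrite /mod_ normc_def /= !exprMn -mulrDr cos2Dsin2 mulr1 sqrtr_sqr.
by rewrite ger0_norm// expR_ge0.
Qed.

Lemma cexp_neq0 z : cexp z != 0.
Proof. by rewrite -mod_gt0 mod_cexp expR_gt0. Qed.

Lemma cexpN z : cexp (- z) = (cexp z)^-1.
Proof.
apply: (mulfI (cexp_neq0 z)); rewrite -cexpD subrr cexp0 mulfV//; exact: cexp_neq0.
Qed.

Lemma real_remainder (g : R -> R) d : is_derive (0 : R) (1 : R) g d ->
  forall e : R, 0 < e -> \forall x \near (0 : R), `|g x - g 0 - d * x| <= e * `|x|.
Proof.
move=> [dg dE] e e0.
have h : h0^-1 *: (g (h0 *: 1 + 0) - g 0) @[h0 --> (0 : R)^'] --> d by rewrite -dE; exact: dg.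
have := proj1 (@cvgrPdist_lt _ _ _ _ _ _ _) h e e0 => -[r /= r0 hr].
exists r => //= x; rewrite /ball_ /= sub0r normrN => xr.
have [->|x0] := eqVneq x 0; first by rewrite subrr mulr0 subr0 normr0 mulr0.
have := hr x; rewrite /ball_ /= sub0r normrN => /(_ xr x0).
have -> : x *: 1 + 0 = x :> R by rewrite addr0 /GRing.scale /= mulr1.
rewrite /GRing.scale /= => hx.
have -> : g x - g 0 - d * x = - ((d - x^-1 * (g x - g 0)) * x) by field.
by rewrite normrN normrM ler_wpM2r// ltW.
Qed.

Lemma cexp_near0 (e : R) : 0 < e ->
  \forall h \near (0 : C), mod_ (cexp h - 1 - h) <= e * mod_ h.
Proof.
(* the error terms below add up to at most [k (|x| + 5 |y|)] with [h = x + i y] *)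
move=> e0; pose k := Num.min (e / 6) 1.
have k0 : 0 < k by rewrite lt_min ltr01 divr_gt0.
have kle : k <= e / 6 by rewrite ge_min lexx.
have k1 : k <= 1 by rewrite ge_min lexx orbT.
have hE := real_remainder (is_derive_expR (0 : R)) k0.
have hC := real_remainder (is_derive_cos (0 : R)) k0.
have hS := real_remainder (is_derive_sin (0 : R)) k0.
have hB : \forall x \near (0 : R), `|expR x - 1| <= k.
  have := proj1 (@cvgrPdist_le _ _ _ _ (nbhs_filter (0 : R)) _ _) (@continuous_expR R 0) k k0.
  by apply: filterS => x; rewrite expR0 distrC.
have cR : Re h @[h --> (0 : C)] --> (0 : R) by exact: (@continuous_Re R 0).
have cint01 : Im h @[h --> (0 : C)] --> (0 : R) by exact: (@continuous_Im R 0).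
have hE' := cR _ hE; have hB' := cR _ hB; have hC' := cint01 _ hC; have hS' := cint01 _ hS.
near=> h.
have bE : `|expR (Re h) - expR 0 - expR 0 * Re h| <= k * `|Re h| by near: h.
have bB : `|expR (Re h) - 1| <= k by near: h.
have bC : `|cos (Im h) - cos 0 - - sin 0 * Im h| <= k * `|Im h| by near: h.
have bS : `|sin (Im h) - sin 0 - cos 0 * Im h| <= k * `|Im h| by near: h.
move: bE bC bS; rewrite expR0 mul1r cos0 sin0 oppr0 mul0r ?addr0 !subr0 mul1r => bE bC bS.
apply: le_trans (mod_le_ReIm _) _; rewrite !ReD !ImD !ReN !ImN /cexp /=.
have m1 := Re_le_mod h; have m2 := Im_le_mod h; have m0 := mod_ge0 h.
move: bE bB bC bS m1 m2 m0.
set x := Re h; set y := Im h; set E := expR x => bE bB bC bS m1 m2 m0.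
have E2 : `|E| <= 2.
  have := ler_normD (E - 1) 1; rewrite subrK normr1; lra.
have -> : E * cos y - 1 - x = (E - 1 - x) + E * (cos y - 1) by ring.
have -> : E * sin y - 0 - y = E * (sin y - y) + (E - 1) * y by ring.
have b1 : `|E - 1 - x + E * (cos y - 1)| <= k * `|x| + 2 * (k * `|y|).
  by apply: le_trans (ler_normD _ _) _; apply: lerD => //; rewrite normrM ler_pM.
have b2 : `|E * (sin y - y) + (E - 1) * y| <= 2 * (k * `|y|) + k * `|y|.
  by apply: le_trans (ler_normD _ _) _; apply: lerD; rewrite normrM ler_pM.
apply: le_trans (lerD b1 b2) _.
have c1 : k * `|x| <= e / 6 * mod_ h by rewrite ler_pM// ltW.
have c2 : k * `|y| <= e / 6 * mod_ h by rewrite ler_pM// ltW.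
by lra.
Unshelve. all: end_near. Qed.

Lemma is_derive_cexp z : is_derive z 1 (@cexp R) (cexp z).
Proof.
have h : h0^-1 *: (cexp (h0 *: 1 + z) - cexp z) @[h0 --> (0 : C)^'] --> cexp z.
  apply: (proj2 (cvgCP _ _)) => e e0; near=> h0.
  have h00 : h0 != 0 by near: h0; exact: nbhs_dnbhs_neq.
  have hb : mod_ (cexp h0 - 1 - h0) <= e / (2 * mod_ (cexp z)) * mod_ h0.
    near: h0; apply: nbhs_dnbhs; apply: cexp_near0.
    by rewrite divr_gt0// mulr_gt0// mod_gt0 cexp_neq0.
  have -> : h0 *: 1 + z = z + h0 by rewrite /GRing.scale /= mulr1 addrC.
  rewrite cexpD /GRing.scale /=.
  have -> : h0^-1 * (cexp z * cexp h0 - cexp z) - cexp z = cexp z * (cexp h0 - 1 - h0) / h0.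
    by field.
  rewrite !modM modV ltr_pdivrMr ?mod_gt0//.
  have mz : 0 < mod_ (cexp z) by rewrite mod_gt0 cexp_neq0.
  have mh : 0 < mod_ h0 by rewrite mod_gt0.
  apply: le_lt_trans (ler_wpM2l (ltW mz) hb) _.
  rewrite mulrA ltr_pM2r//.
  have -> : mod_ (cexp z) * (e / (2 * mod_ (cexp z))) = e / 2 by field; rewrite gt_eqF.
  by lra.
by apply: DeriveDef; [apply/cvg_ex; exists (cexp z)|apply/cvg_lim => //; exact: norm_hausdorff].
Unshelve. all: end_near. Qed.

Lemma derivable_cexp z : derivable (@cexp R) z 1.
Proof. by have [] := is_derive_cexp z. Qed.

Lemma continuous_cexp : continuous (@cexp R).
Proof.
by move=> z; apply: differentiable_continuous; apply/derivable1_diffP; exact: derivable_cexp.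
Qed.

Lemma cexp_2pi z : cexp (z + Complex 0 (pi *+ 2)) = cexp z.
Proof.
by apply: ReIm_eq; rewrite /cexp /= ReD ImD /= addr0 ?cosD2pi ?sinD2pi.
Qed.

Lemma e2ipiD z w : e2ipi (z + w) = e2ipi z * e2ipi w.
Proof. by rewrite /e2ipi mulrDr cexpD. Qed.
Lemma e2ipi0 : e2ipi (0 : C) = 1.
Proof. by rewrite /e2ipi mulr0 cexp0. Qed.
Lemma e2ipiN z : e2ipi (- z) = (e2ipi z)^-1.
Proof. by rewrite /e2ipi mulrN cexpN. Qed.
Lemma e2ipi_neq0 z : e2ipi z != 0.
Proof. exact: cexp_neq0. Qed.

Lemma e2ipiE z : e2ipi z = cexp (z * Complex 0 (pi *+ 2)).
Proof.
rewrite /e2ipi mulrC; congr cexp; congr (_ * _); apply: ReIm_eq; rewrite ?ReM ?ImM /=; ring.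
Qed.

Lemma e2ipi1 : e2ipi (1 : C) = 1.
Proof. by rewrite e2ipiE mul1r -[Complex _ _]add0r cexp_2pi cexp0. Qed.

Lemma e2ipi_half : e2ipi (2^-1 : C) = -1.
Proof.
have -> : e2ipi (2^-1 : C) = cexp (Complex 0 pi).
  rewrite e2ipiE; congr cexp; rewrite -(rcn R 2) -rcV.
  by apply: ReIm_eq; rewrite ?ReM ?ImM /=; field.
by apply: ReIm_eq; rewrite /cexp /= expR0 ?cospi ?sinpi ?ReN ?ImN /=; ring.
Qed.

Lemma continuous_e2ipi : continuous (@e2ipi R).
Proof.
apply: (cont_comp continuous_cexp); apply: contM; [exact: cont_cst|exact: cont_id].
Qed.

Lemma mod_e2ipi z : mod_ (e2ipi z) = expR (- (pi *+ 2) * Im z).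
Proof. rewrite e2ipiE mod_cexp ReM /=; congr expR; ring. Qed.

Lemma mod_circle (t : R) : mod_ (e2ipi (rc t)) = 1.
Proof. by rewrite mod_e2ipi /= mulr0 expR0. Qed.

Lemma continuous_circle : continuous (fun t : R => e2ipi (rc t)).
Proof. exact: (cont_comp continuous_e2ipi (@continuous_rc R)). Qed.
Lemma continuous_circleN : continuous (fun t : R => e2ipi (- rc t)).
Proof. exact: (cont_comp continuous_e2ipi (contN (@continuous_rc R))). Qed.

(** The contributions of opposite points of the circle cancel. *)
Lemma cint01_circleN : cint01 (fun t : R => e2ipi (- rc t)) = 0.
Proof.
rewrite (cint01_split continuous_circleN).
have c : continuous (fun t : R => e2ipi (- rc (2^-1 * t))).
  apply: (cont_comp continuous_circleN) => t.
  by apply: cvgM; [exact: cvg_cst|exact: cvg_id].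
have -> : (fun t : R => e2ipi (- rc (2^-1 * t + 2^-1))) = (fun t => - e2ipi (- rc (2^-1 * t))).
  apply/funext => t; rewrite rcD opprD e2ipiD [X in _ * X]e2ipiN rcV rcn e2ipi_half.
  by rewrite invrN1 mulrN1.
by rewrite (cint01N c) subrr mulr0.
Qed.

(** The integral of [g o exp] over vertical segments of length [2 pi] does not depend
    on their abscissa, by Goursat's lemma and periodicity; as the abscissa goes to
    [-oo], [exp] goes to [0] and the integrand to [L]. *)
Lemma mean_value (g : C -> C) (L : C) : (forall z, z != 0 -> derivable g z 1) ->
  g @ (0 : C)^' --> L -> cint01 (fun t => g (e2ipi (rc t))) = L.
Proof.
move=> dg gL; pose phi w := g (cexp w); pose v : C := Complex 0 (pi *+ 2).
have dphi w : derivable phi w 1.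
  apply/derivable1_diffP; apply: (@differentiable_comp _ _ _ _ (@cexp R) g).
    by apply/derivable1_diffP; exact: derivable_cexp.
  by apply/derivable1_diffP; apply: dg; exact: cexp_neq0.
have cphi : continuous phi.
  by move=> w; exact: differentiable_continuous (proj1 (derivable1_diffP _ _) (dphi w)).
have pphi w : phi (w + v) = phi w by rewrite /phi cexp_2pi.
have shift (x : R) : cint01 (fun t => phi (rc t * v)) = cint01 (fun t => phi (rc x + rc t * v)).
  have := goursat (rc x) (rc (- x)) v cphi dphi; rewrite /boundI.
  have -> : segI phi (rc x + v) (rc (- x)) = segI phi (rc x) (rc (- x)).
    rewrite /segI; congr (_ * cint01 _); apply/funext => t.
    by rewrite addrAC pphi.
  have cancel (A B D : C) : A + B - A - D = B - D by ring.
  rewrite cancel rcN addrN => /eqP; rewrite subr_eq0 /segI => /eqP.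
  have v0 : v != 0.
    by apply/eqP => -[] /eqP; rewrite mulrn_eq0 /= gt_eqF// pi_gt0.
  move=> /(mulfI v0) <-; congr cint01; apply/funext => t; by rewrite add0r.
have -> : (fun t => g (e2ipi (rc t))) = (fun t => phi (rc t * v)).
  by apply/funext => t; rewrite /phi e2ipiE.
apply/eqP; rewrite -subr_eq0 -mod_eq0 eq_le mod_ge0 andbT; apply/ler_addgt0Pl => e e0.
rewrite addr0.
have e2 : 0 < e / 2 by lra.
have := proj1 (cvgCP _ _) gL _ e2 => -[_ /= /gt0_rcP[r r0 ->] hr].
have r1 : 0 < r / 2 by lra.
have cx : continuous (fun t => phi (rc (ln (r / 2)) + rc t * v)) by
  exact: (cont_comp cphi (@cont_line R (rc (ln (r / 2))) v)).
rewrite (shift (ln (r / 2))) -[X in _ - X](cint01_cst L) -(cint01B cx (@cont_cst R _ L)).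
have -> : e = 2 * (e / 2) by field.
apply: (cint01_bound (contB cx (@cont_cst R _ L))) => t _.
apply/ltW/hr => /=; last exact: cexp_neq0.
rewrite sub0r normrN modE ltc_rc mod_cexp ReD ReM /= mulr0 mul0r subr0 addr0.
by rewrite lnK ?posrE//; lra.
Qed.

End ComplexExponential.

(** * Entire functions on normed spaces *)

Section Entire.
Variable R : realType.
Local Notation C := (Cplx R).

(** Continuity together with holomorphy along every complex line is stable under all the
    constructions below; it is only turned into differentiability in [entire_differentiable]. *)
Definition entire (V : normedModType C) (f : V -> C) :=
  continuous f /\ forall z v, derivable f z v.

Section Normed.
Variable V : normedModType C.
Implicit Types (f g : V -> C) (z v : V).

Lemma entire_cst (k : C) : entire (fun _ : V => k).
Proof. by split; [exact: cont_cst|move=> z v; exact: derivable_cst]. Qed.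
Lemma entireD f g : entire f -> entire g -> entire (fun z => f z + g z).
Proof.
by move=> [cf df] [cg dg]; split=> [|z v];
  [exact: (contD cf cg)|exact: (derivableD (df z v) (dg z v))].
Qed.
Lemma entireN f : entire f -> entire (fun z => - f z).
Proof.
by move=> [cf df]; split=> [|z v]; [exact: (contN cf)|exact: (derivableN (df z v))].
Qed.
Lemma entireM f g : entire f -> entire g -> entire (fun z => f z * g z).
Proof.
by move=> [cf df] [cg dg]; split=> [|z v];
  [exact: (contM cf cg)|exact: (derivableM (df z v) (dg z v))].
Qed.
Lemma entire_sum (I : Type) (r : seq I) (P : pred I) (F : I -> V -> C) :
  (forall i, entire (F i)) -> entire (fun z => \sum_(i <- r | P i) F i z).
Proof.
move=> h; elim: r => [|i r ih].
  by under eq_fun do rewrite big_nil; exact: entire_cst.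
under eq_fun do rewrite big_cons; case: (P i); last exact: ih.
exact: (entireD (h i) ih).
Qed.
Lemma entire_prod (I : Type) (r : seq I) (P : pred I) (F : I -> V -> C) :
  (forall i, entire (F i)) -> entire (fun z => \prod_(i <- r | P i) F i z).
Proof.
move=> h; elim: r => [|i r ih].
  by under eq_fun do rewrite big_nil; exact: entire_cst.
under eq_fun do rewrite big_cons; case: (P i); last exact: ih.
exact: (entireM (h i) ih).
Qed.

Lemma dnbhs0_scale (h : C) : h != 0 -> (fun k : C => k * h) @ 0^' --> (0 : C)^'.
Proof.
move=> h0 A [_ /= /gt0_rcP[r r0 ->] hA].
have rh : 0 < r / mod_ h by rewrite divr_gt0// mod_gt0.
exists (rc (r / mod_ h)); first by rewrite /= ltc_rc.
move=> k /=; rewrite sub0r normrN modE ltc_rc => kr k0; apply: hA => /=.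
  by rewrite sub0r normrN modE ltc_rc modM -ltr_pdivlMr// mod_gt0.
by rewrite mulf_neq0.
Qed.

Lemma is_derive_scale f z v (h : C) : derivable f z v ->
  is_derive z (h *: v) f (h * 'D_v f z).
Proof.
move=> df; have [->|h0] := eqVneq h 0.
  by rewrite scale0r mul0r; exact: is_derive0.
have c : k^-1 *: (f (k *: (h *: v) + z) - f z) @[k --> (0 : C)^'] --> h * 'D_v f z.
  have c1 := cvg_comp _ _ (dnbhs0_scale h0) df.
  apply: cvg_trans (ccvgM (cvg_cst h) c1); apply: near_eq_cvg; near=> k => /=.
  have k0 : k != 0 by near: k; exact: nbhs_dnbhs_neq.
  by rewrite scalerA /GRing.scale /= invfM; field; apply/andP.
by apply: DeriveDef; [apply/cvg_ex; exists (h * 'D_v f z)|apply/cvg_lim => //;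
  exact: norm_hausdorff].
Unshelve. all: end_near. Qed.

Lemma cont_scale (T : topologicalType) (k : T -> C) (A : T -> V) :
  continuous k -> continuous A -> continuous (fun x => k x *: A x).
Proof. by move=> ck cA x; apply: cvgZ; [exact: ck|exact: cA]. Qed.
Lemma cont_add (T : topologicalType) (A B : T -> V) :
  continuous A -> continuous B -> continuous (fun x => A x + B x).
Proof. by move=> cA cB x; apply: cvgD; [exact: cA|exact: cB]. Qed.
Lemma cont_vcst (T : topologicalType) (v : V) : continuous (fun _ : T => v).
Proof. by move=> x; exact: cvg_cst. Qed.

Lemma derivable_line f z v (x : C) : entire f -> derivable (fun k : C => f (k *: v + z)) x 1.
Proof.
move=> [_ df]; have := df (x *: v + z) v; rewrite /derivable.
suff -> : (fun h : C => h^-1 *: ((f \o shift (x *: v + z)) (h *: v) - f (x *: v + z))) =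
  (fun h : C => h^-1 *: (((fun k : C => f (k *: v + z)) \o shift x) (h *: 1) - f (x *: v + z)))
    by [].
apply/funext => h /=; congr (_ *: (f _ - _)).
by rewrite addrA -scalerDl /GRing.scale /= mulr1.
Qed.

(** Cauchy's formula for the derivative: the mean value property for the difference
    quotient of [f] at [z] in the direction [v], whose singularity at [0] is
    removable. *)
Lemma derive_mean f z v : entire f ->
  'D_v f z = cint01 (fun t => f (z + e2ipi (rc t) *: v) * e2ipi (- rc t)).
Proof.
move=> ef; have [cf df] := ef.
pose g (k : C) := k^-1 * (f (k *: v + z) - f z).
have dg k : k != 0 -> derivable g k 1.
  move=> k0; apply: (@derivableM _ _ (fun k : C => k^-1)).
    by apply: derivableV => //; exact: derivable_id.
  by apply: derivableB; [exact: derivable_line|exact: derivable_cst].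
have gL : g @ (0 : C)^' --> 'D_v f z by exact: (df z v).
rewrite -(mean_value dg gL).
have cl : continuous (fun t => f (z + e2ipi (rc t) *: v) * e2ipi (- rc t)).
  apply: contM; last exact: continuous_circleN.
  apply: (cont_comp cf); apply: cont_add; first exact: cont_vcst.
  by apply: cont_scale; [exact: continuous_circle|exact: cont_vcst].
have -> : (fun t => g (e2ipi (rc t))) = (fun t => f (z + e2ipi (rc t) *: v) * e2ipi (- rc t) -
    f z * e2ipi (- rc t)).
  by apply/funext => t; rewrite /g -e2ipiN [_ *: v + z]addrC; ring.
have c2 := @continuous_circleN R.
by rewrite (cint01B cl (contM (@cont_cst R _ (f z)) c2)) (cint01Z _ c2) cint01_circleN mulr0 subr0.
Qed.

Lemma cont_translate (T : topologicalType) (k : T -> C) (A : T -> V) v :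
  continuous k -> continuous A -> continuous (fun x => A x + k x *: v).
Proof. by move=> ck cA; exact: (cont_add cA (cont_scale ck (@cont_vcst T v))). Qed.

Lemma continuous_derive f v : entire f -> continuous ('D_v f).
Proof.
move=> ef; have [cf _] := ef.
have -> : 'D_v f = fun z => cint01 (fun t => f (z + e2ipi (rc t) *: v) * e2ipi (- rc t)).
  by apply/funext => z; exact: derive_mean.
apply: (@cint01_continuous R V (fun p => f (p.2 + e2ipi (rc p.1) *: v) * e2ipi (- rc p.1))).
apply: contM.
  apply: (cont_comp cf); apply: cont_translate; last exact: cont_snd.
  exact: (cont_comp (@continuous_circle R) (@cont_fst _ _)).
exact: (cont_comp (@continuous_circleN R) (@cont_fst _ _)).
Qed.

Lemma cont_curve (cont_f : V -> C) z w (h : C) : continuous cont_f ->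
  continuous (fun s : R => cont_f (z + (rc s * h) *: w)).
Proof.
move=> cf; apply: (cont_comp cf); apply: cont_translate; last exact: cont_vcst.
by apply: contM; [exact: continuous_rc|exact: cont_cst].
Qed.

(** Fundamental theorem of calculus along a complex segment. *)
Lemma increment f z w (h : C) : entire f ->
  f (z + h *: w) - f z = h * cint01 (fun s => 'D_w f (z + (rc s * h) *: w)).
Proof.
move=> ef; have [_ df] := ef.
have := curve_derive (f := f) (d := fun x => h * 'D_w f x) z (fun x => is_derive_scale h (df x w)).
move=> /cint01_prim; rewrite rc1 rc0 scale1r scale0r addr0 => <-.
rewrite -(cint01Z _ (@cont_curve _ z w h (@continuous_derive f w ef))).
by apply: (f_equal (@cint01 R)); apply/funext => s; rewrite scalerA.
Qed.

(** Differentiation under the integral sign: the difference quotients in [h] are again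
    parameter integrals, which are continuous at [h = 0]. *)
Lemma entire_integral (F : R * V -> C) : continuous F ->
  (forall t, entire (fun z => F (t, z))) -> entire (fun z => cint01 (fun t => F (t, z))).
Proof.
move=> cF eF; split; first exact: cint01_continuous.
move=> z w.
pose G (p : R * V) := cint01 (fun s => F (p.1, p.2 + e2ipi (rc s) *: w) * e2ipi (- rc s)).
have cG : continuous G.
  apply: (@cint01_continuous R (R * V)%type
    (fun q => F (q.2.1, q.2.2 + e2ipi (rc q.1) *: w) * e2ipi (- rc q.1))).
  apply: contM; last exact: (cont_comp (@continuous_circleN R) (@cont_fst _ _)).
  apply: (cont_comp cF); apply: cont_pair.
    exact: (cont_comp (@cont_fst _ _) (@cont_snd _ _)).
  apply: cont_translate; first exact: (cont_comp (@continuous_circle R) (@cont_fst _ _)).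
  exact: (cont_comp (@cont_snd _ _) (@cont_snd _ _)).
have GE t y : 'D_w (fun z => F (t, z)) y = G (t, y) by rewrite (derive_mean y w (eF t)).
pose H (p : R * C) := cint01 (fun s => G (p.1, z + (rc s * p.2) *: w)).
have cH : continuous H.
  apply: (@cint01_continuous R (R * C)%type (fun q => G (q.2.1, z + (rc q.1 * q.2.2) *: w))).
  apply: (cont_comp cG); apply: cont_pair.
    exact: (cont_comp (@cont_fst _ _) (@cont_snd _ _)).
  apply: cont_translate; last exact: cont_vcst.
  apply: contM; first exact: (cont_comp (@continuous_rc R) (@cont_fst _ _)).
  exact: (cont_comp (@cont_snd _ _) (@cont_snd _ _)).
have cK : continuous (fun h : C => cint01 (fun t => H (t, h))) by exact: cint01_continuous.
apply/cvg_ex; exists (cint01 (fun t => H (t, 0))).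
have c0 : (fun h : C => cint01 (fun t => H (t, h))) @ (0 : C)^' --> cint01 (fun t => H (t, 0)).
  by move=> A /(cK 0) nA; exact: nbhs_dnbhs.
apply: cvg_trans c0; apply: near_eq_cvg; near=> h => /=.
have h0 : h != 0 by near: h; exact: nbhs_dnbhs_neq.
have cFy y : continuous (fun t => F (t, y)).
  by apply: (cont_comp cF); apply: cont_pair; [exact: cont_id|exact: cont_vcst].
have cHh : continuous (fun t => H (t, h)).
  by apply: (cont_comp cH); apply: cont_pair; [exact: cont_id|exact: cont_cst].
rewrite -(cint01B (cFy _) (cFy _)).
have -> : (fun t => F (t, h *: w + z) - F (t, z)) = fun t => h * H (t, h).
  apply/funext => t; rewrite [h *: w + z]addrC (increment z w h (eF t)) /H; congr (_ * cint01 _).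
  by apply/funext => s; rewrite GE.
by rewrite (cint01Z _ cHh) /GRing.scale /= mulrA mulVf// mul1r.
Unshelve. all: end_near. Qed.

(** The derivative is a parameter integral of translates of [f], by [derive_mean]. *)
Lemma entire_derive f v : entire f -> entire ('D_v f).
Proof.
move=> ef; have [cf df] := ef.
have -> : 'D_v f = fun z => cint01 (fun t => f (z + e2ipi (rc t) *: v) * e2ipi (- rc t)).
  by apply/funext => z; exact: derive_mean.
apply: (@entire_integral (fun p => f (p.2 + e2ipi (rc p.1) *: v) * e2ipi (- rc p.1))).
  apply: contM.
    apply: (cont_comp cf); apply: cont_translate; last exact: cont_snd.
    exact: (cont_comp (@continuous_circle R) (@cont_fst _ _)).
  exact: (cont_comp (@continuous_circleN R) (@cont_fst _ _)).
move=> t /=; apply: entireM; last exact: entire_cst.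
split=> [|z w].
  by apply: (cont_comp cf); apply: cont_translate; [exact: cont_cst|exact: cont_id].
have := df (z + e2ipi (rc t) *: v) w; rewrite /derivable.
suff -> : (fun h : C => h^-1 *:
  ((f \o shift (z + e2ipi (rc t) *: v)) (h *: w) - f (z + e2ipi (rc t) *: v))) =
  (fun h : C => h^-1 *: (((fun y => f (y + e2ipi (rc t) *: v)) \o shift z) (h *: w) - f
    (z + e2ipi (rc t) *: v))) by [].
by apply/funext => h /=; rewrite addrA.
Qed.

End Normed.

Definition affine (V W : normedModType C) (A : V -> W) :=
  continuous A /\ exists L : V -> W, forall (k : C) z v, A (k *: v + z) = k *: L v + A z.

Lemma entire_affine (V W : normedModType C) (A : V -> W) (f : W -> C) :
  entire f -> affine A -> entire (fun z => f (A z)).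
Proof.
move=> [cf df] [cA [L AL]]; split=> [|z v]; first exact: (cont_comp cf cA).
have := df (A z) (L v); rewrite /derivable.
suff -> : (fun h : C => h^-1 *: ((f \o shift (A z)) (h *: L v) - f (A z))) =
  (fun h : C => h^-1 *: (((fun y => f (A y)) \o shift z) (h *: v) - f (A z))) by [].
by apply/funext => h /=; rewrite AL.
Qed.

(** Hadamard's lemma: if [f] vanishes on a hyperplane [u = p] then the quotient of
    [f] by [u - p] is the mean of the derivative of [f] along the segment from the
    hyperplane in a transversal direction [v]. *)
Lemma hadamard (V : normedModType C) (f u : V -> C) (v : V) (p : C) :
  entire f -> affine u -> (forall k z, u (k *: v + z) = k + u z) ->
  (forall z, u z = p -> f z = 0) ->
  exists2 q, entire q & forall z, f z = (u z - p) * q z.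
Proof.
move=> ef [cu [L uL]] uv f0; have [cf df] := ef.
pose A (s : R) z := (rc s * (u z - p)) *: v + ((p - u z) *: v + z).
have AA s : affine (A s).
  split.
    apply: cont_add.
      apply: cont_scale; last exact: cont_vcst.
      by apply: contM; [exact: cont_cst|exact: (contB cu (@cont_cst R _ p))].
    apply: cont_add; last exact: cont_id.
    by apply: cont_scale; [exact: (contB (@cont_cst R _ p) cu)|exact: cont_vcst].
  exists (fun w => (rc s * L w) *: v + (- L w *: v + w)) => k z w.
  rewrite /A uL !scalerDr !scalerA.
  have -> : rc s * (k *: L w + u z - p) = k * (rc s * L w) + rc s * (u z - p).
    by rewrite /GRing.scale /=; ring.
  have -> : p - (k *: L w + u z) = k * (- L w) + (p - u z).
    by rewrite /GRing.scale /=; ring.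
  rewrite !scalerDl -!addrA; congr (_ + _).
  rewrite addrCA; congr (_ + _); rewrite [RHS]addrCA; congr (_ + _).
  by rewrite [RHS]addrCA; congr (_ + _); exact: addrCA.
exists (fun z => cint01 (fun s => 'D_v f (A s z))).
  apply: (@entire_integral V (fun q => 'D_v f (A q.1 q.2))).
    have cu2 : continuous (fun q : R * V => u q.2) by exact: (cont_comp cu (@cont_snd _ _)).
    have cA : continuous (fun q : R * V => A q.1 q.2).
      apply: cont_add.
        apply: cont_scale; last exact: cont_vcst.
        apply: contM; first exact: (cont_comp (@continuous_rc R) (@cont_fst _ _)).
        exact: (contB cu2 (@cont_cst R _ p)).
      apply: cont_add; last exact: cont_snd.
      by apply: cont_scale; [exact: (contB (@cont_cst R _ p) cu2)|exact: cont_vcst].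
    exact: (cont_comp (@continuous_derive V f v ef) cA).
  by move=> t; exact: (entire_affine (entire_derive v ef) (AA t)).
move=> z; have := increment ((p - u z) *: v + z) v (u z - p) ef.
rewrite (f0 ((p - u z) *: v + z)); last by rewrite uv; ring.
rewrite subr0 addrAC -scalerDl.
have -> : p - u z + (u z - p) = 0 by ring.
rewrite scale0r add0r => ->.
apply: (f_equal (fun F => (u z - p) * cint01 F)); apply/funext => s.
by rewrite /A addrC.
Qed.

(** At a zero [z] of [l] the product differs from [K z * l] by [l * (K - K z)], which
    is [o(x - z)]; hence continuity of the factor [K] suffices. *)
Lemma differentiable_vanishing (V : normedModType C) (l K : V -> C) (z : V) :
  differentiable l z -> l z = 0 -> {for z, continuous K} ->
  differentiable (fun x => l x * K x) z.
Proof.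
move=> dl l0 cK.
pose phi x := l x * (K x - K z).
have -> : (fun x => l x * K x) = K z \*: l + phi.
  apply/funext => x; change (l x * K x = K z * l x + l x * (K x - K z)); ring.
apply: differentiableD; first exact: differentiableZ.
have cd := diff_continuous dl.
have [k k0 hk] := linear_lipschitz cd.
have lb : \forall h \near (0 : V), `|l (h + z)| <= (k + 1) * `|h|.
  have := diff_locally dl => /eqaddoP/(_ 1 ltr01); apply: filterS => h.
  rewrite !fctE /= l0 add0r mul1r => hh.
  rewrite -[l _](subrK ('d l z h)); apply: le_trans (ler_normD _ _) _.
  by rewrite mulrDl mul1r addrC lerD.
have e0 : phi \o shift z = cst (phi z) + \0 +o_ (0 : V) id.
  apply/eqaddoP => e e0.
  have k1 : 0 < k + 1 by rewrite addr_gt0.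
  have kb : \forall h \near (0 : V), `|K (h + z) - K z| <= e / (k + 1).
    have c1 : K (h + z) @[h --> (0 : V)] --> K z.
      have c2 : (fun h : V => h + z) @ (0 : V) --> 0 + z.
        by apply: cvgD; [exact: cvg_id|exact: cvg_cst].
      by rewrite add0r in c2; exact: (cvg_comp _ _ c2 cK).
    have := proj1 (@cvgrPdist_le _ _ _ _ (nbhs_filter (0 : V)) _ _) c1 (e / (k + 1))
      (divr_gt0 e0 k1).
    by apply: filterS => h; rewrite distrC.
  near=> h; rewrite !fctE /= /phi subrr mulr0 !addr0 subr0 normrM.
  have b1 : `|l (h + z)| <= (k + 1) * `|h| by near: h.
  have b2 : `|K (h + z) - K z| <= e / (k + 1) by near: h.
  apply: le_trans (ler_pM (normr_ge0 _) (normr_ge0 _) b1 b2) _.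
  by rewrite mulrAC mulrCA mulfV ?gt_eqF// mulr1.
apply/diff_locallyP.
have c0 : continuous (\0 : {linear V -> C}) by exact: cst_continuous.
by rewrite (diff_unique c0 e0).
Unshelve. all: end_near. Qed.

Section Coordinates.
Variable m : nat.
Local Notation V := 'rV[C]_m.

Lemma cont_row (T : topologicalType) (A : T -> V) :
  (forall j, continuous (fun x => A x 0 j)) -> continuous A.
Proof.
move=> h x; apply/cvg_ballP => e e0.
have hj : \forall y \near x, forall j, ball (A x 0 j) e (A y 0 j).
  by apply: filter_forall => j; have /cvg_ballP/(_ e e0) := h j x.
apply: filterS hj => y hy; split => // i j.
by rewrite (ord1 i); exact: hy.
Qed.

Lemma cont_coord (j : 'I_m) : continuous (fun z : V => z 0 j).
Proof. exact: coord_continuous. Qed.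

Let trunc k (h : V) : V := \row_j (if (j < k)%N then h 0 j else 0).

(** Moving one coordinate at a time, [f (z + h) - f z] is a combination of the
    coordinates of [h] with coefficients continuous in [h]. *)
Lemma entire_differentiable (f : V -> C) : entire f -> forall z, differentiable f z.
Proof.
move=> ef z; have [cf df] := ef.
pose K (k : 'I_m) (h : V) :=
  cint01 (fun s => 'D_(delta_mx 0 k) f (z + trunc k h + (rc s * h 0 k) *: delta_mx 0 k)).
have cK k : continuous (K k).
  pose A (q : R * V) : V := z + trunc k q.2 + (rc q.1 * q.2 0 k) *: delta_mx 0 k.
  have cA : continuous A.
    apply: cont_translate.
      apply: contM; first exact: (cont_comp (@continuous_rc R) (@cont_fst _ _)).
      exact: (cont_comp (@cont_coord k) (@cont_snd _ _)).
    apply: cont_add; first exact: cont_vcst.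
    apply: cont_row => j; rewrite /trunc.
    have -> : (fun q : R * V => (\row_j0 (if (j0 < k)%N then q.2 0 j0 else 0)) 0 j) =
        (fun q : R * V => if (j < k)%N then q.2 0 j else 0).
      by apply/funext => q; rewrite mxE.
    case: (j < k)%N; last exact: cont_cst.
    exact: (cont_comp (@cont_coord j) (@cont_snd _ _)).
  apply: (@cint01_continuous R V (fun q => 'D_(delta_mx 0 k) f (A q))).
  exact: (cont_comp (@continuous_derive V f _ ef) cA).
have fE x : f x = f z + \sum_(k < m) (x 0 k - z 0 k) * K k (x - z).
  pose h := x - z.
  have tS (k : 'I_m) : trunc k.+1 h = trunc k h + h 0 k *: delta_mx 0 k.
    apply/rowP => j; rewrite !mxE eqxx /= ltnS leq_eqVlt.
    have [->|jk] := eqVneq j k; first by rewrite eqxx ltnn mulr1 add0r.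
    by rewrite (inj_eq val_inj) (negPf jk) /= mulr0 addr0.
  have step (k : 'I_m) : f (z + trunc k.+1 h) - f (z + trunc k h) = (x 0 k - z 0 k) * K k h.
    by rewrite tS addrA (increment (z + trunc k h) (delta_mx 0 k) (h 0 k) ef) /K !mxE.
  rewrite -(eq_bigr _ (fun k _ => step k)).
  rewrite -(big_mkord xpredT (fun k => f (z + trunc k.+1 h) - f (z + trunc k h))).
  rewrite telescope_sumr//.
  have -> : trunc 0 h = 0 by apply/rowP => j; rewrite !mxE.
  have -> : trunc m h = h by apply/rowP => j; rewrite !mxE ltn_ord.
  by rewrite addr0 /h [z + _]addrC subrK addrC subrK.
have -> : f = cst (f z) + \sum_(k < m) (fun x : V => (x 0 k - z 0 k) * K k (x - z)).
  by apply/funext => x; rewrite [LHS]fE !fctE fct_sumE.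
apply: differentiableD; first exact: differentiable_cst.
apply: differentiable_sum => k.
apply: (@differentiable_vanishing _ (fun x : V => x 0 k - z 0 k) (fun x : V => K k (x - z))).
- by apply: differentiableB; [exact: differentiable_coord|exact: differentiable_cst].
- by rewrite subrr.
have cz : continuous (fun x : V => x - z).
  by apply: cont_add; [exact: cont_id|exact: cont_vcst].
have ck2 : continuous (fun x : V => K k (x - z)) by exact: (cont_comp (cK k) cz).
exact: ck2.
Qed.

Lemma differentiable_entire (f : V -> C) : (forall z, differentiable f z) -> entire f.
Proof.
move=> df; split=> [z|z v]; first exact: differentiable_continuous (df z).
exact: diff_derivable (df z).
Qed.

End Coordinates.

(** Weierstrass: the formula of [derive_mean] passes to the limit, so the increments
    of [f] are integrals of the continuous function [G] it defines. *)
Lemma entire_limit (F : nat -> C -> C) (f : C -> C) : (forall n, entire (F n)) ->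
  (forall r e : R, 0 < e -> exists n, forall z, mod_ z <= r -> mod_ (F n z - f z) <= e) ->
  entire f.
Proof.
move=> eF h.
have cf : continuous f.
  move=> z; apply: (proj2 (@cvgCP R C (nbhs z) (nbhs_filter z) f (f z))) => e e0.
  have e4 : 0 < e / 4 by lra.
  have [n hn] := h (mod_ z + 1) _ e4.
  have cn : \forall w \near z, mod_ (F n w - F n z) < e / 4.
    exact: (proj1 (@cvgCP R C (nbhs z) (nbhs_filter z) (F n) (F n z)) ((eF n).1 z)).
  have cz : \forall w \near z, mod_ (w - z) < 1.
    exact: (proj1 (@cvgCP R C (nbhs z) (nbhs_filter z) id z) (@cvg_id _ _)).
  near=> w.
  have wz : mod_ (w - z) < 1 by near: w.
  have b1 : mod_ (F n w - F n z) < e / 4 by near: w.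
  have b2 := hn w; have b3 := hn z.
  have {}b2 : mod_ (F n w - f w) <= e / 4.
    apply: b2; have := modD (w - z) z; rewrite subrK; lra.
  have {}b3 : mod_ (F n z - f z) <= e / 4 by apply: b3; lra.
  have -> : f w - f z = (F n w - F n z) - (F n w - f w) + (F n z - f z) by ring.
  apply: le_lt_trans (modD _ _) _; apply: le_lt_trans (lerD (modB _ _) (lexx _)) _.
  lra.
pose G (p : C) := cint01 (fun t => f (p + e2ipi (rc t) * 1) * e2ipi (- rc t)).
have cin (g : C -> C) (p : C) : continuous g ->
  continuous (fun t => g (p + e2ipi (rc t) * 1) * e2ipi (- rc t)).
  move=> cg; apply: contM; last exact: continuous_circleN.
  apply: (cont_comp cg); apply: contD; first exact: cont_cst.
  by apply: contM; [exact: continuous_circle|exact: cont_cst].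
have cG : continuous G.
  apply: (@cint01_continuous R C (fun q => f (q.2 + e2ipi (rc q.1) * 1) * e2ipi (- rc q.1))).
  apply: contM; last exact: (cont_comp (@continuous_circleN R) (@cont_fst _ _)).
  apply: (cont_comp cf); apply: contD; first exact: cont_snd.
  apply: contM; last exact: cont_cst.
  exact: (cont_comp (@continuous_circle R) (@cont_fst _ _)).
have cseg (g : C -> C) (z k : C) : continuous g -> continuous (fun s : R => g (z + rc s * k)).
  by move=> cg; exact: (cont_comp cg (@cont_line R z k)).
have inc z k : f (z + k) - f z = k * cint01 (fun s => G (z + rc s * k)).
  apply/eqP; rewrite -subr_eq0 -mod_eq0 eq_le mod_ge0 andbT; apply/ler_addgt0Pl => e e0.
  rewrite addr0.
  pose M := mod_ k + 1; have M0 : 0 < M by rewrite /M; have := mod_ge0 k; lra.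
  have eM : 0 < e / (6 * M) by rewrite divr_gt0// mulr_gt0.
  have [n hn] := h (mod_ z + mod_ k + 1) _ eM.
  have [cn dn] := eF n.
  have en := increment z 1 k (eF n).
  have kE : k *: 1 = k by rewrite /GRing.scale /= mulr1.
  rewrite kE in en.
  have -> : f (z + k) - f z - k * cint01 (fun s => G (z + rc s * k)) =
    (F n z - f z) - (F n (z + k) - f (z + k)) +
    k * (cint01 (fun s => 'D_1 (F n) (z + (rc s * k) *: 1)) - cint01 (fun s => G (z + rc s * k))).
    by rewrite mulrBr -en; ring.
  have cD : continuous (fun s : R => 'D_1 (F n) (z + (rc s * k) *: 1)).
    exact: (@cont_curve C _ z 1 k (@continuous_derive C (F n) 1 (eF n))).
  rewrite -(cint01B cD (cseg G z k cG)).
  have m0 := mod_ge0 k; have mz := mod_ge0 z.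
  have b1 : mod_ (F n z - f z) <= e / (6 * M) by apply: hn; lra.
  have b2 : mod_ (F n (z + k) - f (z + k)) <= e / (6 * M).
    by apply: hn; apply: le_trans (modD _ _) _; lra.
  have b3 : mod_ (cint01 (fun s => 'D_1 (F n) (z + (rc s * k) *: 1) - G (z + rc s * k))) <=
      2 * (2 * (e / (6 * M))).
    apply: (cint01_bound (contB cD (cseg G z k cG))) => s /andP[s0 s1].
    have sE : (rc s * k) *: 1 = rc s * k by rewrite /GRing.scale /= mulr1.
    rewrite sE (@derive_mean C (F n) (z + rc s * k) 1 (eF n)) /G.
    rewrite -(cint01B (cin _ (z + rc s * k) cn) (cin _ (z + rc s * k) cf)).
    apply: (cint01_bound (contB (cin _ (z + rc s * k) cn) (cin _ (z + rc s * k) cf))) => t _.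
    rewrite -mulrBl modM e2ipiN modV mod_circle invr1 [leLHS]mulr1; apply: hn.
    apply: le_trans (modD _ _) _; rewrite mulr1 mod_circle.
    apply: le_trans (lerD (modD _ _) (lexx _)) _; rewrite modM mod_rc ger0_norm//.
    have : s * mod_ k <= mod_ k by rewrite ler_piMl.
    lra.
  apply: le_trans (modD _ _) _; rewrite modM.
  apply: le_trans (lerD (modB _ _) (ler_wpM2l m0 b3)) _.
  apply: le_trans (lerD (lerD b1 b2) (lexx _)) _.
  have eE : e = (e / (6 * M)) * 6 * M by field; rewrite gt_eqF.
  rewrite [leRHS]eE; move: eM; set q := e / (6 * M) => eM; rewrite /M; nra.
split; first exact: cf.
move=> z v.
suff d1 : derivable f z 1.
  have -> : v = v *: 1 by rewrite /GRing.scale /= mulr1.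
  by have [] := is_derive_scale v d1.
apply/cvg_ex; exists (cint01 (fun s => G (z + rc s * 0))).
have cK : continuous (fun k : C => cint01 (fun s => G (z + rc s * k))).
  apply: (@cint01_continuous R C (fun q => G (z + rc q.1 * q.2))).
  apply: (cont_comp cG); apply: contD; first exact: cont_cst.
  apply: contM; last exact: cont_snd.
  exact: (cont_comp (@continuous_rc R) (@cont_fst _ _)).
have c0 : (fun k : C => cint01 (fun s => G (z + rc s * k))) @ (0 : C)^' -->
  cint01 (fun s => G (z + rc s * 0)).
  by move=> A /(cK 0) nA; exact: nbhs_dnbhs.
apply: cvg_trans c0; apply: near_eq_cvg; near=> k => /=.
have k0 : k != 0 by near: k; exact: nbhs_dnbhs_neq.
have kE : k *: 1 + z = z + k by rewrite /GRing.scale /= mulr1 addrC.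
by rewrite kE inc /GRing.scale /= mulrA mulVf// mul1r.
Unshelve. all: end_near. Qed.

End Entire.

(** * Estimates for products and for quadratic exponents *)

Section RealEstimates.
Variable R : realType.
Implicit Types s X Q : R.

(** As [1 - w >= exp (- w / (1 - s))] for [0 <= w <= s], a geometric series bounds
    the exponent. *)
Lemma prod_ge s : 0 <= s -> s < 1 ->
  exists2 d : R, 0 < d & forall n, d <= \prod_(k < n) (1 - s ^+ k.+1).
Proof.
move=> s0 s1; exists (expR (- (s / (1 - s) ^+ 2))); first exact: expR_gt0.
have t0 : 0 < 1 - s by lra.
have geo n : \sum_(k < n) s ^+ k.+1 <= s / (1 - s).
  have -> : \sum_(k < n) s ^+ k.+1 = s * (1 - s ^+ n) / (1 - s).
    apply: (mulIf (lt0r_neq0 t0)); rewrite mulfVK ?gt_eqF//.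
    elim: n => [|n ih]; first by rewrite big_ord0 expr0; ring.
    by rewrite big_ord_recr /= mulrDl ih !exprS; ring.
  rewrite ler_pM2r ?invr_gt0// -[leRHS]mulr1 ler_wpM2l//.
  by rewrite lerBlDr lerDl exprn_ge0.
move=> n; apply: le_trans (_ : expR (- ((\sum_(k < n) s ^+ k.+1) / (1 - s))) <= _).
  rewrite ler_expR lerN2 expr2 invfM mulrA ler_pM2r ?invr_gt0//; exact: geo.
elim: n => [|n ih]; first by rewrite !big_ord0 mul0r oppr0 expR0.
rewrite !big_ord_recr /= mulrDl opprD expRD; apply: ler_pM ih _; rewrite ?expR_ge0//.
set w := s ^+ n.+1; have w0 : 0 <= w by rewrite exprn_ge0.
have ws : w <= s by rewrite /w exprS ler_piMr// exprn_ile1// ltW.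
rewrite expRN -[leRHS]invrK lef_pV2 ?posrE ?invr_gt0 ?expR_gt0//; last lra.
apply: le_trans (expR_ge1Dx _); rewrite -div1r ler_pdivrMr; last lra.
have : w * w <= w * s by rewrite ler_wpM2l.
move=> ww.
have -> : (1 + w / (1 - s)) * (1 - w) = 1 + (w * s - w * w) / (1 - s).
  by field; rewrite gt_eqF.
by rewrite lerDl divr_ge0//; lra.
Qed.

(** Since [(1 + w) (1 - w) <= 1], this is the inverse of the bound of [prod_ge]. *)
Lemma prod_le s : 0 <= s -> s < 1 ->
  exists2 B : R, 0 < B & forall n, \prod_(k < n) (1 + s ^+ k.+1) <= B.
Proof.
move=> s0 s1; have [d d0 hd] := prod_ge s0 s1.
have t0 : 0 < 1 - s by lra.
exists d^-1; first by rewrite invr_gt0.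
move=> n; rewrite -[leRHS]div1r ler_pdivlMr//.
apply: le_trans (ler_wpM2l _ (hd n)) _; first by apply: prodr_ge0 => k _;
  rewrite addr_ge0// exprn_ge0.
rewrite -big_split /=; apply: prodr_ile1 => k _.
have k0 : 0 <= s ^+ k.+1 by rewrite exprn_ge0.
have k1 : s ^+ k.+1 <= 1 by rewrite exprn_ile1// ltW.
apply/andP; split; nra.
Qed.

(** Bounds the terms of index [j] and [- j] of the theta series when [Q] is the
    modulus of [e(tau)] and [X] bounds those of [e(z)] and [e(- z)]. *)
Definition tbound X Q j : R := X ^+ j * Q ^+ 'C(j, 2).

Lemma bin2S j : 'C(j.+1, 2) = ('C(j, 2) + j)%N.
Proof. by rewrite binS bin1 addnC. Qed.

Lemma bin2_double n : ('C(n, 2) * 2 = n * n.-1)%N.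
Proof. by elim: n => [|n ih]//; rewrite bin2S mulnDl ih; case: n {ih} => [|n]//=; nia. Qed.

Lemma bin2_double_shift m k :
  ('C(m, 2) + 'C((m + k.+1).+1, 2) = (m + k.+1) * m + 'C(k.+2, 2))%N.
Proof.
have := bin2_double m; have := bin2_double (m + k.+1).+1; have := bin2_double k.+2.
by case: m => [|m] /=; nia.
Qed.

Lemma tbound_ge0 X Q j : 0 <= X -> 0 <= Q -> 0 <= tbound X Q j.
Proof. by move=> X0 Q0; rewrite mulr_ge0// exprn_ge0. Qed.

(** From some index on the quotient of consecutive terms is at most [1 / 2]. *)
Lemma tbound_tail X Q (e : R) : 0 <= X -> 0 <= Q -> Q < 1 -> 0 < e ->
  exists N, forall m, \sum_(N <= j < m) tbound X Q j <= e.
Proof.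
move=> X0 Q0 Q1 e0.
have [J hJ] : exists J, X * Q ^+ J <= 2^-1.
  have : (fun n => X * Q ^+ n) @ \oo --> (X * 0 : R).
    by apply: cvgM; [exact: cvg_cst|apply: cvg_expr; rewrite ger0_norm].
  have h2 : 0 < 2^-1 :> R by rewrite invr_gt0.
  rewrite mulr0 => /cvgrPdist_le/(_ _ h2)[n _ /(_ n)] /(_ (leqnn _)).
  by rewrite sub0r normrN => h; exists n; exact: le_trans (ler_norm _) h.
have step j : (J <= j)%N -> tbound X Q j.+1 <= 2^-1 * tbound X Q j.
  move=> Jj; rewrite /tbound bin2S exprD exprS.
  have -> : X * X ^+ j * (Q ^+ 'C(j, 2) * Q ^+ j) = (X * Q ^+ j) * (X ^+ j * Q ^+ 'C(j, 2)) by ring.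
  apply: ler_wpM2r; first exact: tbound_ge0.
  apply: le_trans hJ; apply: ler_wpM2l => //.
  by rewrite -(subnK Jj) exprD ler_piMl ?exprn_ge0// exprn_ile1// ltW.
have sum N m : (J <= N)%N -> \sum_(N <= j < m) tbound X Q j <= 2 * tbound X Q N.
  move=> JN; have [mN|/ltnW Nm] := leqP m N.
    by rewrite big_geq// mulr_ge0// tbound_ge0.
  suff : \sum_(N <= j < m) tbound X Q j <= 2 * (tbound X Q N - tbound X Q m).
    by have := tbound_ge0 m X0 Q0; lra.
  rewrite -(subnKC Nm); elim: (m - N)%N => [|i ih]; first by rewrite addn0 big_geq// subrr mulr0.
  rewrite addnS big_nat_recr ?leq_addr//=.
  have := step (N + i)%N (leq_trans JN (leq_addr _ _)); lra.
have decay i : tbound X Q (J + i) <= tbound X Q J / 2 ^+ i.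
  elim: i => [|i ih]; first by rewrite addn0 expr0 divr1.
  rewrite addnS; apply: le_trans (step _ (leq_addr _ _)) _.
  have -> : tbound X Q J / 2 ^+ i.+1 = 2^-1 * (tbound X Q J / 2 ^+ i) by rewrite exprS invfM mulrCA.
  by apply: ler_wpM2l; [rewrite invr_ge0|exact: ih].
have [i hi] : exists i, 2 * (tbound X Q J / 2 ^+ i) <= e.
  have : (fun n => (2 * tbound X Q J) * 2^-1 ^+ n) @ \oo --> ((2 * tbound X Q J) * 0 : R).
    by apply: cvgM; [exact: cvg_cst|apply: cvg_expr; rewrite ger0_norm ?invr_ge0//; lra].
  rewrite mulr0 => /cvgrPdist_le/(_ _ e0)[n _ /(_ n)] /(_ (leqnn _)).
  rewrite sub0r normrN => h; exists n; apply: le_trans (ler_norm _) _.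
  by rewrite -exprVn mulrA.
exists (J + i)%N => m; apply: le_trans (sum _ _ (leq_addr _ _)) _.
by apply: le_trans hi; apply: ler_wpM2l.
Qed.

End RealEstimates.

(** * The q-binomial theorem *)

Section QBinomial.
Variables (K : fieldType) (q : K).

(** The q-Pochhammer symbol [(q; q)_n]. *)
Definition qpoch n : K := \prod_(k < n) (1 - q ^+ k.+1).

(** Gaussian binomial coefficients, by Pascal's rule rather than as quotients, so
    that they make sense for every [q]. *)
Fixpoint gauss n k : K :=
  match n, k with
  | 0%N, 0%N => 1
  | 0%N, _ => 0
  | n'.+1, 0%N => 1
  | n'.+1, k'.+1 => gauss n' k' + q ^+ k'.+1 * gauss n' k'.+1
  end.

Lemma qpochS m : qpoch m.+1 = qpoch m * (1 - q ^+ m.+1).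
Proof. by rewrite /qpoch big_ord_recr. Qed.

Lemma gauss0 n : gauss n 0 = 1. Proof. by case: n. Qed.

Lemma gauss_small n k : (n < k)%N -> gauss n k = 0.
Proof.
elim: n k => [|n ih] [|k]//= nk; rewrite !ih ?mulr0 ?addr0//.
exact: ltnW.
Qed.

Lemma gauss_qpoch n k : (k <= n)%N -> gauss n k * (qpoch k * qpoch (n - k)) = qpoch n.
Proof.
elim: n k => [|n ih] [|k]//.
- by move=> _; rewrite /qpoch big_ord0 !mul1r.
- by move=> _; rewrite gauss0 /qpoch big_ord0 !mul1r subn0.
move=> kn; rewrite /= subSS.
have qS := qpochS.
have e1 : gauss n k * (qpoch k.+1 * qpoch (n - k)) = qpoch n * (1 - q ^+ k.+1).
  by rewrite -(ih k kn) qS; ring.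
have e2 : gauss n k.+1 * (qpoch k.+1 * qpoch (n - k)) = qpoch n * (1 - q ^+ (n - k)).
  move: kn; rewrite ltnS leq_eqVlt => /orP[/eqP ->|kn].
    by rewrite gauss_small// subnn expr0 subrr mul0r mulr0.
  by rewrite -(ih k.+1 kn) -(subnSK kn) [qpoch (n - k.+1).+1]qS; ring.
rewrite mulrDl e1 -mulrA e2 qS -[in RHS](subnKC (kn : (k < n.+1)%N)) subSS.
by rewrite exprD; ring.
Qed.

(** Cauchy's q-binomial theorem. *)
Lemma q_binomial n y :
  \prod_(j < n) (1 + y * q ^+ j) = \sum_(k < n.+1) q ^+ 'C(k, 2) * gauss n k * y ^+ k.
Proof.
elim: n y => [|n ih] y; first by rewrite big_ord0 big_ord1 bin0n !expr0 !mul1r.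
rewrite big_ord_recl expr0 mulr1.
under eq_bigr => j _ do rewrite lift0 exprS mulrA.
rewrite ih.
pose A k := q ^+ ('C(k, 2) + k) * gauss n k * y ^+ k.
have -> : \sum_(k < n.+1) q ^+ 'C(k, 2) * gauss n k * (y * q) ^+ k = \sum_(k < n.+1) A k.
  by apply: eq_bigr => k _; rewrite /A exprMn exprD; ring.
have AS : \sum_(i < n.+1) A i.+1 = \sum_(i < n.+1) A i - 1.
  have : \sum_(i < n.+2) A i = \sum_(i < n.+1) A i.
    by rewrite big_ord_recr /= [A n.+1]/A gauss_small// mulr0 mul0r addr0.
  rewrite big_ord_recl [A ord0]/A gauss0 bin0n addn0 !expr0 !mul1r => <-.
  by rewrite addrAC subrr add0r; apply: eq_bigr => i _; rewrite lift0.
rewrite [RHS]big_ord_recl gauss0 bin0n !expr0 !mul1r.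
have -> : \sum_(i < n.+1) q ^+ 'C(lift ord0 i, 2) * gauss n.+1 (lift ord0 i) * y ^+ lift ord0 i
   = \sum_(i < n.+1) A i * y + \sum_(i < n.+1) A i.+1.
  rewrite -big_split /=; apply: eq_bigr => i _.
  by rewrite /A bin2S !exprD !exprS; ring.
by rewrite -mulr_suml AS; ring.
Qed.

End QBinomial.

(** * The theta function: convergence, quasi-periodicity, zeros *)

Section Theta.
Variable R : realType.
Local Notation C := (Cplx R).
Local Notation Re := (@complex.Re R).
Local Notation Im := (@complex.Im R).

Lemma complex_cauchy (s : nat -> C) :
  (forall e : R, 0 < e -> exists N, forall m, (N <= m)%N -> mod_ (s m - s N) <= e) ->
  exists l : C, s @ \oo --> l.
Proof.
move=> h.
have real_cauchy (p : C -> R) : (forall z w, `|p z - p w| <= mod_ (z - w)) ->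
    cvg (p \o s @ \oo).
  move=> hp; apply/cauchy_cvgP/cauchy_exP => e e0.
  have e2 : 0 < e / 2 by lra.
  have [N hN] := h _ e2; exists (p (s N)).
  exists N => // m /= /hN hm; rewrite /ball /= distrC.
  by apply: le_lt_trans (hp _ _) _; apply: le_lt_trans hm _; lra.
have /cvg_ex[a ha] : cvg (Re \o s @ \oo).
  by apply: real_cauchy => z w; rewrite -ReN -ReD Re_le_mod.
have /cvg_ex[b hb] : cvg (Im \o s @ \oo).
  by apply: real_cauchy => z w; rewrite -ImN -ImD Im_le_mod.
exists (Complex a b).
have -> : s = (fun n => Complex (Re (s n)) (Im (s n)) : C) by apply/funext => n; case: (s n).
exact: (cvg_Complex ha hb).
Qed.

Lemma e2ipi_nat n (z : C) : e2ipi (n%:R * z) = e2ipi z ^+ n.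
Proof.
elim: n => [|n ih]; first by rewrite mul0r e2ipi0.
by rewrite exprS -ih -e2ipiD; congr e2ipi; rewrite -[n.+1]add1n natrD; ring.
Qed.

Lemma e2ipi_int (k : int) : e2ipi (k%:~R : C) = 1.
Proof.
case: k => n; first by rewrite -[_%:~R]mulr1 e2ipi_nat e2ipi1 expr1n.
by rewrite NegzE rmorphN e2ipiN /= -[n.+1%:~R]mulr1 e2ipi_nat e2ipi1 expr1n invr1.
Qed.

Lemma entireV (V : normedModType C) (f : V -> C) : entire f -> (forall z, f z != 0) ->
  entire (fun z => (f z)^-1).
Proof.
move=> [cf df] f0; split=> [z|z v]; first exact: (ccvgV (f0 z) (cf z)).
exact: (derivableV (f0 z) (df z v)).
Qed.

Lemma affine_lin (a b : C) : affine (fun z : C => a * z + b).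
Proof.
split.
  by apply: contD; [apply: contM; [exact: cont_cst|exact: cont_id]|exact: cont_cst].
by exists (fun z => a * z) => k z v; rewrite /GRing.scale /=; ring.
Qed.

Lemma entire_cexp : entire (@cexp R).
Proof.
split=> [|z v]; first exact: continuous_cexp.
have -> : v = v *: 1 by rewrite /GRing.scale /= mulr1.
by have [] := is_derive_scale v (@derivable_cexp R z).
Qed.

Lemma entire_e2ipi (a b : C) : entire (fun z : C => e2ipi (a * z + b)).
Proof.
have -> : (fun z : C => e2ipi (a * z + b)) =
  (fun z : C => cexp ((a * Complex 0 (pi *+ 2)) * z + b * Complex 0 (pi *+ 2))).
  by apply/funext => z; rewrite e2ipiE; congr cexp; ring.
exact: (entire_affine entire_cexp (affine_lin _ _)).
Qed.

Lemma signzS (k : int) : (-1 : C) ^ (k + 1) = - (-1) ^ k.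
Proof. by rewrite expfzDr ?oppr_eq0 ?oner_eq0// expr1z mulrN1. Qed.
Lemma signzN (k : int) : (-1 : C) ^ (- k) = (-1) ^ k.
Proof. by rewrite -exprz_inv invrN1. Qed.

Variable tau : C.
Hypothesis tau_gt0 : 0 < Im tau.
Local Notation q := (e2ipi tau).
Local Notation term := (theta_term tau).

Lemma term_shift (z : C) k : term (z + tau) k = - e2ipi (- z) * term z (k + 1).
Proof.
rewrite /theta_term signzS.
have -> : k%:~R * (z + tau) + k%:~R * (k%:~R - 1) / 2 * tau =
   - z + ((k + 1)%:~R * z + (k + 1)%:~R * ((k + 1)%:~R - 1) / 2 * tau).
  by rewrite intrD; field.
by rewrite e2ipiD; ring.
Qed.

Lemma term_refl (z : C) k : term (- z) k = - e2ipi (- z) * term z (1 - k).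
Proof.
have -> : (1 - k = - k + 1)%R by rewrite addrC.
rewrite /theta_term signzS signzN.
have -> : k%:~R * - z + k%:~R * (k%:~R - 1) / 2 * tau =
   - z + ((- k + 1)%:~R * z + (- k + 1)%:~R * ((- k + 1)%:~R - 1) / 2 * tau).
  by rewrite intrD rmorphN /=; field.
by rewrite e2ipiD; ring.
Qed.

Lemma term_period (z : C) k : term (z + 1) k = term z k.
Proof.
rewrite /theta_term; congr (_ * _).
have -> : k%:~R * (z + 1) + k%:~R * (k%:~R - 1) / 2 * tau =
  k%:~R + (k%:~R * z + k%:~R * (k%:~R - 1) / 2 * tau) by ring.
by rewrite e2ipiD e2ipi_int mul1r.
Qed.

Lemma half_bin2 n : n%:R * (n%:R - 1) / 2 = 'C(n, 2)%:R :> C.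
Proof.
elim: n => [|n ih]; first by rewrite bin0n mul0r mul0r.
by rewrite bin2S natrD -ih -[n.+1]add1n natrD; field.
Qed.

Lemma term_pos (z : C) (n : nat) : term z n%:Z = (-1) ^+ n * e2ipi z ^+ n * q ^+ 'C(n, 2).
Proof. by rewrite /theta_term e2ipiD half_bin2 !e2ipi_nat mulrA. Qed.

Lemma term_neg (z : C) (n : nat) :
  term z (- (n.+1)%:Z) = (-1) ^+ n.+1 * e2ipi (- z) ^+ n.+1 * q ^+ 'C(n.+2, 2).
Proof.
rewrite /theta_term signzN.
have -> : (- (n.+1)%:Z)%:~R * z + (- (n.+1)%:Z)%:~R * ((- (n.+1)%:Z)%:~R - 1) / 2 * tau =
  n.+1%:R * (- z) + ((n.+2)%:R * (n.+2%:R - 1) / 2) * tau :> C.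
  by rewrite rmorphN /= -[n.+2]add1n natrD; field.
by rewrite half_bin2 e2ipiD !e2ipi_nat mulrA.
Qed.

Let Q : R := expR (- (pi *+ 2) * Im tau).
Let X (B : R) : R := expR ((pi *+ 2) * B).

Lemma mod_q : mod_ q = Q.
Proof. by rewrite mod_e2ipi. Qed.
Lemma Q_ge0 : 0 <= Q. Proof. exact: expR_ge0. Qed.
Lemma Q_lt1 : Q < 1.
Proof. by rewrite /Q expR_lt1 mulNr oppr_lt0 mulr_gt0// mulrn_wgt0// pi_gt0. Qed.
Lemma X_ge0 B : 0 <= X B. Proof. exact: expR_ge0. Qed.

Lemma mod_sign n : mod_ ((-1 : C) ^+ n) = 1.
Proof. by rewrite modX modN mod1 expr1n. Qed.

Lemma mod_x_le (z : C) (B : R) : `|Im z| <= B -> mod_ (e2ipi z) <= X B.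
Proof.
move=> zB; rewrite mod_e2ipi ler_expR mulNr -mulrN; apply: ler_wpM2l.
  by rewrite mulrn_wge0 ?pi_ge0.
by apply: le_trans zB; rewrite -normrN ler_norm.
Qed.

Lemma term_pos_le (z : C) (B : R) n : `|Im z| <= B -> mod_ (term z n%:Z) <= tbound (X B) Q n.
Proof.
move=> zB; rewrite term_pos !modM mod_sign mul1r !modX mod_q.
apply: ler_wpM2r; first by rewrite exprn_ge0// Q_ge0.
by apply: lerXn2r; rewrite ?nnegrE ?mod_ge0 ?X_ge0// mod_x_le.
Qed.

Lemma term_neg_le (z : C) (B : R) n : `|Im z| <= B ->
  mod_ (term z (- (n.+1)%:Z)) <= tbound (X B) Q n.+1.
Proof.
move=> zB; rewrite term_neg !modM mod_sign mul1r !modX mod_q.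
apply: ler_pM; rewrite ?exprn_ge0 ?mod_ge0 ?Q_ge0//.
  by apply: lerXn2r; rewrite ?nnegrE ?mod_ge0 ?X_ge0// mod_x_le// ImN normrN.
rewrite (bin2S n.+1) exprD ler_piMr ?exprn_ge0 ?Q_ge0//.
by rewrite exprn_ile1 ?Q_ge0// ltW// Q_lt1.
Qed.

Definition theta_sum (z : C) (N : nat) : C :=
  \sum_(k < N) (term z k%:Z + term z (- k.+1%:Z)).

Lemma theta_sum_tail (B e : R) : 0 < e -> exists N, forall n m (z : C), `|Im z| <= B ->
  (N <= n)%N -> (n <= m)%N -> mod_ (theta_sum z m - theta_sum z n) <= e.
Proof.
move=> e0; have e2 : 0 < e / 2 by lra.
have [N hN] := tbound_tail (X_ge0 B) Q_ge0 Q_lt1 e2.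
exists N => n m z zB Nn nm.
have -> : theta_sum z m - theta_sum z n = \sum_(n <= k < m) (term z k%:Z + term z (- k.+1%:Z)).
  rewrite /theta_sum -!(big_mkord xpredT (fun k => term z k%:Z + term z (- k.+1%:Z))).
  by rewrite (big_cat_nat _ nm)//= addrAC subrr add0r.
have t0 j : 0 <= tbound (X B) Q j := tbound_ge0 j (X_ge0 B) Q_ge0.
have sub i j : (N <= i)%N -> \sum_(i <= k < j) tbound (X B) Q k <= e / 2.
  move=> Ni; have [ij|ji] := leqP i j; last by rewrite big_geq; [exact: ltW|exact: ltnW].
  apply: le_trans (hN j); rewrite [leRHS](big_cat_nat _ ij)//= lerDr.
  exact: sumr_ge0.
apply: le_trans (mod_sum _ _ _) _.
apply: le_trans (_ : \sum_(n <= k < m) (tbound (X B) Q k + tbound (X B) Q k.+1) <= _).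
  by apply: ler_sum => k _; apply: le_trans (modD _ _) _;
    exact: (lerD (term_pos_le k zB) (term_neg_le k zB)).
rewrite big_split /= [e]splitr lerD ?sub//.
by have := sub n.+1 m.+1 (leqW Nn); rewrite big_add1.
Qed.

(** The limit in the definition of [theta] exists, the partial sums being uniformly
    Cauchy. *)
Lemma theta_cvg (z : C) : theta_sum z @ \oo --> theta tau z.
Proof.
have [l hl] : exists l : C, theta_sum z @ \oo --> l.
  apply: complex_cauchy => e e0; have [N hN] := theta_sum_tail `|Im z| e0.
  by exists N => m Nm; apply: hN.
suff -> : theta tau z = l by [].
by apply: cvg_lim hl; exact: norm_hausdorff.
Qed.

Lemma theta_uniform (B e : R) : 0 < e -> exists N, forall n (z : C), `|Im z| <= B ->
  (N <= n)%N -> mod_ (theta_sum z n - theta tau z) <= e.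
Proof.
move=> e0; have [N hN] := theta_sum_tail B e0; exists N => n z zB Nn.
apply/ler_addgt0Pl => d d0.
have [M _ hM] := proj1 (cvgCP _ _) (@theta_cvg z) d d0.
have nm := leq_maxl n M; have Mm := leq_maxr n M.
have := hM (maxn n M) Mm => /ltW h1; have h2 := hN n (maxn n M) z zB Nn nm.
have -> : theta_sum z n - theta tau z =
  (theta_sum z (maxn n M) - theta tau z) - (theta_sum z (maxn n M) - theta_sum z n) by ring.
by apply: le_trans (modB _ _) _; rewrite lerD.
Qed.

Lemma entire_theta : entire (theta tau).
Proof.
apply: (@entire_limit R (fun n z => theta_sum z n)).
  move=> n; apply: entire_sum => k; apply: entireD; apply: entireM.
  - exact: entire_cst.
  - exact: entire_e2ipi.
  - exact: entire_cst.
  - exact: entire_e2ipi.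
move=> r e e0; have [N hN] := theta_uniform r e0; exists N => z zr.
by apply: hN => //; apply: le_trans (Im_le_mod z) zr.
Qed.

Lemma term_small (z : C) (e : R) : 0 < e -> exists N, forall n, (N <= n)%N ->
  mod_ (term z n%:Z) <= e /\ mod_ (term z (- n.+1%:Z)) <= e.
Proof.
move=> e0; have [N hN] := tbound_tail (X_ge0 `|Im z|) Q_ge0 Q_lt1 e0.
have t0 j : 0 <= tbound (X `|Im z|) Q j := tbound_ge0 j (X_ge0 _) Q_ge0.
have h n : (N <= n)%N -> tbound (X `|Im z|) Q n <= e.
  move=> Nn; apply: le_trans (hN n.+1); rewrite big_nat_recr//= lerDr.
  exact: sumr_ge0.
exists N => n Nn; split.
  by apply: le_trans (h n Nn); exact: term_pos_le.
by apply: le_trans (h n.+1 (leqW Nn)); exact: term_neg_le.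
Qed.

Lemma term_pos_cvg (z : C) i : (fun n : nat => term z (n + i)%N%:Z) @ \oo --> (0 : C).
Proof.
apply: (proj2 (cvgCP _ _)) => e e0; have e2 : 0 < e / 2 by lra.
have [N hN] := term_small z e2; exists N => // n /= Nn; rewrite subr0.
by have [h _] := hN (n + i)%N (leq_trans Nn (leq_addr _ _)); apply: le_lt_trans h _; lra.
Qed.

Lemma term_neg_cvg (z : C) i : (fun n : nat => term z (- (n + i).+1%:Z)) @ \oo --> (0 : C).
Proof.
apply: (proj2 (cvgCP _ _)) => e e0; have e2 : 0 < e / 2 by lra.
have [N hN] := term_small z e2; exists N => // n /= Nn; rewrite subr0.
by have [_ h] := hN (n + i)%N (leq_trans Nn (leq_addr _ _)); apply: le_lt_trans h _; lra.
Qed.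

Lemma theta_cvg_shift i (z : C) : (fun n => theta_sum z (n + i)) @ \oo --> theta tau z.
Proof. exact: (cvg_comp _ _ (@cvg_addnr i) (@theta_cvg z)). Qed.

Lemma theta_sumS (z : C) N :
  theta_sum z N.+1 = theta_sum z N + (term z N%:Z + term z (- N.+1%:Z)).
Proof. by rewrite /theta_sum big_ord_recr. Qed.

Lemma theta_unique (z l : C) (u : nat -> C) : u @ \oo --> l ->
  (forall n, theta_sum z (n + 2) = u n) -> theta tau z = l.
Proof.
move=> ul e; apply: (@cvg_unique _ (@norm_hausdorff _ C) _ _ _ _ _ ul).
have := @theta_cvg_shift 2 z; have -> : (fun n => theta_sum z (n + 2)) = u by apply/funext.
by [].
Qed.

Lemma thetaD1 (z : C) : theta tau (z + 1) = theta tau z.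
Proof.
apply: (theta_unique (@theta_cvg_shift 2 z)) => n.
by apply: eq_bigr => k _; rewrite !term_period.
Qed.

(** The translation shifts the index of summation by one; the range of the partial
    sums is restored at the cost of two boundary terms, which tend to [0]. *)
Lemma thetaDtau (z : C) : theta tau (z + tau) = - e2ipi (- z) * theta tau z.
Proof.
have step N : theta_sum (z + tau) N =
    - e2ipi (- z) * (theta_sum z N + term z N%:Z - term z (- N%:Z)).
  elim: N => [|N ih]; first by rewrite /theta_sum !big_ord0 oppr0; ring.
  rewrite !theta_sumS ih !term_shift.
  have -> : N%:Z + 1 = N.+1%:Z by lia.
  have -> : - N.+1%:Z + 1 = - N%:Z by lia.
  ring.
(* [N = n + 2], so that [- N] and, in [thetaN], also [1 - N] are opposites of successors *)
pose u n := - e2ipi (- z) * (theta_sum z (n + 2) + term z (n + 2)%N%:Z - term z (- (n + 1).+1%:Z)).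
apply: (@theta_unique _ _ u); last by move=> n; rewrite step /u addn1 addn2.
rewrite -[X in _ --> X]/(- e2ipi (- z) * theta tau z).
have -> : theta tau z = theta tau z + 0 - 0 by rewrite addr0 subr0.
apply: ccvgM; first exact: cvg_cst.
apply: ccvgB; last exact: term_neg_cvg.
by apply: ccvgD; [exact: theta_cvg_shift|exact: term_pos_cvg].
Qed.

(** The reflection exchanges the indices [k] and [1 - k]; again the boundary terms
    tend to [0]. *)
Lemma thetaN (z : C) : theta tau (- z) = - e2ipi (- z) * theta tau z.
Proof.
have step N : theta_sum (- z) N = - e2ipi (- z) *
    (theta_sum z N + term z N%:Z + term z N.+1%:Z - term z (- N%:Z) - term z (1 - N%:Z)).
  elim: N => [|N ih]; first by rewrite /theta_sum !big_ord0 oppr0 subr0; ring.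
  rewrite !theta_sumS ih !term_refl.
  have -> : 1 - - N.+1%:Z = N.+2%:Z by lia.
  have -> : 1 - N.+1%:Z = - N%:Z by lia.
  ring.
pose u n := - e2ipi (- z) * (theta_sum z (n + 2) + term z (n + 2)%N%:Z + term z (n + 3)%N%:Z
   - term z (- (n + 1).+1%:Z) - term z (- (n + 0).+1%:Z)).
apply: (@theta_unique _ _ u).
  have -> : theta tau z = theta tau z + 0 + 0 - 0 - 0 by rewrite !addr0 !subr0.
  apply: ccvgM; first exact: cvg_cst.
  apply: ccvgB; last exact: term_neg_cvg.
  apply: ccvgB; last exact: term_neg_cvg.
  apply: ccvgD; last exact: term_pos_cvg.
  by apply: ccvgD; [exact: theta_cvg_shift|exact: term_pos_cvg].
move=> n; rewrite step /u.
have -> : (n + 2).+1 = (n + 3)%N by lia.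
have -> : - (n + 2)%N%:Z = - (n + 1).+1%:Z by lia.
by have -> : 1 - (n + 1).+1%:Z = - (n + 0).+1%:Z by lia.
Qed.

Lemma theta0 : theta tau 0 = 0.
Proof.
have := thetaN 0; rewrite oppr0 e2ipi0 mulN1r => e.
have h : theta tau 0 + theta tau 0 = 0 by rewrite {1}e addNr.
apply/eqP; rewrite -(mulrI_eq0 _ (@mulfI _ (2 : C) _)) ?pnatr_eq0//.
by rewrite mulr_natl mulr2n h.
Qed.

(** Finite form of the Jacobi triple product, from the q-binomial theorem with
    [2 N] factors evaluated at [- x q^(-N)]. *)
Lemma jacobi_finite (z : C) N (x := e2ipi z) :
  \prod_(k < N) ((1 - x * q ^+ k) * (1 - x^-1 * q ^+ k.+1)) =
  \sum_(k < N.+1) gauss q (N + N) (N + k) * term z k%:Z +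
  \sum_(k < N) gauss q (N + N) (N - k.+1) * term z (- k.+1%:Z).
Proof.
have aux (a b c d : C) : c != 0 -> a * (b / c) * (c * d) = b * (a * d).
  by move=> c0; field.
have aux2 (a b c d e : C) : c != 0 -> a * b * (d * e) = a / c * (b * e) * (d * c).
  by move=> c0; field.
have x0 : x != 0 by exact: e2ipi_neq0.
have q0 : q != 0 by exact: e2ipi_neq0.
pose y := - x / q ^+ N.
pose W := (- x) ^+ N / q ^+ 'C(N.+1, 2).
have W0 : W != 0 by rewrite mulf_neq0 ?invr_eq0 ?expf_neq0 ?oppr_eq0.
have prodW : \prod_(j < N) (1 + y * q ^+ j) = W * \prod_(k < N) (1 - x^-1 * q ^+ k.+1).
  have -> : W = \prod_(j < N) (- x / q ^+ j.+1).
    rewrite /W; elim: N {y W W0} => [|N ih]; first by rewrite big_ord0 !expr0 divr1.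
    by rewrite big_ord_recr /= -ih bin2S exprD exprSr invfM; ring.
  rewrite -big_split /= (reindex_inj rev_ord_inj) /=; apply: eq_bigr => j _.
  rewrite /y; have := ltn_ord j; set i := nat_of_ord j => iN.
  rewrite -[in q ^+ N](subnK iN) exprD; field.
  by rewrite x0 !expf_neq0.
have prodE : \prod_(j < N + N) (1 + y * q ^+ j) =
   W * \prod_(k < N) ((1 - x * q ^+ k) * (1 - x^-1 * q ^+ k.+1)).
  rewrite big_split_ord /= prodW big_split /= -mulrA; congr (W * _); rewrite mulrC.
  congr (_ * _); apply: eq_bigr => j _.
  by rewrite /y exprD; field; rewrite expf_neq0.
apply: (mulfI W0); rewrite -prodE q_binomial -addnS big_split_ord /= addrC mulrDr.
congr (_ + _); rewrite mulr_sumr.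
  apply: eq_bigr => k _; rewrite term_pos.
  suff h : q ^+ 'C(N + k, 2) * y ^+ (N + k) = W * ((-1) ^+ k * x ^+ k * q ^+ 'C(k, 2)).
    by rewrite mulrAC h /x; ring.
  rewrite /W /y expr_div_n -exprM.
  have e : ('C(N + k, 2) + 'C(N.+1, 2) = N * (N + k) + 'C(k, 2))%N.
    have b := bin2_double.
    have := b (N + k)%N; have := b N.+1; have := b k; case: (nat_of_ord k) => [|k'];
      case: (N) => [|N'] /=; nia.
  apply: (@mulIf _ (q ^+ (N * (N + k)) * q ^+ 'C(N.+1, 2))).
    by rewrite mulf_neq0 ?expf_neq0.
  transitivity ((- x) ^+ (N + k) * q ^+ ('C(N + k, 2) + 'C(N.+1, 2))).
    by rewrite aux ?expf_neq0// [in RHS](exprD q).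
  rewrite e (exprD (- x)) (exprD q (N * (N + k)) 'C(k, 2)) [(- x) ^+ k]exprNn.
  by apply: aux2; rewrite expf_neq0.
rewrite (reindex_inj rev_ord_inj) /=; apply: eq_bigr => k _.
rewrite term_neg; have kN := ltn_ord k; set m := (N - k.+1)%N.
suff h : q ^+ 'C(m, 2) * y ^+ m = W * ((-1) ^+ k.+1 * e2ipi (- z) ^+ k.+1 * q ^+ 'C(k.+2, 2)).
  by rewrite mulrAC h; ring.
have NE : N = (m + k.+1)%N by rewrite /m subnK.
rewrite /W /y expr_div_n -exprM e2ipiN -/x.
have e : ('C(m, 2) + 'C(N.+1, 2) = N * m + 'C(k.+2, 2))%N.
  by have := bin2_double_shift m k; rewrite -NE.
apply: (@mulIf _ (q ^+ (N * m) * q ^+ 'C(N.+1, 2))).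
  by rewrite mulf_neq0 ?expf_neq0.
transitivity ((- x) ^+ m * q ^+ ('C(m, 2) + 'C(N.+1, 2))).
  by rewrite aux ?expf_neq0// [in RHS](exprD q).
rewrite e exprD.
have -> : (- x) ^+ N = (- x) ^+ m * ((-1) ^+ k.+1 * x ^+ k.+1).
  by rewrite -exprNn -exprD -NE.
have -> : (-1) ^+ k.+1 * x^-1 ^+ k.+1 = ((-1) ^+ k.+1 * x ^+ k.+1)^-1 :> C.
  by rewrite invfM exprVn -[in RHS]exprVn invrN1.
have s0 : (-1) ^+ k.+1 * x ^+ k.+1 != 0 by rewrite mulf_neq0 ?expf_neq0 ?oppr_eq0 ?oner_eq0.
move: s0 (expf_neq0 'C(N.+1, 2) q0).
move: ((-1) ^+ k.+1 * x ^+ k.+1) (q ^+ 'C(N.+1, 2)) (q ^+ (N * m)) (q ^+ 'C(k.+2, 2)) ((- x) ^+ m).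
by move=> A B D E F A0 B0; field; rewrite A0 B0.
Qed.

Lemma mod_1B_ge (w : C) : 1 - mod_ w <= mod_ (1 - w).
Proof. by have := mod_dist_ge 1 w; rewrite mod1. Qed.

Lemma qpoch_bounds : exists d B : R, [/\ 0 < d, 0 < B &
  forall n, d <= mod_ (qpoch q n) /\ mod_ (qpoch q n) <= B].
Proof.
have [d d0 hd] := prod_ge Q_ge0 Q_lt1; have [B B0 hB] := prod_le Q_ge0 Q_lt1.
exists d, B; split=> // n; rewrite /qpoch mod_prod; split.
  apply: le_trans (hd n) _; apply: ler_prod => k _; apply/andP; split.
    by rewrite subr_ge0 exprn_ile1 ?Q_ge0// ltW// Q_lt1.
  by rewrite -mod_q -modX mod_1B_ge.
apply: le_trans (hB n); apply: ler_prod => k _; rewrite mod_ge0 /=.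
by apply: le_trans (modB _ _) _; rewrite mod1 modX mod_q.
Qed.

Lemma qpoch_neq0 n : qpoch q n != 0.
Proof. by rewrite -mod_gt0; have [d [B [d0 _ /(_ n)[h _]]]] := qpoch_bounds;
  apply: lt_le_trans h. Qed.

Lemma cvg_qX : (fun n => q ^+ n) @ \oo --> (0 : C).
Proof.
apply: (proj2 (cvgCP _ _)) => e e0.
have : (fun n => Q ^+ n) @ \oo --> (0 : R).
  by apply: cvg_expr; rewrite ger0_norm ?Q_ge0// Q_lt1.
move=> /cvgrPdist_lt/(_ e e0); apply: filterS => n; rewrite sub0r normrN subr0 modX mod_q.
by rewrite ger0_norm// exprn_ge0// Q_ge0.
Qed.

(** The coefficients of [jacobi_finite] multiplied by [(q; q)_N ^ 2 / (q; q)_(2 N)],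
    the inverse of the central one. *)
Definition gauss_ratio N k : C := qpoch q N ^+ 2 / (qpoch q (N + k) * qpoch q (N - k)).

(** Passing from [k] to [k + 1] multiplies by a quotient of two factors [1 - q ^ i]
    with [i] going to infinity. *)
Lemma gauss_ratio_cvg k : (fun N => gauss_ratio N k) @ \oo --> (1 : C).
Proof.
elim: k => [|k ih].
  have -> : (fun N => gauss_ratio N 0) = fun=> 1.
    by apply/funext => N; rewrite /gauss_ratio addn0 subn0 -expr2 mulfV// expf_neq0// qpoch_neq0.
  exact: cvg_cst.
have c1 : (fun N => 1 - q ^+ (N - k)) @ \oo --> (1 - 0 : C).
  by apply: ccvgB; [exact: cvg_cst|exact: (cvg_comp _ _ (@cvg_subnr k) cvg_qX)].
have c2 : (fun N => (1 - q ^+ (N + k.+1))^-1) @ \oo --> ((1 - 0)^-1 : C).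
  apply: ccvgV; first by rewrite subr0 oner_eq0.
  by apply: ccvgB; [exact: cvg_cst|exact: (cvg_comp _ _ (@cvg_addnr k.+1) cvg_qX)].
have c3 : (fun N => gauss_ratio N k * (1 - q ^+ (N - k)) * (1 - q ^+ (N + k.+1))^-1) @ \oo -->
    (1 * (1 - 0) * (1 - 0)^-1 : C).
  by apply: ccvgM c2; exact: ccvgM ih c1.
rewrite subr0 invr1 !mulr1 in c3.
apply: cvg_trans c3; apply: near_eq_cvg; near=> N => /=.
have kN : (k < N)%N by near: N; exact: nbhs_infty_gt.
rewrite /gauss_ratio addnS; have := qpoch_neq0 (N + k).+1; have := qpoch_neq0 (N - k).
have -> : (N - k = (N - k.+1).+1)%N by rewrite subnSK.
rewrite !qpochS.
have aux (P A B D E : C) : A * B != 0 -> D * E != 0 ->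
    P / (D * (A * B)) * B / E = P / (D * E * A).
  rewrite !mulf_eq0 !negb_or => /andP[a1 a2] /andP[b1 b2].
  by field; rewrite a1 a2 b1 b2.
exact: aux.
Unshelve. all: end_near. Qed.

Lemma gauss_ratioE N k : (k <= N)%N ->
  gauss q (N + N) (N + k) * (qpoch q N ^+ 2 / qpoch q (N + N)) = gauss_ratio N k.
Proof.
move=> kN; have := @gauss_qpoch _ q (N + N) (N + k); rewrite leq_add2l => /(_ kN).
rewrite subnDl => <-; rewrite /gauss_ratio; have := qpoch_neq0 (N + k); have := qpoch_neq0 (N - k).
move=> a b.
have [g0|g0] := eqVneq (gauss q (N + N) (N + k)) 0.
  have := @gauss_qpoch _ q (N + N) (N + k); rewrite leq_add2l => /(_ kN).
  by rewrite g0 mul0r => /esym/eqP; rewrite (negPf (qpoch_neq0 _)).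
by field; rewrite a b g0.
Qed.

Lemma gauss_ratioNE N k : (k < N)%N ->
  gauss q (N + N) (N - k.+1) * (qpoch q N ^+ 2 / qpoch q (N + N)) = gauss_ratio N k.+1.
Proof.
move=> kN; have le : (N - k.+1 <= N + N)%N by lia.
have := @gauss_qpoch _ q (N + N) (N - k.+1) le.
have -> : (N + N - (N - k.+1) = N + k.+1)%N by lia.
move=> e; have := qpoch_neq0 (N + N); rewrite -e mulf_eq0 negb_or => /andP[g0 _].
rewrite /gauss_ratio; have a := qpoch_neq0 (N + k.+1); have b := qpoch_neq0 (N - k.+1).
by field; rewrite a b g0.
Qed.

(** On this strip all the factors of the triple product but [1 - e(z)] stay away from
    zero, and the normalised finite products converge to [theta] by dominated
    convergence. *)
Lemma theta_lower : exists2 d : R, 0 < d & forall z : C, `|Im z| <= Im tau / 2 ->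
  d * mod_ (1 - e2ipi z) <= mod_ (theta tau z).
Proof.
have [d [B [d0 B0 hq]]] := qpoch_bounds.
pose s := expR (- (pi * Im tau)).
have s0 : 0 <= s by exact: expR_ge0.
have s1 : s < 1 by rewrite expR_lt1 oppr_lt0 mulr_gt0// pi_gt0.
have [c c0 hc] := prod_ge s0 s1.
exists (c ^+ 2 * (d ^+ 2 / B)); first by rewrite mulr_gt0 ?exprn_gt0// divr_gt0// exprn_gt0.
move=> z zs; pose x := e2ipi z.
have factor (w : C) k : `|Im w| <= Im tau / 2 -> 1 - s ^+ k.+1 <= mod_ (1 - e2ipi w * q ^+ k.+1).
  move=> ws; apply: le_trans (mod_1B_ge _); rewrite lerD2l lerN2 modM modX mod_q mod_e2ipi.
  rewrite /Q -expRM_natl -expRD /s -expRM_natl ler_expR.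
  have p0 := pi_gt0 R; move: ws; rewrite ler_norml => /andP[w1 w2].
  rewrite -mulr_natr mulr2n.
  have k1 : (1 : R) <= k.+1%:R by rewrite ler1n.
  set kk := k.+1%:R in k1 *.
  have h1 : - (pi * (1 + 1)) * Im w <= pi * Im tau by nra.
  have h2 : pi * Im tau <= kk * (pi * Im tau) by rewrite ler_peMl// mulr_ge0// ltW.
  lra.
have c_le N : c <= mod_ (\prod_(k < N) (1 - x * q ^+ k.+1)).
  rewrite mod_prod; apply: le_trans (hc N) _; apply: ler_prod => k _; apply/andP; split.
    by rewrite subr_ge0 exprn_ile1// ltW.
  exact: factor.
have c_leN N : c <= mod_ (\prod_(k < N) (1 - x^-1 * q ^+ k.+1)).
  rewrite mod_prod; apply: le_trans (hc N) _; apply: ler_prod => k _; apply/andP; split.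
    by rewrite subr_ge0 exprn_ile1// ltW.
  by rewrite /x -e2ipiN; apply: factor; rewrite ImN normrN.
pose P N := \prod_(k < N) ((1 - x * q ^+ k) * (1 - x^-1 * q ^+ k.+1)).
pose kap N := qpoch q N ^+ 2 / qpoch q (N + N).
have lower N : c ^+ 2 * (d ^+ 2 / B) * mod_ (1 - x) <= mod_ (kap N.+1 * P N.+1).
  have p1 : c ^+ 2 * mod_ (1 - x) <= mod_ (P N.+1).
    rewrite /P big_split /= big_ord_recl expr0 mulr1 !modM.
    have -> : \prod_(i < N) (1 - x * q ^+ lift ord0 i) = \prod_(i < N) (1 - x * q ^+ i.+1).
      by apply: eq_bigr => i _; rewrite lift0.
    have a := c_le N; have b := c_leN N.+1; have m0 := mod_ge0 (1 - x).
    rewrite expr2 mulrAC [c * _]mulrC; have h := ler_wpM2l m0 a.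
    by apply: ler_pM => //; [rewrite mulr_ge0// ltW|exact: ltW].
  have k1 : d ^+ 2 / B <= mod_ (kap N.+1).
    rewrite /kap modM modV modX; have [a _] := hq N.+1; have [a2 b] := hq (N.+1 + N.+1)%N.
    apply: ler_pM.
    - by rewrite exprn_ge0// ltW.
    - by rewrite invr_ge0 ltW.
    - by apply: lerXn2r => //; rewrite nnegrE ?mod_ge0// ltW.
    - by rewrite lef_pV2// ?posrE//; exact: lt_le_trans a2.
  have -> : c ^+ 2 * (d ^+ 2 / B) * mod_ (1 - x) = (d ^+ 2 / B) * (c ^+ 2 * mod_ (1 - x)) by ring.
  rewrite modM; apply: ler_pM => //.
    by rewrite divr_ge0 ?exprn_ge0// ltW.
  by rewrite mulr_ge0 ?mod_ge0// exprn_ge0// ltW.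
have expand N : kap N * P N = \sum_(k < N.+1) gauss_ratio N k * term z k%:Z +
    \sum_(k < N) gauss_ratio N k.+1 * term z (- k.+1%:Z).
  rewrite /P jacobi_finite mulrDr !mulr_sumr; congr (_ + _); apply: eq_bigr => k _.
    by rewrite mulrA [kap N * _]mulrC gauss_ratioE// -ltnS.
  by rewrite mulrA [kap N * _]mulrC gauss_ratioNE.
pose b := B ^+ 2 / (d * d).
have b0 : 0 < b by rewrite divr_gt0// ?mulr_gt0// exprn_gt0.
have ratio_le N k : mod_ (gauss_ratio N k) <= b.
  rewrite /gauss_ratio modM modV modX modM; have [_ h1] := hq N.
  have [h2 _] := hq (N + k)%N; have [h3 _] := hq (N - k)%N.
  apply: ler_pM.
  - by rewrite exprn_ge0// mod_ge0.
  - by rewrite invr_ge0 mulr_ge0// mod_ge0.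
  - by apply: lerXn2r => //; rewrite nnegrE ?mod_ge0// ltW.
  - rewrite lef_pV2 ?posrE ?mulr_gt0//; [|exact: lt_le_trans h2|exact: lt_le_trans h3].
    by apply: ler_pM => //; exact: ltW.
apply/ler_addgt0Pl => e e0.
have e4 : 0 < e / 4 by lra.
have eb : 0 < e / 4 / (2 * b) by rewrite !divr_gt0// mulr_gt0.
have [K1 hK1] := theta_uniform `|Im z| e4.
have [K2 hK2] := tbound_tail (X_ge0 `|Im z|) Q_ge0 Q_lt1 eb.
pose K := maxn K1 K2.
have hS : mod_ (theta_sum z K - theta tau z) <= e / 4 by apply: hK1 => //; exact: leq_maxl.
have t0 j : 0 <= tbound (X `|Im z|) Q j := tbound_ge0 j (X_ge0 _) Q_ge0.
have tail i m : (K <= i)%N -> \sum_(i <= j < m) tbound (X `|Im z|) Q j <= e / 4 / (2 * b).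
  move=> Ki; have K2i : (K2 <= i)%N by apply: leq_trans Ki; exact: leq_maxr.
  have [im|mi] := leqP i m; last by rewrite big_geq; [exact: ltW|exact: ltnW].
  apply: le_trans (hK2 m); rewrite [leRHS](big_cat_nat _ im)//= lerDr.
  exact: sumr_ge0.
pose H N := \sum_(k < K) (gauss_ratio N k * term z k%:Z + gauss_ratio N k.+1 * term z (- k.+1%:Z)).
have cH : H @ \oo --> theta_sum z K.
  have -> : theta_sum z K = \sum_(k < K) (1 * term z k%:Z + 1 * term z (- k.+1%:Z)).
    by apply: eq_bigr => k _; rewrite !mul1r.
  apply: ccvg_sum => k; apply: ccvgD; apply: ccvgM; try exact: cvg_cst.
    exact: gauss_ratio_cvg.
  exact: gauss_ratio_cvg.
have [M _ hM] := proj1 (cvgCP _ _) cH _ e4.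
pose N := (maxn K M).+1.
have KN : (K <= N)%N by rewrite leqW// leq_maxl.
have MN : (M <= N)%N by rewrite leqW// leq_maxr.
have hH : mod_ (H N - theta_sum z K) <= e / 4 by apply/ltW/hM.
have split : kap N * P N = H N + (\sum_(K <= k < N.+1) gauss_ratio N k * term z k%:Z +
    \sum_(K <= k < N) gauss_ratio N k.+1 * term z (- k.+1%:Z)).
  rewrite expand /H big_split /= -!(big_mkord xpredT (fun k => gauss_ratio N k * term z k%:Z)).
  rewrite -!(big_mkord xpredT (fun k => gauss_ratio N k.+1 * term z (- k.+1%:Z))).
  by rewrite (big_cat_nat _ (leqW KN))//= (big_cat_nat _ KN)//=; ring.
have r1 : mod_ (\sum_(K <= k < N.+1) gauss_ratio N k * term z k%:Z) <= e / 4 / 2.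
  apply: le_trans (mod_sum _ _ _) _.
  have -> : e / 4 / 2 = b * (e / 4 / (2 * b)) by field; rewrite gt_eqF.
  apply: le_trans (ler_wpM2l (ltW b0) (tail K N.+1 (leqnn _))).
  rewrite mulr_sumr; apply: ler_sum => k _; rewrite modM.
  by apply: ler_pM; rewrite ?mod_ge0//; exact: term_pos_le.
have r2 : mod_ (\sum_(K <= k < N) gauss_ratio N k.+1 * term z (- k.+1%:Z)) <= e / 4 / 2.
  apply: le_trans (mod_sum _ _ _) _.
  have -> : e / 4 / 2 = b * (e / 4 / (2 * b)) by field; rewrite gt_eqF.
  apply: le_trans (ler_wpM2l (ltW b0) (tail K.+1 N.+1 (leqnSn _))).
  rewrite big_add1 /= mulr_sumr; apply: ler_sum => k _; rewrite modM.
  by apply: ler_pM; rewrite ?mod_ge0//; exact: term_neg_le.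
apply: le_trans (lower (maxn K M)) _; rewrite -/N split.
set S1 := \sum_(K <= k < N.+1) _ in r1 *; set S2 := \sum_(K <= k < N) _ in r2 *.
have -> : H N + (S1 + S2) = (H N - theta_sum z K) + (theta_sum z K - theta tau z) +
   (S1 + S2) + theta tau z by ring.
apply: le_trans (modD _ _) _; apply: lerD => //.
apply: le_trans (modD _ _) _.
apply: le_trans (lerD (modD _ _) (modD _ _)) _.
lra.
Qed.

Lemma rc_int (p : int) : rc p%:~R = p%:~R :> C.
Proof.
by case: p => n; rewrite ?NegzE ?rmorphN ?rcN /= -?pmulrn rcn.
Qed.

Lemma e2ipi_eq1 (z : C) : e2ipi z = 1 -> exists p : int, z = p%:~R.
Proof.
move=> e1; have p0 := pi_gt0 R.
have im0 : Im z = 0.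
  have : mod_ (e2ipi z) = expR 0 by rewrite e1 mod1 expR0.
  rewrite mod_e2ipi => /expR_inj/eqP; rewrite mulf_eq0 oppr_eq0 mulrn_eq0 /= gt_eqF//=.
  by move/eqP.
pose p := Num.floor (Re z); pose y := Re z - p%:~R.
have := floor_itv (Re z); rewrite -/p intrD => /andP[f1 f2].
have y0 : 0 <= y by rewrite /y; lra.
have y1 : y < 1 by rewrite /y; lra.
have zE : z = rc y + p%:~R.
  by rewrite -rc_int -rcD /y subrK; case: (z) im0 => a b /= ->.
exists p; rewrite {1}zE.
suff -> : y = 0 by rewrite rc0 add0r.
apply/eqP; rewrite eq_le y0 andbT leNgt; apply/negP => y_gt0.
have : e2ipi (rc y) = 1 by rewrite -e1 zE e2ipiD e2ipi_int mulr1.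
rewrite e2ipiE => /(congr1 Re);
  rewrite /cexp /= !(mul0r, mulr0, subr0, add0r, addr0, oppr0, expR0, mul1r).
have sp : 0 < sin (pi * y).
  by apply: sin_gt0_pi; rewrite mulr_gt0//= gtr_pMr.
have -> : y * (pi *+ 2) = pi * y + pi * y by rewrite mulr2n; ring.
rewrite cosD => h; have := cos2Dsin2 (pi * y); rewrite !expr2; nra.
Qed.

Notation Gamma := (lattice tau).

Lemma latticeD a b : Gamma a -> Gamma b -> Gamma (a + b).
Proof.
by move=> [p [r ->]] [p' [r' ->]]; exists (p + p'), (r + r'); rewrite !intrD; ring.
Qed.
Lemma latticeN a : Gamma a -> Gamma (- a).
Proof.
by move=> [p [r ->]]; exists (- p), (- r); rewrite !rmorphN /=; ring.
Qed.
Lemma latticeB a b : Gamma a -> Gamma b -> Gamma (a - b).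
Proof. by move=> ga gb; exact: latticeD (latticeN gb). Qed.

(** Quasi-periodicity with respect to the lattice thus only has to be established for
    [1] and [tau]. *)
Lemma lattice_ind (P : C -> Prop) : P 1 -> P tau -> P 0 ->
  (forall a b, P a -> P b -> P (a + b)) -> (forall a, P a -> P (- a)) ->
  forall a, Gamma a -> P a.
Proof.
move=> P1 Pt P0 PD PN a [p [r ->]].
have Pn b n : P b -> P (n%:R * b).
  move=> Pb; elim: n => [|n ih]; first by rewrite mul0r.
  by rewrite -[n.+1]add1n natrD mulrDl mul1r; exact: PD.
have Pi b (k : int) : P b -> P (k%:~R * b).
  move=> Pb; case: k => n; first exact: Pn.
  by rewrite NegzE rmorphN mulNr; apply: PN; exact: Pn.
by apply: PD; [rewrite -[p%:~R]mulr1|]; exact: Pi.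
Qed.

Lemma entire_shift (f : C -> C) (a : C) : entire f -> entire (fun u => f (u + a)).
Proof.
move=> ef; have := entire_affine ef (affine_lin 1 a).
by have -> : (fun z => f (1 * z + a)) = (fun u => f (u + a)) by apply/funext => z; rewrite mul1r.
Qed.

Lemma theta_translate (a : C) : Gamma a ->
  exists E : C -> C, [/\ entire E, forall u, E u != 0 & forall u, theta tau (u + a) =
    E u * theta tau u].
Proof.
move: a; apply: lattice_ind.
- exists (fun=> 1); split; [exact: entire_cst|by move=> u; exact: oner_neq0|].
  by move=> u; rewrite thetaD1 mul1r.
- exists (fun u => - e2ipi (- u)); split=> [|u|u]; last exact: thetaDtau.
    have := entireN (entire_e2ipi (-1) 0).
    by have -> : (fun z : C => - e2ipi (-1 * z + 0)) = (fun u : C => - e2ipi (- u))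
      by apply/funext => z; rewrite mulN1r addr0.
  by rewrite oppr_eq0 e2ipi_neq0.
- exists (fun=> 1); split; [exact: entire_cst|by move=> u; exact: oner_neq0|].
  by move=> u; rewrite addr0 mul1r.
- move=> a b [E [eE E0 hE]] [F [eF F0 hF]].
  exists (fun u => E (u + b) * F u); split=> [|u|u].
  + exact: entireM (entire_shift b eE) eF.
  + by rewrite mulf_neq0.
  + by rewrite addrA addrAC hE hF mulrA.
- move=> a [E [eE E0 hE]].
  exists (fun u => (E (u - a))^-1); split=> [|u|u].
  + exact: (entireV (entire_shift (- a) eE) (fun u => E0 (u - a))).
  + by rewrite invr_eq0.
  + by have := hE (u - a); rewrite subrK => ->; rewrite mulrA mulVf ?mul1r.
Qed.

Lemma strip_translate (z : C) : exists2 a, Gamma a & `|Im (z + a)| <= Im tau / 2.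
Proof.
pose p := Num.floor (Im z / Im tau + 2^-1).
exists (- p%:~R * tau); first by exists 0, (- p); rewrite add0r rmorphN.
have := floor_itv (Im z / Im tau + 2^-1); rewrite -/p intrD => /andP[f1 f2].
have -> : Im (z + - p%:~R * tau) = Im z - p%:~R * Im tau.
  by rewrite -rc_int -rcN ImD ImM /= mul0r addr0 mulNr.
have -> : Im z - p%:~R * Im tau = (Im z / Im tau - p%:~R) * Im tau.
  by field; rewrite gt_eqF.
rewrite normrM [`|Im tau|]gtr0_norm// mulrC ler_pM2l// ler_norml; apply/andP; split; lra.
Qed.

Lemma theta_lattice (u : C) : Gamma u -> theta tau u = 0.
Proof.
move=> /theta_translate[E [_ _ hE]]; by rewrite -[u]add0r hE theta0 mulr0.
Qed.

(** Translated into the strip of [theta_lower], a zero [u] satisfies [e(u) = 1]. *)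
Lemma theta_eq0 (u : C) : theta tau u = 0 -> Gamma u.
Proof.
move=> u0; have [a ga sa] := strip_translate u.
have [E [_ _ hE]] := theta_translate ga; have [d d0 hd] := theta_lower.
have := hd _ sa; rewrite hE u0 mulr0 mod0 pmulr_rle0// => h.
have /e2ipi_eq1[p pE] : e2ipi (u + a) = 1.
  by apply/eqP; rewrite eq_sym -subr_eq0 -mod_eq0 eq_le h mod_ge0.
rewrite -(addrK a u) pE; apply: latticeB => //.
by exists p, 0; rewrite mul0r addr0.
Qed.

(** Simplicity of the zeros: by [theta_lower], [theta u] is bounded below by a
    multiple of [1 - e(u)], hence of [u], near [0], so that the quotient [theta u /
    u] cannot vanish there. *)
Lemma theta_factor (a : C) : Gamma a ->
  exists k : C -> C, [/\ entire k, k a != 0 & forall u, theta tau u = (u - a) * k u].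
Proof.
suff [k [ek k0 hk]] : exists k : C -> C, [/\ entire k, k 0 != 0 & forall u, theta tau u = u * k u].
  move=> ga; have [E [eE E0 hE]] := theta_translate ga.
  exists (fun u => E (u - a) * k (u - a)); split=> [|//|u].
  - by apply: entireM; exact: entire_shift.
  - by rewrite subrr mulf_neq0.
  - by rewrite -{1}(subrK a u) hE hk; ring.
have lin (k : C) (z : C) : k *: 1 + z = k + z by rewrite /GRing.scale /= mulr1.
have aid : affine (fun u : C => u).
  by split; [exact: cont_id|exists (fun u => u) => k z v].
have [k ek hk] := @hadamard R C (theta tau) (fun u => u) 1 0 entire_theta aid lin
   (fun u u0 => etrans (congr1 _ u0) theta0).
exists k; split=> // [|u]; last by rewrite hk subr0.
apply/negP => /eqP k0.
have [d d0 hd] := theta_lower.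
have [ck _] := ek; have c1 := proj1 (@cvgCP R _ _ (nbhs_filter (0 : C)) _ _) (ck 0) _
  (mulr_gt0 d0 (pi_gt0 R)).
have c2 : \forall u \near (0 : C), `|Im u| <= Im tau / 2.
  have h := proj1 (@cvgCP R _ _ (nbhs_filter (0 : C)) _ _) (@cvg_id _ (nbhs (0 : C))) (Im tau / 2).
  have {}h := h (divr_gt0 tau_gt0 (ltr0Sn _ 1)); apply: filterS h => u; rewrite subr0 => /ltW.
  by apply: le_trans; exact: Im_le_mod.
have c3 : \forall u \near (0 : C), pi * mod_ u <= mod_ (1 - e2ipi u).
  have cm : continuous (fun u : C => u * Complex 0 (pi *+ 2)).
    by apply: contM; [exact: cont_id|exact: cont_cst].
  have c4 : u * Complex 0 (pi *+ 2) @[u --> (0 : C)] --> (0 * Complex 0 (pi *+ 2) : C) by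
    exact: (cm 0).
  rewrite mul0r in c4.
  have h2 : 0 < 2^-1 :> R by rewrite invr_gt0.
  have c5 : \forall u \near (0 : C),
    mod_ (cexp (u * Complex 0 (pi *+ 2)) - 1 - u * Complex 0 (pi *+ 2)) <=
      2^-1 * mod_ (u * Complex 0 (pi *+ 2)) by exact: (c4 _ (cexp_near0 h2)).
  apply: filterS c5 => u; rewrite /= -e2ipiE.
  have m2 : mod_ (Complex 0 (pi *+ 2) : C) = pi *+ 2.
    by rewrite /mod_ normc_def /= expr0n /= add0r sqrtr_sqr ger0_norm// mulrn_wge0// pi_ge0.
  rewrite modM m2 => h.
  have := mod_dist_ge (u * Complex 0 (pi *+ 2)) (- (e2ipi u - 1 - u * Complex 0 (pi *+ 2))).
  rewrite modN modM m2 opprK.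
  have -> : u * Complex 0 (pi *+ 2) + (e2ipi u - 1 - u * Complex 0 (pi *+ 2)) = - (1 - e2ipi u)
    by ring.
  rewrite modN mulr2n in h *; lra.
have [r /= r0 hr] : nbhs (0 : C) [set u | [/\ mod_ (k u - k 0) < d * pi,
    `|Im u| <= Im tau / 2 & pi * mod_ u <= mod_ (1 - e2ipi u)]].
  by near=> u => /=; split; near: u.
have [r' r'0 rE] := gt0_rcP r0.
have u0 : mod_ (rc (r' / 2)) = r' / 2 by rewrite mod_rc ger0_norm//; lra.
have /hr[h1 h2 h3] : ball_ [eta Num.norm] (0 : C) r (rc (r' / 2)).
  by rewrite /= sub0r normrN modE u0 rE ltc_rc; lra.
rewrite k0 subr0 in h1.
have := hd _ h2; rewrite hk subr0 modM u0.
rewrite u0 in h3; have p0 := pi_gt0 R; nra.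
Unshelve. all: end_near. Qed.

End Theta.

(** * Odd products over pairs and the sign of a permutation *)

Section OddProducts.
Variable K : comNzRingType.

Definition pair_sort m (p : 'I_m * 'I_m) : 'I_m * 'I_m :=
  if (p.1 < p.2)%N then p else (p.2, p.1).

(** A permutation of the indices permutes the pairs and reverses the inverted ones. *)
Lemma odd_prod_perm m (s : 'S_m) (G : 'I_m -> 'I_m -> K) :
  (forall i j, G i j = - G j i) ->
  \prod_(p : 'I_m * 'I_m | (p.1 < p.2)%N) G (s p.1) (s p.2) =
  (\prod_(p : 'I_m * 'I_m | (p.1 < p.2)%N) (if (s p.1 < s p.2)%N then 1 else -1)) *
  \prod_(p : 'I_m * 'I_m | (p.1 < p.2)%N) G p.1 p.2.
Proof.
move=> Godd.
pose h (p : 'I_m * 'I_m) := pair_sort (s p.1, s p.2).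
pose h' (p : 'I_m * 'I_m) := pair_sort ((s^-1)%g p.1, (s^-1)%g p.2).
have hP (p : 'I_m * 'I_m) : (p.1 < p.2)%N -> ((h p).1 < (h p).2)%N /\ h' (h p) = p.
  move=> lt; have ne : p.1 != p.2 by rewrite -val_eqE /= neq_ltn lt.
  rewrite /h /pair_sort /=; case: ifP => sp; rewrite /h' /pair_sort /= ?permK ?lt.
    by rewrite -surjective_pairing.
  rewrite [(p.2 < p.1)%N]ltnNge (ltnW lt) /= -surjective_pairing; split=> //.
  rewrite ltn_neqAle leqNgt sp andbT; apply: contra ne => /eqP e.
  by apply/eqP/(@perm_inj _ s)/esym/val_inj.
have hP' (p : 'I_m * 'I_m) : (p.1 < p.2)%N -> ((h' p).1 < (h' p).2)%N /\ h (h' p) = p.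
  move=> lt; have ne : p.1 != p.2 by rewrite -val_eqE /= neq_ltn lt.
  rewrite /h' /pair_sort /=; case: ifP => sp; rewrite /h /pair_sort /= ?permKV ?lt.
    by rewrite -surjective_pairing.
  rewrite [(p.2 < p.1)%N]ltnNge (ltnW lt) /= -surjective_pairing; split=> //.
  rewrite ltn_neqAle leqNgt sp andbT; apply: contra ne => /eqP e.
  by apply/eqP/(@perm_inj _ (s^-1)%g)/esym/val_inj.
rewrite [X in _ = _ * X](reindex_onto h h') /=; last by move=> p /hP'[].
have -> : \prod_(p | ((h p).1 < (h p).2)%N && (h' (h p) == p)) G (h p).1 (h p).2 =
    \prod_(p : 'I_m * 'I_m | (p.1 < p.2)%N) G (h p).1 (h p).2.
  apply: eq_bigl => p; apply/andP/idP => [[lt /eqP e]|/hP[-> ->]]; last by rewrite eqxx.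
  by have [] := hP' (h p) lt; rewrite e.
rewrite -big_split /=; apply: eq_bigr => p _.
by rewrite /h /pair_sort /=; case: ifP => _; rewrite ?mul1r// mulN1r /= -Godd.
Qed.

End OddProducts.

(** The number of inversions has the parity of the permutation: compare both with
    the Vandermonde determinant. *)
Lemma sign_inversions (K : comNzRingType) m (s : 'S_m) :
  \prod_(p : 'I_m * 'I_m | (p.1 < p.2)%N) (if (s p.1 < s p.2)%N then 1 else -1) =
  (-1) ^+ s :> K.
Proof.
pose F (L : comNzRingType) : L :=
  \prod_(p : 'I_m * 'I_m | (p.1 < p.2)%N) (if (s p.1 < s p.2)%N then 1 else -1).
suff h : F int = (-1) ^+ s.
  have := congr1 (fun k : int => k%:~R : K) h; rewrite rmorphXn rmorphN1 => <-.
  by rewrite rmorph_prod; apply: eq_bigr => p _; case: ifP; rewrite ?rmorph1 ?rmorphN1.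
pose a : 'rV[int]_m := \row_j (j : nat)%:Z.
pose D (b : 'rV[int]_m) : int := \prod_(p : 'I_m * 'I_m | (p.1 < p.2)%N) (b 0 p.2 - b 0 p.1).
have detV b : \det (Vandermonde m b) = D b.
  by rewrite det_Vandermonde /D pair_big_dep.
have D0 : D a != 0.
  apply/prodf_neq0 => p lt; rewrite !mxE subr_eq0; apply: contraTneq lt => -[->].
  by rewrite ltnn.
have e1 : D (col_perm s a) = F int * D a.
  rewrite /D; have := @odd_prod_perm int m s (fun i j => a 0 j - a 0 i)
    (fun i j => esym (opprB _ _)).
  by move=> <-; apply: eq_bigr => p _; rewrite !mxE.
have e2 : D (col_perm s a) = (-1) ^+ s * D a.
  rewrite -!detV; have -> : Vandermonde m (col_perm s a) = col_perm s (Vandermonde m a).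
    by apply/matrixP => i j; rewrite !mxE.
  by rewrite col_permE det_mulmx det_perm mulrC odd_permV.
by apply: (mulIf D0); rewrite -e1 e2.
Qed.

(** * Generic points and division along the divisors *)

Section Divisors.
Variable R : realType.
Local Notation C := (Cplx R).

Lemma affine_row m a (g : 'I_a -> 'I_m) (b : C) :
  affine (fun z : 'rV[C]_m => (\row_i (z 0 (g i) - b)) : 'rV[C]_a).
Proof.
split.
  apply: cont_row => j; have -> : (fun z : 'rV[C]_m => (\row_i (z 0 (g i) - b)) 0 j) =
    (fun z => z 0 (g j) - b).
    by apply/funext => z; rewrite mxE.
  exact: (contB (@cont_coord R m (g j)) (@cont_cst R _ b)).
exists (fun v : 'rV[C]_m => \row_i v 0 (g i)) => k z v; apply/rowP => i; rewrite !mxE; ring.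
Qed.

Lemma affine_row0 m a (g : 'I_a -> 'I_m) :
  affine (fun z : 'rV[C]_m => (\row_i z 0 (g i)) : 'rV[C]_a).
Proof.
have := affine_row g 0; congr affine; apply/funext => z; apply/rowP => i.
by rewrite !mxE subr0.
Qed.

Lemma affine_diff m (i j : 'I_m) (a b : C) : affine (fun z : 'rV[C]_m => a * (z 0 i - z 0 j) + b).
Proof.
split.
  apply: contD; last exact: cont_cst.
  apply: contM; first exact: cont_cst.
  exact: (contB (@cont_coord R m i) (@cont_coord R m j)).
by exists (fun v : 'rV[C]_m => a * (v 0 i - v 0 j)) => k z v; rewrite !mxE /GRing.scale /=; ring.
Qed.

Lemma affine_diff1 m (i j : 'I_m) : affine (fun z : 'rV[C]_m => z 0 i - z 0 j).
Proof. by have := affine_diff i j 1 0; congr affine; apply/funext => z; rewrite mul1r addr0. Qed.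

Lemma affine_col_perm m (s : 'S_m) : affine (fun z : 'rV[C]_m => col_perm s z).
Proof.
have := affine_row0 s; congr affine; apply/funext => z; apply/rowP => i.
by rewrite !mxE.
Qed.

Lemma entire_local (V : normedModType C) (Q : V -> C) :
  (forall p, exists g, [/\ {near p, g =1 Q}, {for p, continuous g} & forall v, derivable g p v]) ->
  entire Q.
Proof.
move=> h; split=> [p|p v]; have [g [e cg dg]] := h p.
  have eQ : g p = Q p by exact: nbhs_singleton e.
  rewrite /continuous_at -eQ; apply: cvg_trans cg.
  exact: near_eq_cvg.
exact: (near_eq_derivable e (dg v)).
Qed.

Variable tau : C.
Hypothesis tau_gt0 : 0 < complex.Im tau.
Local Notation Gamma := (lattice tau).

(** A lattice point [p + q tau] has modulus at least [|q| Im tau], and [|p|] if [q =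
    0]. *)
Lemma lattice_gap : exists2 r : R, 0 < r & forall a, Gamma a -> a != 0 -> r <= mod_ a.
Proof.
exists (Num.min 1 (complex.Im tau)); first by rewrite lt_min ltr01.
move=> a [p [k ->]]; rewrite -!rc_int ge_min => a0.
have [k0|k0] := eqVneq k 0.
  apply/orP; left; move: a0; rewrite k0 mulr0z rc0 mul0r addr0 mod_rc => p0.
  have {}p0 : p != 0 by apply: contraNneq p0 => ->; rewrite mulr0z rc0.
  by rewrite -intr_norm ler1z -gtz0_ge1 normr_gt0.
apply/orP; right; apply: le_trans (Im_le_mod _).
rewrite ImD ImM /= mul0r addr0 add0r normrM [`|complex.Im tau|]gtr0_norm//.
apply: ler_peMl; first exact: ltW.
by rewrite -intr_norm ler1z -gtz0_ge1 normr_gt0.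
Qed.

Lemma lattice_discrete (u0 : C) : exists2 r : R, 0 < r &
  forall u, mod_ (u - u0) < r -> u != u0 -> ~ Gamma u.
Proof.
have [r r0 hr] := lattice_gap.
have [[u1 [g1 ne1 d1]]|no] := pselect (exists u1, [/\ Gamma u1, u1 != u0 & mod_ (u1 - u0) < r / 2]).
  exists (mod_ (u1 - u0)); first by rewrite mod_gt0 subr_eq0.
  move=> u d ne g; have uu : u != u1.
    by apply: contraTneq d => ->; rewrite ltxx.
  have := hr (u - u1) (latticeB g g1); rewrite subr_eq0 => /(_ uu).
  have -> : u - u1 = (u - u0) - (u1 - u0) by ring.
  have := modB (u - u0) (u1 - u0); lra.
exists (r / 2); first lra.
by move=> u d ne g; apply: no; exists u.
Qed.

Lemma diff_off_lattice m (z w : 'rV[C]_m) (i j : 'I_m) : w 0 i != w 0 j ->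
  \forall t \near (0 : C)^', ~ Gamma ((t *: w + z) 0 i - (t *: w + z) 0 j).
Proof.
move=> wij; pose d := w 0 i - w 0 j; have d0 : d != 0 by rewrite subr_eq0.
have [r r0 hr] := lattice_discrete (z 0 i - z 0 j).
have rd : 0 < r / mod_ d by rewrite divr_gt0// mod_gt0.
exists (rc (r / mod_ d)); first by rewrite /= ltc_rc.
move=> t /=; rewrite sub0r normrN modE ltc_rc => tr t0.
have e : (t *: w + z) 0 i - (t *: w + z) 0 j - (z 0 i - z 0 j) = t * d.
  by rewrite !mxE /d; ring.
apply: hr; first by rewrite e modM -ltr_pdivlMr// mod_gt0.
by rewrite -subr_eq0 e mulf_neq0.
Qed.

(** A direction separating all the coordinates: small multiples of it move any point
    to a generic one. *)
Definition ramp m : 'rV[C]_m := \row_i (i : nat)%:R.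

Lemma generic_near m (z : 'rV[C]_m) : \forall t \near (0 : C)^', generic tau (t *: ramp m + z).
Proof.
have h : \forall t \near (0 : C)^', forall p : 'I_m * 'I_m, p.1 != p.2 ->
    ~ Gamma ((t *: ramp m + z) 0 p.1 - (t *: ramp m + z) 0 p.2).
  apply: filter_forall => p; have [e|ne] := eqVneq p.1 p.2.
    by apply: nearW.
  have := @diff_off_lattice m z (ramp m) p.1 p.2; rewrite !mxE eqr_nat => /(_ ne).
  by apply: filterS => t ht _.
by apply: filterS h => t ht i j ij; exact: (ht (i, j)).
Qed.

Lemma cont_aline (V : normedModType C) (w z : V) : continuous (fun t : C => t *: w + z).
Proof.
apply: cont_add; last exact: cont_vcst.
by apply: cont_scale; [exact: cont_id|exact: cont_vcst].
Qed.

Lemma cvg_aline (V : normedModType C) (w z : V) : t *: w + z @[t --> (0 : C)^'] --> z.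
Proof.
have c1 : (fun t : C => t *: w + z) @ (0 : C) --> 0 *: w + z by exact: cont_aline.
by rewrite scale0r add0r in c1; move=> A /c1 nA; exact: nbhs_dnbhs.
Qed.

Lemma cvg_line (V : normedModType C) (f : V -> C) (z w : V) : {for z, continuous f} ->
  f (t *: w + z) @[t --> (0 : C)^'] --> f z.
Proof.
by move=> cf; exact: (cvg_comp _ _ (@cvg_aline V w z) cf).
Qed.

(** Generic points are dense. *)
Lemma eq_generic m (f g : 'rV[C]_m -> C) : continuous f -> continuous g ->
  (forall z, generic tau z -> f z = g z) -> forall z, f z = g z.
Proof.
move=> cf cg fg z.
apply: (@cvg_unique _ (@norm_hausdorff _ C) ((fun t : C => f (t *: ramp m + z)) @ (0 : C)^') _).
  exact: cvg_line (cf z).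
have := @cvg_line _ g z (ramp m) (cg z); apply: cvg_trans; apply: near_eq_cvg.
by have := generic_near z; apply: filterS => t gt; rewrite fg.
Qed.

Lemma generic_proper m (z : 'rV[C]_m) : ProperFilter (within (@generic R tau m) (nbhs z)).
Proof.
split; last exact: within_filter.
rewrite /within /= => h.
have c := @cvg_aline _ (ramp m) z.
have h1 := c _ h; have h2 := generic_near z.
have : \forall t \near (0 : C)^', False by near=> t;
  have g : generic tau (t *: ramp m + z) by [near: t|]; move: g; near: t.
by move=> /filter_ex[].
Unshelve. all: end_near. Qed.

(** A direction [w] with distinct [i]-th and [j]-th coordinates is transverse to the
    divisor. *)
Lemma eq_offdiv m (i j : 'I_m) (f : 'rV[C]_m -> C) (w : 'rV[C]_m) (z : 'rV[C]_m) :
  continuous f -> w 0 i != w 0 j ->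
  (forall t, ~ Gamma ((t *: w + z) 0 i - (t *: w + z) 0 j) -> f (t *: w + z) = 0) -> f z = 0.
Proof.
move=> cf wij h.
apply: (@cvg_unique _ (@norm_hausdorff _ C) ((fun t : C => f (t *: w + z)) @ (0 : C)^') _).
  exact: cvg_line (cf z).
have c0 : (fun _ : C => 0 : C) @ (0 : C)^' --> (0 : C) by exact: cvg_cst.
apply: cvg_trans c0; apply: near_eq_cvg.
by have := @diff_off_lattice m z w i j wij; apply: filterS => t gt; rewrite h.
Qed.

(** Unlike [theta], this variant is odd, which makes [vdm] below antisymmetric. *)
Definition theta1 (u : C) : C := e2ipi (- 2^-1 * u) * theta tau u.

Lemma entire_theta1 : entire theta1.
Proof.
have := entire_e2ipi (- 2^-1 : C) 0; rewrite (_ : (fun z => _) = (fun z : C => e2ipi (- 2^-1 * z))).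
  by move=> h; exact: entireM h (entire_theta tau_gt0).
by apply/funext => z; rewrite addr0.
Qed.

Lemma theta1N u : theta1 (- u) = - theta1 u.
Proof.
rewrite /theta1 thetaN//.
have -> : e2ipi (- 2^-1 * - u) = e2ipi (- 2^-1 * u) * e2ipi u.
  by rewrite -e2ipiD; congr e2ipi; field.
by rewrite e2ipiN; field; exact: e2ipi_neq0.
Qed.

Lemma theta1_eq0 u : theta1 u = 0 <-> Gamma u.
Proof.
split=> [/eqP|g]; last by rewrite /theta1 theta_lattice// mulr0.
rewrite mulf_eq0 (negPf (e2ipi_neq0 _)) /= => /eqP; exact: theta_eq0.
Qed.

Lemma theta1D1 u : theta1 (u + 1) = - theta1 u.
Proof.
by rewrite /theta1 thetaD1// mulrDr mulr1 e2ipiD e2ipiN e2ipi_half invrN1 mulrN1 mulNr.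
Qed.

Lemma theta1Dtau u : theta1 (u + tau) = - e2ipi (- u - 2^-1 * tau) * theta1 u.
Proof.
by rewrite /theta1 thetaDtau// mulrDr e2ipiD -[- u - _]/(- u + - _) -mulNr e2ipiD; ring.
Qed.

Lemma theta1_factor (a : C) : Gamma a ->
  exists k : C -> C, [/\ entire k, k a != 0 & forall u, theta1 u = (u - a) * k u].
Proof.
move=> /theta_factor-/(_ tau_gt0)[k [ek k0 hk]].
have := entire_e2ipi (- 2^-1 : C) 0; rewrite (_ : (fun z => _) = (fun z : C => e2ipi (- 2^-1 * z))).
  move=> ee; exists (fun u => e2ipi (- 2^-1 * u) * k u); split=> [||u].
  - exact: entireM ee ek.
  - by rewrite mulf_neq0 ?e2ipi_neq0.
  - by rewrite /theta1 hk; ring.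
by apply/funext => z; rewrite addr0.
Qed.

Section Division.
Variable m : nat.
Local Notation V := 'rV[C]_m.

(** Near a point of the divisor both [h] and [theta1 (z_i - z_j)] are multiples of the
    same linear form, by Hadamard's lemma. *)
Lemma divide_pair (h : V -> C) (i j : 'I_m) : i != j -> entire h ->
  (forall z : V, Gamma (z 0 i - z 0 j) -> h z = 0) ->
  exists2 Q, entire Q & forall z : V, h z = theta1 (z 0 i - z 0 j) * Q z.
Proof.
move=> ij eh h0; have [ch dh] := eh; pose u (z : V) := z 0 i - z 0 j.
have au : affine u by exact: affine_diff1.
have cu : continuous u by case: au.
have uv (k : C) (z : V) : u (k *: delta_mx 0 i + z) = k + u z.
  by rewrite /u !mxE !eqxx [j == i]eq_sym (negPf ij) /=; ring.
have : forall a, exists p : (V -> C) * (C -> C), Gamma a ->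
    [/\ entire p.1, (forall z, h z = (u z - a) * p.1 z), entire p.2, p.2 a != 0 &
        forall w, theta1 w = (w - a) * p.2 w].
  move=> a; have [ga|na] := pselect (Gamma a); last by exists (fun=> 0, fun=> 0).
  have [k [ek k0 hk]] := theta1_factor ga.
  have [q eq hq] := @hadamard R V h u (delta_mx 0 i) a eh au uv
    (fun z (e : u z = a) => h0 z (eq_ind_r Gamma ga e)).
  by exists (q, k).
move=> /choice[F hF].
pose Q z := if theta1 (u z) == 0 then (F (u z)).1 z / (F (u z)).2 (u z) else h z / theta1 (u z).
have QE z : h z = theta1 (u z) * Q z.
  rewrite /Q; case: eqP => [e|/eqP ne]; last by rewrite mulrC divfK.
  by rewrite e mul0r; apply: h0; exact/theta1_eq0.
exists Q; last exact: QE.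
apply: entire_local => p.
have [t0|tn0] := eqVneq (theta1 (u p)) 0.
  have ga : Gamma (u p) by exact/theta1_eq0.
  have [eq hq ek k0 hk] := hF (u p) ga.
  have ekn : entire (fun z => (F (u p)).2 (u z)) by exact: (entire_affine ek au).
  exists (fun z => (F (u p)).1 z * ((F (u p)).2 (u z))^-1); split.
  - have [r r0 hr] := lattice_discrete (u p).
    have n1 : \forall z \near p, mod_ (u z - u p) < r.
      exact: (proj1 (@cvgCP R _ _ (nbhs_filter p) _ _) (cu p) _ r0).
    have n2 : \forall z \near p, (F (u p)).2 (u z) != 0.
      have k1 : 0 < mod_ ((F (u p)).2 (u p)) by rewrite mod_gt0.
      have := proj1 (@cvgCP R _ _ (nbhs_filter p) _ _) (ekn.1 p) _ k1.
      apply: filterS => z; apply: contraTneq => ->.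
      by rewrite sub0r modN ltxx.
    near=> z; rewrite /Q.
    have b1 : mod_ (u z - u p) < r by near: z.
    have b2 : (F (u p)).2 (u z) != 0 by near: z.
    have [uz|uz] := eqVneq (u z) (u p); first by rewrite uz t0 eqxx.
    have nz : theta1 (u z) != 0.
      by apply/eqP => /theta1_eq0; exact: hr.
    rewrite (negPf nz) hq hk; rewrite hk in nz.
    move: nz; rewrite mulf_eq0 negb_or => /andP[n3 _].
    by field; rewrite n3 b2.
  - exact: (@ccvgM R _ _ (nbhs_filter p) _ _ _ _ (eq.1 p)
    (@ccvgV R _ _ (nbhs_filter p) _ _ k0 (ekn.1 p))).
  - move=> v; apply: (@derivableM _ _ (F (u p)).1); first exact: (eq.2 p v).
    exact: (@derivableV _ _ (fun z => (F (u p)).2 (u z)) p v k0 (ekn.2 p v)).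
have et : entire (fun z => theta1 (u z)) by exact: (entire_affine entire_theta1 au).
exists (fun z => h z * (theta1 (u z))^-1); split.
- have k1 : 0 < mod_ (theta1 (u p)) by rewrite mod_gt0.
  have := proj1 (@cvgCP R _ _ (nbhs_filter p) _ _) (et.1 p) _ k1.
  apply: filterS => z hz; rewrite /Q; case: eqP => // e.
  by move: hz; rewrite e sub0r modN ltxx.
- exact: (@ccvgM R _ _ (nbhs_filter p) _ _ _ _ (ch p)
  (@ccvgV R _ _ (nbhs_filter p) _ _ tn0 (et.1 p))).
- move=> v; apply: (@derivableM _ _ h); first exact: (dh p v).
  exact: (@derivableV _ _ (fun z => theta1 (u z)) p v tn0 (et.2 p v)).
Unshelve. all: end_near. Qed.

(** After a division by one factor, the quotient still vanishes on the other
    divisors: none of them is contained in the divisor of that factor, so its points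
    are limits of points where the factor does not vanish. *)
Lemma divide_pairs (l : seq ('I_m * 'I_m)) (h : V -> C) : uniq l ->
  all (fun p : 'I_m * 'I_m => p.1 < p.2)%N l -> entire h ->
  (forall p (z : V), p \in l -> Gamma (z 0 p.1 - z 0 p.2) -> h z = 0) ->
  exists2 Q, entire Q & forall z : V, h z = (\prod_(p <- l) theta1 (z 0 p.1 - z 0 p.2)) * Q z.
Proof.
elim: l h => [|p l ih] h /=.
  by move=> _ _ eh _; exists h => // z; rewrite big_nil mul1r.
move=> /andP[pl ul] /andP[plt all_l] eh h0.
have pne : p.1 != p.2 by rewrite -val_eqE /= neq_ltn plt.
have [Q1 eQ1 hQ1] := divide_pair pne eh (fun z => h0 p z (mem_head _ _)).
have [|Q eQ hQ] := ih Q1 ul all_l eQ1.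
  move=> r z rl gz; have rlt := allP all_l _ rl.
  have rp : r != p by apply: contraNneq pl => <-.
  (* a direction preserving [z_r1 - z_r2] but not [z_p1 - z_p2] *)
  have [w wp wr] : exists2 w : V, w 0 p.1 != w 0 p.2 & w 0 r.1 = w 0 r.2.
    have [e1|n1] := boolP ((p.1 == r.1) || (p.1 == r.2)); last first.
      exists (delta_mx 0 p.1).
        by rewrite !mxE !eqxx /= [p.2 == _]eq_sym (negPf pne) oner_eq0.
      rewrite !mxE eqxx /=; move: n1; rewrite negb_or => /andP[n1 n2].
      by rewrite [r.1 == _]eq_sym [r.2 == _]eq_sym (negPf n1) (negPf n2).
    exists (delta_mx 0 p.2).
      by rewrite !mxE !eqxx /= (negPf pne) eq_sym oner_eq0.
    rewrite !mxE eqxx /=.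
    have n1 : r.1 != p.2.
      apply: contraTneq rlt => e; rewrite e -leqNgt.
      move: e1; rewrite e (negPf pne) /= => /eqP <-; exact: ltnW.
    have n2 : r.2 != p.2.
      apply: contraNneq rp => e; move: e1; rewrite e (negPf pne) orbF => /eqP e1.
      by rewrite [p]surjective_pairing e1 -e -surjective_pairing.
    by rewrite (negPf n1) (negPf n2).
  apply: (@eq_offdiv m p.1 p.2 Q1 w z eQ1.1 wp) => t nt.
  have nz : theta1 ((t *: w + z) 0 p.1 - (t *: w + z) 0 p.2) != 0.
    by apply/eqP => /theta1_eq0.
  apply: (mulfI nz); rewrite -hQ1 mulr0; apply: (h0 r); first by rewrite inE rl orbT.
  by rewrite !mxE wr (_ : _ - _ = z 0 r.1 - z 0 r.2)//; ring.
by exists Q => // z; rewrite hQ1 hQ big_cons mulrA.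
Qed.

End Division.

(** The common denominator of the products: the theta analogue of Vandermonde's
    determinant. *)
Definition vdm m (z : 'rV[C]_m) : C :=
  \prod_(p : 'I_m * 'I_m | (p.1 < p.2)%N) theta1 (z 0 p.1 - z 0 p.2).

Lemma entire_pair m (f : C -> C) (i j : 'I_m) : entire f ->
  entire (fun z : 'rV[C]_m => f (z 0 i - z 0 j)).
Proof. by move=> ef; exact: (entire_affine ef (affine_diff1 i j)). Qed.

Lemma entire_vdm m : entire (@vdm m).
Proof. by apply: entire_prod => p; exact: (entire_pair _ _ entire_theta1). Qed.

Lemma vdm_col_perm m (s : 'S_m) (z : 'rV[C]_m) : vdm (col_perm s z) = (-1) ^+ s * vdm z.
Proof.
rewrite -(sign_inversions C s) /vdm.
rewrite -(@odd_prod_perm C m s (fun i j => theta1 (z 0 i - z 0 j))).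
  by apply: eq_bigr => p _; rewrite !mxE.
by move=> i j; rewrite -theta1N opprB.
Qed.

Lemma vdm_neq0 m (z : 'rV[C]_m) : generic tau z -> vdm z != 0.
Proof.
move=> gz; apply/prodf_neq0 => p lt; apply/eqP => /theta1_eq0; apply: gz.
by rewrite -val_eqE /= neq_ltn lt.
Qed.

Definition lsub a b (y : 'rV[C]_(a + b)) : 'rV[C]_a := \row_i y 0 (lshift b i).
Definition rsub a b (y : 'rV[C]_(a + b)) : 'rV[C]_b := \row_j y 0 (rshift a j).

Lemma vdm_split a b (y : 'rV[C]_(a + b)) : vdm y = vdm (lsub y) * vdm (rsub y) *
  \prod_(i < a) \prod_(j < b) theta1 (y 0 (lshift b i) - y 0 (rshift a j)).
Proof.
have E m (z : 'rV[C]_m) : vdm z = \prod_(i < m) \prod_(j < m | (i < j)%N) theta1 (z 0 i - z 0 j).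
  by rewrite /vdm pair_big_dep.
rewrite !E big_split_ord /=.
under eq_bigr => i _ do rewrite big_split_ord /=.
rewrite big_split /= -!mulrA [RHS]mulrCA [RHS]mulrC -mulrA; congr (_ * _).
  by apply: eq_bigr => i _; apply: eq_bigr => j _; rewrite !mxE.
congr (_ * _).
  apply: eq_bigr => i _; apply: eq_bigl => j.
  by rewrite (leq_trans (ltn_ord i) (leq_addr _ _)).
apply: eq_bigr => i _; rewrite big_split_ord /= big_pred0 ?mul1r.
  by apply: eq_big => j; rewrite ?ltn_add2l// !mxE.
by move=> j; apply/negbTE; rewrite -leqNgt ltnW// (leq_trans (ltn_ord j) (leq_addr _ _)).
Qed.

End Divisors.

(** * The product of two homogeneous elements *)

(** The pairs that contain [p] correspond to the other indices. *)
Lemma prod_pairs_at (K : comNzRingType) m (c : 'I_m -> K) (p : 'I_m) :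
  \prod_(q : 'I_m * 'I_m | (q.1 < q.2)%N)
    (if q.1 == p then c q.2 else if q.2 == p then c q.1 else 1) =
  \prod_(j < m | j != p) c j.
Proof.
transitivity (\prod_(i < m) \prod_(j < m | (i < j)%N)
    (if i == p then c j else if j == p then c i else 1)).
  by rewrite pair_big_dep.
rewrite (bigD1 p) //= [RHS](bigID (fun j : 'I_m => (p < j)%N)) /=; congr (_ * _).
  rewrite eqxx; apply: eq_bigl => j; rewrite andb_idl// => pj.
  by rewrite -val_eqE /= neq_ltn pj orbT.
rewrite big_mkcond [RHS]big_mkcond /=; apply: eq_bigr => i _.
have [->|ip] := eqVneq i p; first by [].
rewrite /= -leqNgt; have [pi|ip'] := leqP i p.
  have {}pi : (i < p)%N by rewrite ltn_neqAle pi andbT val_eqE ip.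
  rewrite (bigD1 p) //= eqxx big1 ?mulr1// => j /andP[_ /negPf ->]; by rewrite ?(negPf ip).
rewrite big1 // => j ij; case: eqP => // e; move: ij; rewrite e ltnNge.
by rewrite ltnW.
Qed.

Section Star.
Variables (R : realType) (n : nat) (tau c eta : Cplx R).
Local Notation C := (Cplx R).
Hypothesis tau_gt0 : 0 < complex.Im tau.
Local Notation Gamma := (lattice tau).
Local Notation theta1 := (theta1 tau).
Local Notation vdm := (vdm tau).
Local Notation F := (Fspace n tau c eta).

(** The multiplier under translations by [tau] in the space of functions of [a]
    variables. *)
Definition mult a (x : C) : C :=
  (-1) ^+ n * e2ipi (- (n%:R * x - c - (a%:R - 1) * n%:R * eta)).

(** The kernel [theta (u - n eta) / theta u] multiplied by [theta1 u]. *)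
Definition cross (u : C) : C := theta tau (u - n%:R * eta) * e2ipi (- 2^-1 * u).

Lemma Fspace_entire a f : @F a f -> entire f.
Proof. by move=> [df _ _ _]; exact: differentiable_entire. Qed.

Lemma Fspace_sym a f (s : 'S_a) z : @F a f -> f (col_perm s z) = f z.
Proof. by move=> [_ h _ _]. Qed.

(** By symmetry any variable can be moved to the first place. *)
Lemma Fspace_any a (f : 'rV[C]_a -> C) (w : C) (L : C -> C) : @F a f ->
  (forall (i : 'I_a) z, i = 0%N :> nat -> f (z + w *: delta_mx 0 i) = L (z 0 i) * f z) ->
  forall (p : 'I_a) z, f (z + w *: delta_mx 0 p) = L (z 0 p) * f z.
Proof.
move=> ff h p z; have a0 : (0 < a)%N by case: (a) p => [[]|].
pose i0 := Ordinal a0; pose s := tperm p i0.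
rewrite -(Fspace_sym s _ ff) -[f z](Fspace_sym s _ ff).
have -> : col_perm s (z + w *: delta_mx 0 p) = col_perm s z + w *: delta_mx 0 i0.
  apply/rowP => k; rewrite !mxE /=; congr (_ + _ * (_ _)%:R).
  by rewrite -[p](tpermR p i0) (inj_eq perm_inj).
by rewrite h// !mxE tpermR.
Qed.

Lemma Fspace_shift1 a f (p : 'I_a) z : @F a f -> f (z + 1 *: delta_mx 0 p) = 1 * f z.
Proof.
move=> ff; apply: (@Fspace_any a f 1 (fun=> 1) ff) => i y i0; rewrite scale1r mul1r.
by case: ff => _ _ h _; exact: h.
Qed.

Lemma Fspace_shift_tau a f (p : 'I_a) z : @F a f ->
  f (z + tau *: delta_mx 0 p) = mult a (z 0 p) * f z.
Proof.
move=> ff; apply: (@Fspace_any a f tau (mult a) ff) => i y i0.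
by case: ff => _ _ _ h; exact: h.
Qed.

Lemma entire_cross : entire cross.
Proof.
apply: entireM; first exact: (entire_shift _ (entire_theta tau_gt0)).
have := entire_e2ipi (- 2^-1 : C) 0; congr entire; apply/funext => u; by rewrite addr0.
Qed.

Section VdmShift.
Variables (w : C) (mu : C -> C).
Hypotheses (thw : forall u, theta1 (u + w) = mu u * theta1 u)
  (muN : forall u, mu (- u) * mu (u - w) = 1).

(** The multiplier of [vdm] under the translation by [w] of the variable of index
    [p]. *)
Definition shift_factor m (z : 'rV[C]_m) (p : 'I_m) : C := \prod_(j < m | j != p) mu
  (z 0 p - z 0 j).

Lemma mu_neq0 u : mu u != 0.
Proof.
have := muN (- u); rewrite opprK => e; apply/eqP => u0; move: e; rewrite u0 mul0r => /eqP.
by rewrite eq_sym oner_eq0.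
Qed.

(** The second hypothesis on [mu] expresses the compatibility of the first one with
    oddness. *)
Lemma theta1_shiftN u : theta1 (u - w) = mu (- u) * theta1 u.
Proof.
rewrite -[in RHS](subrK w u) (thw (u - w)) mulrA.
by rewrite subrK muN mul1r.
Qed.

Lemma shift_factor_neq0 m (z : 'rV[C]_m) p : shift_factor z p != 0.
Proof. by apply/prodf_neq0 => j _; exact: mu_neq0. Qed.

Lemma shift_coord m (z : 'rV[C]_m) (p i : 'I_m) :
  (z + w *: delta_mx 0 p) 0 i = if i == p then z 0 i + w else z 0 i.
Proof. by rewrite !mxE eqxx; case: eqP => _ /=; rewrite ?mulr1 ?mulr0 ?addr0. Qed.

Lemma vdm_shift m (z : 'rV[C]_m) p : vdm (z + w *: delta_mx 0 p) = shift_factor z p * vdm z.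
Proof.
rewrite /shift_factor -(prod_pairs_at (fun j => mu (z 0 p - z 0 j))) /vdm -big_split /=.
apply: eq_bigr => q lt; rewrite !shift_coord.
have [e1|n1] := eqVneq q.1 p.
  have -> : (q.2 == p) = false by apply/negP => /eqP e2; move: lt; rewrite e1 e2 ltnn.
  have -> : z 0 q.1 + w - z 0 q.2 = z 0 q.1 - z 0 q.2 + w by ring.
  by rewrite thw e1.
have [e2|n2] := eqVneq q.2 p; last by rewrite mul1r.
have -> : z 0 q.1 - (z 0 q.2 + w) = z 0 q.1 - z 0 q.2 - w by ring.
by rewrite theta1_shiftN opprB e2.
Qed.

End VdmShift.

Section Products.
Variables (a b : nat) (f : 'rV[C]_a -> C) (g : 'rV[C]_b -> C).
Hypotheses (Ff : @F a f) (Fg : @F b g).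
Local Notation m := (a + b)%N.
Local Notation V := 'rV[C]_(a + b).

Definition rsub_shift (y : V) : 'rV[C]_b := \row_j (y 0 (rshift a j) - 2 * a%:R * eta).

(** A summand of the product cleared of its denominators: [vdm] times the summand. *)
Definition cleared (y : V) : C :=
  f (lsub y) * g (rsub_shift y) *
  (\prod_(i < a) \prod_(j < b) cross (y 0 (lshift b i) - y 0 (rshift a j))) *
  (vdm (lsub y) * vdm (rsub y)).

(** The antisymmetrization of [cleared], which is the product of [vdm] and
    [star_sum]. *)
Definition numer (z : V) : C :=
  (a`! * b`!)%:R^-1 * \sum_(s : 'S_m) (-1) ^+ s * cleared (col_perm s z).

Lemma entire_cleared : entire cleared.
Proof.
have al : affine (fun y : V => lsub y) by exact: affine_row0.
have ar : affine (fun y : V => rsub y) by exact: affine_row0.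
apply: entireM; last first.
  apply: entireM; first exact: (entire_affine (entire_vdm tau_gt0 a) al).
  exact: (entire_affine (entire_vdm tau_gt0 b) ar).
apply: entireM; last first.
  by apply: entire_prod => i; apply: entire_prod => j; exact: (entire_pair _ _ entire_cross).
apply: entireM; first exact: (entire_affine (Fspace_entire Ff) al).
exact: (entire_affine (Fspace_entire Fg) (affine_row _ _)).
Qed.

Lemma entire_numer : entire numer.
Proof.
apply: entireM; first exact: entire_cst.
apply: entire_sum => s; apply: entireM; first exact: entire_cst.
have H := @entire_affine R _ _ _ _ entire_cleared (@affine_col_perm R (a + b) s).
exact: H.
Qed.

Lemma numer_col_perm (t : 'S_m) z : numer (col_perm t z) = (-1) ^+ t * numer z.
Proof.
rewrite /numer [RHS]mulrCA; apply: (f_equal (fun u => _ * u)); rewrite mulr_sumr.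
rewrite [RHS](reindex_inj (mulIg t)) /=; apply: eq_bigr => s _.
rewrite col_permM odd_permM signr_addb; move: (cleared _) => X.
have e : (-1) ^+ t * (-1) ^+ t = 1 :> C by rewrite -signr_addb addbb.
transitivity ((-1) ^+ t * (-1) ^+ t * ((-1) ^+ s * X)); first by rewrite e mul1r.
by move: (_ ^+ s) (_ ^+ t) => x y; ring.
Qed.

Lemma generic_col_perm k (s : 'S_k) (z : 'rV[C]_k) : generic tau z -> generic tau (col_perm s z).
Proof.
move=> gz i j ij; rewrite !mxE; apply: gz; apply: contra ij => /eqP/perm_inj ->; exact: eqxx.
Qed.

Lemma cross_generic u : ~ Gamma u -> cross u =
  theta1 u * (theta tau (u - n%:R * eta) / theta tau u).
Proof.
move=> gu; have t0 : theta tau u != 0 by apply/eqP => /(theta_eq0 tau_gt0).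
by rewrite /cross /theta1; field.
Qed.

(** The factor [vdm] splits into the parts of the two blocks and the mixed part,
    whose factors turn the kernels into [cross] functions; its antisymmetry accounts
    for the signs. *)
Lemma numer_generic z : generic tau z -> numer z = vdm z * star_sum n tau eta f g z.
Proof.
move=> gz; rewrite /numer /star_sum [RHS]mulrCA; apply: (f_equal (fun u => _ * u)).
rewrite mulr_sumr; apply: eq_bigr => s _.
set y := col_perm s z.
have -> : vdm z = (-1) ^+ s * vdm y.
  by rewrite (vdm_col_perm tau_gt0) mulrA -signr_addb addbb mul1r.
have gy : generic tau y by exact: generic_col_perm.
have yE k : z 0 (s k) = y 0 k by rewrite mxE.
have -> : f (\row_i z 0 (s (lshift b i))) = f (lsub y).
  by apply: (f_equal f); apply/rowP => i; rewrite !mxE.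
have -> : g (\row_j (z 0 (s (rshift a j)) - 2 * a%:R * eta)) = g (rsub_shift y).
  by apply: (f_equal g); apply/rowP => i; rewrite !mxE.
rewrite vdm_split /cleared -[RHS]mulrA; apply: (f_equal (fun u => _ * u)).
have -> : \prod_(i < a) \prod_(j < b) cross (y 0 (lshift b i) - y 0 (rshift a j)) =
  (\prod_(i < a) \prod_(j < b) theta1 (y 0 (lshift b i) - y 0 (rshift a j))) *
  \prod_(i < a) \prod_(j < b)
    (theta tau (z 0 (s (lshift b i)) - z 0 (s (rshift a j)) - n%:R * eta) /
     theta tau (z 0 (s (lshift b i)) - z 0 (s (rshift a j)))).
  rewrite -big_split; apply: eq_bigr => i _; rewrite -big_split; apply: eq_bigr => j _.
  rewrite !yE; apply: cross_generic; apply: gy.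
  by rewrite -val_eqE /= neq_ltn (leq_trans (ltn_ord i) (leq_addr _ _)).
by move: (f _) (g _) (vdm _) (vdm _) (\prod_(i < a) _) (\prod_(i < a) _) => *; ring.
Qed.

Section NumerShift.
Variables (w kap : C) (mu : C -> C) (L : nat -> C -> C).
Hypotheses (thw : forall u, theta1 (u + w) = mu u * theta1 u)
  (muN : forall u, mu (- u) * mu (u - w) = 1)
  (kap0 : kap != 0)
  (crw : forall u, cross (u + w) = kap * mu u * cross u)
  (Ll : forall x, L a x * kap ^+ b = L (a + b) x)
  (Lr : forall x, L b (x - 2 * a%:R * eta) * kap^-1 ^+ a = L (a + b) x)
  (fw : forall p z, f (z + w *: delta_mx 0 p) = L a (z 0 p) * f z)
  (gw : forall p z, g (z + w *: delta_mx 0 p) = L b (z 0 p) * g z).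
Local Notation nu := (shift_factor mu).

Lemma cross_shiftN u : cross (u - w) = kap^-1 * mu (- u) * cross u.
Proof.
have := crw (u - w); rewrite subrK => ->.
have -> : kap^-1 * mu (- u) * (kap * mu (u - w) * cross (u - w)) =
  (kap^-1 * kap) * (mu (- u) * mu (u - w)) * cross (u - w) by ring.
by rewrite muN mulVf// !mul1r.
Qed.

Lemma lsub_lshift (y : V) i : lsub (y + w *: delta_mx 0 (lshift b i)) = lsub y + w *: delta_mx 0 i.
Proof. by apply/rowP => k; rewrite !mxE eqxx /= (inj_eq (@lshift_inj _ _)). Qed.

Lemma rsub_lshift (y : V) i : rsub (y + w *: delta_mx 0 (lshift b i)) = rsub y.
Proof. by apply/rowP => k; rewrite !mxE eqxx /= eq_rlshift mulr0 addr0. Qed.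

Lemma lsub_rshift (y : V) i : lsub (y + w *: delta_mx 0 (rshift a i)) = lsub y.
Proof. by apply/rowP => k; rewrite !mxE eqxx /= eq_lrshift mulr0 addr0. Qed.

Lemma rsub_rshift (y : V) i : rsub (y + w *: delta_mx 0 (rshift a i)) = rsub y + w *: delta_mx 0 i.
Proof. by apply/rowP => k; rewrite !mxE eqxx /= (inj_eq (@rshift_inj _ _)). Qed.

Lemma rsub_shiftE (y : V) : rsub_shift y = rsub y - const_mx (2 * a%:R * eta).
Proof. by apply/rowP => k; rewrite !mxE. Qed.

(** Each variable of the first block meets the [b] variables of the second one
    through [cross], which contributes [kap ^ b]; dually each variable of the second
    block contributes [kap ^ (- a)]. The hypotheses [Ll] and [Lr] say that this is
    what distinguishes [L a] and the translated [L b] from [L (a + b)]. *)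
Lemma cleared_shift (y : V) p :
  cleared (y + w *: delta_mx 0 p) = L (a + b) (y 0 p) * nu y p * cleared y.
Proof.
case: (split_ordP p) => i ->.
- have -> : nu y (lshift b i) =
  nu (lsub y) i * \prod_(j < b) mu (y 0 (lshift b i) - y 0 (rshift a j)).
    rewrite /shift_factor big_split_ord /=; congr (_ * _).
      by apply: eq_big => k; rewrite ?(inj_eq (@lshift_inj _ _))// !mxE.
    by apply: eq_bigl => k; rewrite eq_rlshift.
  rewrite /cleared !rsub_shiftE lsub_lshift rsub_lshift fw (vdm_shift thw muN).
  have -> : \prod_(k < a) \prod_(j < b) cross ((y + w *: delta_mx 0 (lshift b i)) 0 (lshift b k) -
      (y + w *: delta_mx 0 (lshift b i)) 0 (rshift a j)) =
      kap ^+ b * \prod_(j < b) mu (y 0 (lshift b i) - y 0 (rshift a j)) *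
      \prod_(k < a) \prod_(j < b) cross (y 0 (lshift b k) - y 0 (rshift a j)).
    rewrite (bigD1 i) //= [in RHS](bigD1 i) //= mulrA; congr (_ * _).
      rewrite -[b in kap ^+ b]card_ord -prodr_const -!big_split /=.
      apply: eq_bigr => j _; rewrite !shift_coord eqxx eq_rlshift -crw; congr cross; ring.
    apply: eq_bigr => k ki; apply: eq_bigr => j _.
    by rewrite !shift_coord (inj_eq (@lshift_inj _ _)) (negPf ki) eq_rlshift.
  by rewrite -Ll [lsub y 0 i]mxE; ring.
have -> : nu y (rshift a i) = (\prod_(j < a) mu (y 0 (rshift a i) - y 0 (lshift b j))) * nu
  (rsub y) i.
  rewrite /shift_factor big_split_ord /=; congr (_ * _).
    by apply: eq_bigl => k; rewrite eq_lrshift.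
  by apply: eq_big => k; rewrite ?(inj_eq (@rshift_inj _ _))// !mxE.
rewrite /cleared !rsub_shiftE lsub_rshift rsub_rshift addrAC gw (vdm_shift thw muN).
have -> : \prod_(k < a) \prod_(j < b) cross ((y + w *: delta_mx 0 (rshift a i)) 0 (lshift b k) -
    (y + w *: delta_mx 0 (rshift a i)) 0 (rshift a j)) =
    kap^-1 ^+ a * \prod_(j < a) mu (y 0 (rshift a i) - y 0 (lshift b j)) *
    \prod_(k < a) \prod_(j < b) cross (y 0 (lshift b k) - y 0 (rshift a j)).
  rewrite -[a in kap^-1 ^+ a]card_ord -prodr_const -!big_split /=.
  apply: eq_bigr => k _; rewrite (bigD1 i) //= [in RHS](bigD1 i) //= mulrA; congr (_ * _).
    rewrite !shift_coord eqxx eq_lrshift.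
    have -> : y 0 (lshift b k) - (y 0 (rshift a i) + w) = y 0 (lshift b k) - y 0 (rshift a i) - w
      by ring.
    by rewrite cross_shiftN opprB.
  apply: eq_bigr => j ji.
  by rewrite !shift_coord (inj_eq (@rshift_inj _ _)) (negPf ji) eq_lrshift.
rewrite -Lr.
have -> : (rsub y - const_mx (2 * a%:R * eta)) 0 i = y 0 (rshift a i) - 2 * a%:R * eta
  by rewrite !mxE.
by move: (L b _) (f _) (g _) (vdm _) (vdm _) => *; ring.
Qed.

Lemma col_perm_shift k (s : 'S_k) (z : 'rV[C]_k) (p : 'I_k) :
  col_perm s (z + w *: delta_mx 0 p) = col_perm s z + w *: delta_mx 0 ((s^-1)%g p).
Proof.
apply/rowP => i; rewrite !mxE; congr (_ + _ * (_ && _)%:R).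
by rewrite -{1}[p](permKV s) (inj_eq perm_inj).
Qed.

Lemma numer_shift (z : V) p :
  numer (z + w *: delta_mx 0 p) = L (a + b) (z 0 p) * nu z p * numer z.
Proof.
rewrite /numer [RHS]mulrCA; apply: (f_equal (fun u => _ * u)); rewrite mulr_sumr.
apply: eq_bigr => s _; rewrite col_perm_shift cleared_shift [RHS]mulrCA.
apply: (f_equal (fun u => _ * u)); apply: (f_equal (fun u => u * _)).
rewrite [_ 0 _]mxE permKV; apply: (f_equal (fun u => _ * u)).
rewrite /shift_factor [RHS](reindex_inj (@perm_inj _ s)) /=; apply: eq_big => j.
  by rewrite -{2}[p](permKV s) (inj_eq perm_inj).
by rewrite !mxE permKV.
Qed.

End NumerShift.

Lemma numer_shift1 (z : V) p : numer (z + 1 *: delta_mx 0 p) =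
  1 * shift_factor (fun=> - 1) z p * numer z.
Proof.
apply: (@numer_shift 1 1 (fun=> - 1) (fun _ _ => 1)).
- by move=> u; rewrite theta1D1// mulN1r.
- by move=> u; rewrite mulrNN mulr1.
- exact: oner_neq0.
- move=> u; rewrite /cross mul1r.
  have -> : u + 1 - n%:R * eta = u - n%:R * eta + 1 by ring.
  by rewrite (thetaD1 tau_gt0) mulrDr mulr1 e2ipiD e2ipiN e2ipi_half invrN1 mulrN1 mulrN mulN1r.
- by move=> x; rewrite expr1n mulr1.
- by move=> x; rewrite invr1 expr1n mulr1.
- by move=> q y; exact: Fspace_shift1.
- by move=> q y; exact: Fspace_shift1.
Qed.

Definition mu_tau (u : C) : C := - e2ipi (- u - 2^-1 * tau).

Lemma mu_tauN u : mu_tau (- u) * mu_tau (u - tau) = 1.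
Proof. by rewrite /mu_tau mulrNN -e2ipiD -[RHS](e2ipi0 R); congr e2ipi; field. Qed.

Lemma theta1_mu_tau u : theta1 (u + tau) = mu_tau u * theta1 u.
Proof. exact: theta1Dtau. Qed.

Lemma numer_shift_tau (z : V) p :
  numer (z + tau *: delta_mx 0 p) = mult (a + b) (z 0 p) * shift_factor mu_tau z p * numer z.
Proof.
apply: (@numer_shift tau (e2ipi (n%:R * eta)) mu_tau mult).
- exact: theta1_mu_tau.
- exact: mu_tauN.
- exact: e2ipi_neq0.
- move=> u; rewrite /cross /mu_tau.
  have -> : u + tau - n%:R * eta = u - n%:R * eta + tau by ring.
  rewrite (thetaDtau tau_gt0).
  have -> : e2ipi (- (u - n%:R * eta)) = e2ipi (n%:R * eta) * e2ipi (- u).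
    by rewrite -e2ipiD; congr e2ipi; ring.
  have -> : e2ipi (- 2^-1 * (u + tau)) = e2ipi (- 2^-1 * u) * e2ipi (- (2^-1 * tau)).
    by rewrite -e2ipiD; congr e2ipi; ring.
  by rewrite (e2ipiD (- u)); ring.
- move=> x; rewrite /mult -[LHS]mulrA -(e2ipi_nat b) -e2ipiD; congr (_ * e2ipi _).
  by rewrite natrD; ring.
(* [2 a n eta] from the translated argument and [- a n eta] from [kap] add up to [a n eta] *)
- move=> x; rewrite /mult -[LHS]mulrA -e2ipiN -(e2ipi_nat a) -e2ipiD; congr (_ * e2ipi _).
  by rewrite natrD; ring.
- by move=> q y; exact: Fspace_shift_tau.
- by move=> q y; exact: Fspace_shift_tau.
Qed.

Lemma mult_neq0 k x : mult k x != 0.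
Proof. by rewrite mulf_neq0 ?signr_eq0// e2ipi_neq0. Qed.

(** The multipliers of [numer] never vanish. *)
Lemma numer_vanish_shift (x : C) p : Gamma x ->
  forall z, numer (z + x *: delta_mx 0 p) = 0 <-> numer z = 0.
Proof.
have unit_iff (k y : C) : k != 0 -> k * y = 0 <-> y = 0.
  by move=> k0; split=> [/eqP|->]; [rewrite mulrI_eq0 ?mulr0; [move/eqP|exact/lregP]|rewrite mulr0].
move: x; apply: lattice_ind => [z|z|z|x y hx hy z|x hx z].
- rewrite numer_shift1 mul1r; apply: unit_iff; apply: (@shift_factor_neq0 1) => u.
  by rewrite mulrNN mulr1.
- rewrite numer_shift_tau; apply: unit_iff; rewrite mulf_neq0 ?mult_neq0//.
  exact: (shift_factor_neq0 mu_tauN).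
- by rewrite scale0r addr0.
- by rewrite scalerDl addrA; apply: (iff_trans (hy _)); exact: hx.
- by have := hx (z + - x *: delta_mx 0 p); rewrite -addrA -scalerDl addNr scale0r addr0 => h;
  split=> /h.
Qed.

(** On the hyperplane [z_i = z_j] the antisymmetric [numer] vanishes;
    quasi-periodicity carries this to the translates of the hyperplane by the
    lattice. *)
Lemma numer_vanish (z : V) i j : i != j -> Gamma (z 0 i - z 0 j) -> numer z = 0.
Proof.
move=> ij gz; pose x := z 0 i - z 0 j; pose y := z + - x *: delta_mx 0 i.
have zy : z = y + x *: delta_mx 0 i by rewrite /y -addrA -scalerDl addNr scale0r addr0.
rewrite zy; apply/(numer_vanish_shift i gz).
have yE k : y 0 k = if k == i then z 0 k - x else z 0 k.
  by rewrite !mxE eqxx; case: eqP => _ /=; rewrite ?mulr1 ?mulr0 ?addr0.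
have yij : y 0 i = y 0 j.
  by rewrite !yE eqxx eq_sym (negPf ij) /x; ring.
have yt : col_perm (tperm i j) y = y.
  by apply/rowP => k; rewrite mxE; case: tpermP => [->|->|].
have := numer_col_perm (tperm i j) y; rewrite yt odd_tperm ij expr1 mulN1r => /eqP.
by rewrite -addr_eq0 -mulr2n -mulr_natl mulf_eq0 pnatr_eq0 /= => /eqP.
Qed.

Lemma numer_divisible : exists2 Q, entire Q & forall z : V, numer z = vdm z * Q z.
Proof.
have [||q z ql|Q eQ hQ] := @divide_pairs R tau tau_gt0 m
  [seq q : 'I_m * 'I_m <- index_enum ('I_m * 'I_m)%type | (q.1 < q.2)%N] numer _ _ entire_numer.
- by rewrite filter_uniq// index_enum_uniq.
- exact: filter_all.
- by apply: numer_vanish; move: ql; rewrite mem_filter => /andP[lt _];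
  rewrite -val_eqE /= neq_ltn lt.
by exists Q => // z; rewrite hQ big_filter.
Qed.

Lemma vdm_cancel (z : V) (k x y : C) : generic tau z -> k != 0 -> k * vdm z * x = k * vdm z * y ->
  x = y.
Proof.
move=> gz k0; apply: mulfI; apply: mulf_neq0; [exact: k0|exact: vdm_neq0].
Qed.

(** The quotient [Q] of [numer] by [vdm] is entire, and equal to [star_sum] at
    generic points; hence it is the limit that defines [star]. Its symmetry and its
    multipliers are those of [numer] divided by those of [vdm]. *)
Lemma star_spec : F (star n tau eta f g) /\
  forall z, generic tau z -> star n tau eta f g z = star_sum n tau eta f g z.
Proof.
have [Q eQ hQ] := numer_divisible; have cQ : continuous Q by case: eQ.
have gQ z : generic tau z -> star_sum n tau eta f g z = Q z.
  move=> gz; apply: (@vdm_cancel z 1 _ _ gz (oner_neq0 _)); rewrite mul1r.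
  by rewrite -(numer_generic gz); exact: hQ.
have -> : star n tau eta f g = Q.
  apply/funext => z; have pf := generic_proper tau_gt0 z.
  apply: (@cvg_lim _ (@norm_hausdorff _ C)).
  have cw : Q @ within (@generic R tau m) (nbhs z) --> Q z.
    by apply: cvg_trans (cQ z); apply: cvg_app; exact: cvg_within.
  apply: cvg_trans cw; apply: near_eq_cvg; rewrite near_withinE; apply: nearW => y gy;
    exact: esym (gQ y gy).
split; last by move=> z gz; rewrite gQ.
split.
- exact: entire_differentiable.
- move=> s; apply: (@eq_generic R tau tau_gt0 m (fun z => Q (col_perm s z)) Q _ cQ).
    by case: (@entire_affine R _ _ _ _ eQ (@affine_col_perm R m s)).
  move=> z gz; apply: (@vdm_cancel z ((-1) ^+ s) _ _ gz); first by rewrite signr_eq0.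
  by rewrite -[X in X * Q (col_perm s z)](vdm_col_perm tau_gt0) -hQ numer_col_perm hQ; exact: mulrA.
- move=> i z _; rewrite -[delta_mx 0 i]scale1r; move: z.
  apply: (@eq_generic R tau tau_gt0 m (fun z => Q (z + 1 *: delta_mx 0 i)) Q _ cQ).
    exact: (cont_comp cQ (cont_translate (@cont_cst _ _ 1) (@cont_id _))).
  have mN (u : C) : (fun=> - 1) (- u) * (fun=> - 1) (u - 1) = 1 :> C by rewrite mulrNN mulr1.
  have th (u : C) : theta1 (u + 1) = (fun=> - 1) u * theta1 u by rewrite theta1D1// mulN1r.
  move=> z gz; apply: (@vdm_cancel z (shift_factor (fun=> - 1) z i) _ _ gz).
    exact: (shift_factor_neq0 mN).
  rewrite -[X in X * Q (z + _)](vdm_shift th mN) -hQ numer_shift1 hQ mul1r; exact: mulrA.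
move=> i z _; move: z.
apply: (@eq_generic R tau tau_gt0 m (fun z => Q (z + tau *: delta_mx 0 i))
  (fun z => mult m (z 0 i) * Q z)).
- exact: (cont_comp cQ (cont_translate (@cont_cst _ _ tau) (@cont_id _))).
- apply: contM cQ; apply: contM; first exact: cont_cst.
  have ec : continuous (fun x : C => e2ipi (- (n%:R * x - c - (m%:R - 1) * n%:R * eta))).
    have [ce _] := entire_e2ipi (- n%:R : C) (c + (m%:R - 1) * n%:R * eta).
    suff -> : (fun x : C => e2ipi (- (n%:R * x - c - (m%:R - 1) * n%:R * eta))) =
      (fun x => e2ipi (- n%:R * x + (c + (m%:R - 1) * n%:R * eta))) by [].
    by apply/funext => x; congr e2ipi; ring.
  exact: (cont_comp ec (@cont_coord R m i)).
move=> z gz; apply: (@vdm_cancel z (shift_factor mu_tau z i) _ _ gz).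
  exact: (shift_factor_neq0 mu_tauN).
rewrite -[X in X * Q (z + _)](vdm_shift theta1_mu_tau mu_tauN) -hQ numer_shift_tau hQ.
by move: (mult _ _) (shift_factor _ _ _) (vdm _) (Q _) => *; ring.
Qed.

End Products.
End Star.

(** * Permutations of a block of variables *)

Section BlockPermutations.
Variables (m k o : nat).
Hypothesis okm : (o + k <= m)%N.

Lemma block_index_subproof (x : 'I_k) : (o + x < m)%N.
Proof. by rewrite (leq_trans _ okm)// ltn_add2l. Qed.
Definition block_index (x : 'I_k) : 'I_m := Ordinal (block_index_subproof x).

Lemma block_index_inj : injective block_index.
Proof. by move=> x y /(f_equal val)/addnI/val_inj. Qed.

Definition extend_fun (t : 'S_k) (i : 'I_m) : 'I_m :=
  if [pick x | block_index x == i] is Some x then block_index (t x) else i.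

Lemma extend_fun_inj t : injective (extend_fun t).
Proof.
move=> i1 i2; rewrite /extend_fun.
case: pickP => [x1 /eqP <-|n1]; case: pickP => [x2 /eqP <-|n2].
- by move=> /block_index_inj/perm_inj ->.
- by move=> e; have := n2 (t x1); rewrite e eqxx.
- by move=> e; have := n1 (t x2); rewrite -e eqxx.
by [].
Qed.

Definition extend t : 'S_m := perm (@extend_fun_inj t).

Lemma extend_block t x : extend t (block_index x) = block_index (t x).
Proof.
rewrite permE /extend_fun; case: pickP => [y /eqP/block_index_inj -> //|/(_ x)].
by rewrite eqxx.
Qed.

Lemma extend_out t (i : 'I_m) : ~~ (o <= i < o + k)%N -> extend t i = i.
Proof.
move=> out; rewrite permE /extend_fun; case: pickP => [y /eqP e|//].
by move: out; rewrite -e /= leq_addr ltn_add2l ltn_ord.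
Qed.

End BlockPermutations.

(** Both sums are over the triples [(j, l, r)] with [j + l + r = m]. *)
Lemma sum_triangle (V : nmodType) m (T : nat -> nat -> nat -> V) :
  \sum_(k < m.+1) \sum_(j < k.+1) T j (k - j)%N (m - k)%N =
  \sum_(j < m.+1) \sum_(l < (m - j).+1) T j l (m - j - l)%N.
Proof.
transitivity (\sum_(k < m.+1) \sum_(j < m.+1 | (j <= k)%N) T j (k - j)%N (m - k)%N).
  apply: eq_bigr => k _; rewrite
    (big_ord_widen_cond _ predT (fun j => T j (k - j)%N (m - k)%N) (ltn_ord k)).
  by apply: eq_bigl => j; rewrite ltnS.
rewrite (exchange_big_dep predT) //=; apply: eq_bigr => j _.
have jm : (j <= m)%N by rewrite -ltnS.
rewrite -(big_mkord (fun k => (j <= k)%N) (fun k => T j (k - j)%N (m - k)%N)).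
rewrite -(big_mkord xpredT (fun l => T j l (m - j - l)%N)).
rewrite -subSn//.
transitivity (\sum_(0 + j <= k < m.+1) T j (k - j)%N (m - k)%N).
  by rewrite [RHS](big_nat_widenl _ 0)//; apply: eq_bigl => k; rewrite add0n.
rewrite big_addn; apply: eq_bigr => l _.
by rewrite addnK subnDA [(m - l - j)%N]subnAC.
Qed.

(** * The direct sum: closure, bilinearity, associativity *)

Section Assoc.
Variables (R : realType) (n : nat) (tau c eta : Cplx R).
Local Notation C := (Cplx R).
Hypothesis tau_gt0 : 0 < complex.Im tau.
Local Notation F := (Fspace n tau c eta).

(** Indexing by natural numbers is insensitive to the way the dimension is written as
    a sum, and thus avoids transports between row vectors. *)
Definition coor m (y : 'rV[C]_m) (k : nat) : C := oapp (fun i => y 0 i) 0 (insub k).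

Lemma coorE m (y : 'rV[C]_m) k (i : 'I_m) : k = i :> nat -> coor y k = y 0 i.
Proof. by move=> ->; rewrite /coor valK. Qed.

Definition restr m (y : 'rV[C]_m) k o x : 'rV[C]_k := \row_(i < k) (coor y (o + i) - x).

Lemma coor_restr m (y : 'rV[C]_m) k o x p : (p < k)%N -> coor (restr y k o x) p =
  coor y (o + p) - x.
Proof. by move=> pk; rewrite (@coorE _ _ _ (Ordinal pk))// mxE. Qed.

Lemma restr_restr m (y : 'rV[C]_m) k o x l p x' : (p + l <= k)%N ->
  restr (restr y k o x) l p x' = restr y l (o + p) (x + x').
Proof.
move=> plk; apply/rowP => i; rewrite !mxE coor_restr; first by rewrite addnA opprD addrA.
by rewrite (leq_trans _ plk)// ltn_add2l.
Qed.

Lemma generic_restr m (y : 'rV[C]_m) k o x : (o + k <= m)%N -> generic tau y ->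
  generic tau (restr y k o x).
Proof.
move=> okm gy i j ij; rewrite !mxE.
rewrite (@coorE _ _ _ (block_index okm i))// (@coorE _ _ _ (block_index okm j))//.
have -> : y 0 (block_index okm i) - x - (y 0 (block_index okm j) - x) =
  y 0 (block_index okm i) - y 0 (block_index okm j) by ring.
by apply: gy; rewrite (inj_eq (@block_index_inj _ _ _ _)).
Qed.

Definition theta_ratio (u : C) : C := theta tau (u - n%:R * eta) / theta tau u.

Definition block a (f : 'rV[C]_a -> C) m (y : 'rV[C]_m) o x : C := f (restr y a o x).

Definition block_kernel m (y : 'rV[C]_m) o a p b : C :=
  \prod_(i < a) \prod_(j < b) theta_ratio (coor y (o + i) - coor y (p + j)).

(** The summand of [star_sum], for blocks that may lie inside a larger set of
    variables. *)
Definition pairing a b (f : 'rV[C]_a -> C) (g : 'rV[C]_b -> C) m (y : 'rV[C]_m) o x : C :=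
  block f y o x * block g y (o + a) (x + 2 * a%:R * eta) * block_kernel y o a (o + a) b.

(** In terms of [pairing], transport along [a + b = m] leaves no trace. *)
Lemma star_sum_cast a b m (e : (a + b = m)%N) f g (z : 'rV[C]_m) :
  star_sum n tau eta f g (castmx (erefl, esym e) z) =
  (a`! * b`!)%:R^-1 * \sum_(s : 'S_m) pairing f g (col_perm s z) 0 0.
Proof.
case: m / e z => z; rewrite castmx_id /star_sum; apply: (f_equal (fun u => _ * u)).
apply: eq_bigr => s _.
have yl (i : 'I_a) : coor (col_perm s z) (0 + i) = z 0 (s (lshift b i))
  by rewrite (@coorE _ _ _ (lshift b i))// mxE.
have yr (i : 'I_b) : coor (col_perm s z) (0 + a + i) = z 0 (s (rshift a i))
  by rewrite (@coorE _ _ _ (rshift a i))// mxE.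
rewrite /pairing /block.
have -> : restr (col_perm s z) a 0 0 = \row_i z 0 (s (lshift b i)).
  by apply/rowP => i; rewrite !mxE yl subr0.
have -> : restr (col_perm s z) b (0 + a) (0 + 2 * a%:R * eta) =
  \row_j (z 0 (s (rshift a j)) - 2 * a%:R * eta).
  by apply/rowP => i; rewrite !mxE yr add0r.
apply: (f_equal (fun u => _ * u)); apply: eq_bigr => i _; apply: eq_bigr => j _.
by rewrite /theta_ratio yl yr.
Qed.

Lemma coor_extend m (y : 'rV[C]_m) k o (okm : (o + k <= m)%N) (t : 'S_k) (i : 'I_k) :
  coor (col_perm (extend okm t) y) (o + i) = coor y (o + t i).
Proof.
rewrite (@coorE _ _ _ (block_index okm i))// mxE extend_block.
by rewrite (@coorE _ _ _ (block_index okm (t i))).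
Qed.

Lemma col_perm_restr m (y : 'rV[C]_m) k o x (okm : (o + k <= m)%N) (t : 'S_k) :
  col_perm t (restr y k o x) = restr (col_perm (extend okm t) y) k o x.
Proof.
by apply/rowP => i; rewrite !mxE coor_extend.
Qed.

Lemma coor_extend_out m (y : 'rV[C]_m) k o (okm : (o + k <= m)%N) (t : 'S_k) p :
  ~~ (o <= p < o + k)%N -> coor (col_perm (extend okm t) y) p = coor y p.
Proof.
move=> out; rewrite /coor; case: insubP => //= i _ ip.
by rewrite mxE extend_out ?ip.
Qed.

Lemma restr_extend_out m (y : 'rV[C]_m) k o (okm : (o + k <= m)%N) (t : 'S_k) l p x :
  ((p + l <= o) || (o + k <= p))%N -> restr (col_perm (extend okm t) y) l p x = restr y l p x.
Proof.
move=> out; apply/rowP => i; rewrite !mxE coor_extend_out//; have := ltn_ord i; lia.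
Qed.

Lemma pairing_restr a b (f : 'rV[C]_a -> C) (g : 'rV[C]_b -> C) m (y : 'rV[C]_m) k o x :
  (a + b = k)%N -> pairing f g (restr y k o x) 0 0 = pairing f g y o x.
Proof.
move=> abk; have ab : (0 + a <= k)%N by rewrite -abk leq_addr.
have ba : (0 + a + b <= k)%N by rewrite -abk.
rewrite /pairing /block (restr_restr _ _ _ _ ab) (restr_restr _ _ _ _ ba) !add0n addn0 addr0 add0r.
apply: (f_equal (fun u => _ * u)); apply: eq_bigr => i _; apply: eq_bigr => j _.
have il : (i < k)%N by rewrite (leq_trans _ ab)// add0n.
have jl : (a + j < k)%N by rewrite -abk ltn_add2l.
rewrite add0n (coor_restr _ _ _ il) (coor_restr _ _ _ jl) addnA.
by congr theta_ratio; ring.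
Qed.

(** For each [t], multiplication by [extend okm t] is a bijection of the symmetric
    group. *)
Lemma sum_extend m k o (okm : (o + k <= m)%N) (X : 'rV[C]_m -> C) (z : 'rV[C]_m) :
  \sum_(s : 'S_m) \sum_(t : 'S_k) X (col_perm (extend okm t) (col_perm s z)) =
  k`!%:R * \sum_(s : 'S_m) X (col_perm s z).
Proof.
rewrite exchange_big /= -card_Sn -sum1_card natr_sum mulr_suml; apply: eq_bigr => t _.
rewrite mul1r [RHS](reindex_inj (mulgI (extend okm t))); apply: eq_bigr => s _.
by rewrite col_permM.
Qed.

Lemma block_kernel_extend_l m (y : 'rV[C]_m) k o (okm : (o + k <= m)%N) (t : 'S_k) p d :
  (o + k <= p)%N -> block_kernel (col_perm (extend okm t) y) o k p d = block_kernel y o k p d.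
Proof.
move=> okp; rewrite [RHS](reindex_inj (@perm_inj _ t)); apply: eq_bigr => i _.
apply: eq_bigr => j _; rewrite [coor (col_perm _ y) (p + j)]coor_extend_out; last by lia.
by rewrite coor_extend.
Qed.

Lemma block_kernel_extend_r m (y : 'rV[C]_m) k o (okm : (o + k <= m)%N) (t : 'S_k) p d :
  (p + d <= o)%N -> block_kernel (col_perm (extend okm t) y) p d o k = block_kernel y p d o k.
Proof.
move=> pdo; apply: eq_bigr => i _; rewrite [RHS](reindex_inj (@perm_inj _ t)).
apply: eq_bigr => j _; rewrite [coor (col_perm _ y) (p + i)]coor_extend_out;
  last by have := ltn_ord i; lia.
by rewrite coor_extend.
Qed.

Lemma block_kernel_addl m (y : 'rV[C]_m) o a b p d :
  block_kernel y o (a + b) p d = block_kernel y o a p d * block_kernel y (o + a) b p d.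
Proof.
by rewrite /block_kernel big_split_ord /=; congr (_ * _); apply: eq_bigr => i _; rewrite addnA.
Qed.

Lemma block_kernel_addr m (y : 'rV[C]_m) o a p b d :
  block_kernel y o a p (b + d) = block_kernel y o a p b * block_kernel y o a (p + b) d.
Proof.
rewrite /block_kernel -big_split; apply: eq_bigr => i _ /=; rewrite big_split_ord /=; congr (_ * _).
by apply: eq_bigr => j _; rewrite addnA.
Qed.

(** The common summand of both triple products: three consecutive blocks and the
    kernels between any two of them. *)
Definition triple a b d (f : 'rV[C]_a -> C) (g : 'rV[C]_b -> C) (h : 'rV[C]_d -> C) m
  (y : 'rV[C]_m) : C :=
  block f y 0 0 * block g y a (2 * a%:R * eta) * block h y (a + b) (2 * (a + b)%:R * eta) *
  (block_kernel y 0 a a b * block_kernel y 0 a (a + b) d * block_kernel y a b (a + b) d).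

(** The permutation [t] of the first [k] variables does not affect the third block,
    and permutes the factors of the kernels that link it to the first two; then
    [sum_extend] applies. *)
Lemma nest_left a b k d (f : 'rV[C]_a -> C) (g : 'rV[C]_b -> C) (h : 'rV[C]_d -> C) m
  (z : 'rV[C]_m) :
  (a + b = k)%N -> (k <= m)%N ->
  \sum_(s : 'S_m) (\sum_(t : 'S_k) pairing f g (col_perm t (restr (col_perm s z) k 0 0)) 0 0) *
    block h (col_perm s z) (0 + k) (0 + 2 * k%:R * eta) * block_kernel (col_perm s z) 0 k (0 + k)
      d =
  k`!%:R * \sum_(s : 'S_m) triple f g h (col_perm s z).
Proof.
move=> abk km; have okm : (0 + k <= m)%N by [].
rewrite -(sum_extend okm (fun y => triple f g h y)); apply: eq_bigr => s _.
rewrite mulr_suml mulr_suml; apply: eq_bigr => t _.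
rewrite (col_perm_restr _ _ okm) (pairing_restr _ _ _ _ _ abk).
set y := col_perm s z; set y' := col_perm (extend okm t) y.
have -> : block h y (0 + k) (0 + 2 * k%:R * eta) = block h y' k (2 * k%:R * eta).
  by rewrite /block restr_extend_out ?leqnn ?orbT// add0n add0r.
rewrite -(block_kernel_extend_l y okm t _ (leqnn _)) -/y' add0n -abk block_kernel_addl add0n.
rewrite /pairing /triple !add0n !add0r.
by move: (block f _ _ _) (block g _ _ _) (block h _ _ _) (block_kernel _ _ _ _ _)
  (block_kernel _ _ _ _ _) (block_kernel _ _ _ _ _) => *; ring.
Qed.

(** The translations add up: the last block is translated by [2 a eta] as a part of
    the second factor and by [2 b eta] inside that factor. *)
Lemma nest_right a b k d (f : 'rV[C]_a -> C) (g : 'rV[C]_b -> C) (h : 'rV[C]_d -> C) m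
  (z : 'rV[C]_m) :
  (b + d = k)%N -> (a + k <= m)%N ->
  \sum_(s : 'S_m) block f (col_perm s z) 0 0 *
    (\sum_(t : 'S_k) pairing g h (col_perm t
      (restr (col_perm s z) k (0 + a) (0 + 2 * a%:R * eta))) 0 0) *
    block_kernel (col_perm s z) 0 a (0 + a) k =
  k`!%:R * \sum_(s : 'S_m) triple f g h (col_perm s z).
Proof.
move=> bdk km; have okm : (0 + a + k <= m)%N by [].
rewrite -(sum_extend okm (fun y => triple f g h y)); apply: eq_bigr => s _.
rewrite mulr_sumr mulr_suml; apply: eq_bigr => t _.
rewrite (col_perm_restr _ _ okm) (pairing_restr _ _ _ _ _ bdk).
set y := col_perm s z; set y' := col_perm (extend okm t) y.
have -> : block f y 0 0 = block f y' 0 0.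
  by rewrite /block restr_extend_out ?leqnn.
rewrite -(block_kernel_extend_r y okm t (leqnn _)) -/y' add0n -bdk block_kernel_addr.
rewrite /pairing /triple !add0r.
have -> : 2 * a%:R * eta + 2 * b%:R * eta = 2 * (a + b)%:R * eta by rewrite natrD; ring.
by move: (block f _ _ _) (block g _ _ _) (block h _ _ _) (block_kernel _ _ _ _ _)
  (block_kernel _ _ _ _ _) (block_kernel _ _ _ _ _) => *; ring.
Qed.

Lemma Fspace_lin a (x : C) (f g : 'rV[C]_a -> C) : @F a f -> @F a g ->
  @F a (fun z => x * f z + g z).
Proof.
move=> [df sf f1 ft] [dg sg g1 gt]; split.
- apply: entire_differentiable; apply: entireD; last exact: differentiable_entire.
  by apply: entireM; [exact: entire_cst|exact: differentiable_entire].
- by move=> s z; rewrite sf sg.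
- by move=> i z i0; rewrite f1// g1.
by move=> i z i0; rewrite ft// gt//; ring.
Qed.

Lemma Fspace_zero a : @F a (fun=> 0).
Proof.
split=> [|//|//|i z _]; last by rewrite mulr0.
exact: (entire_differentiable (entire_cst _ 0)).
Qed.

Lemma Fspace_sum a I (l : seq I) (f : I -> 'rV[C]_a -> C) :
  (forall i, @F a (f i)) -> @F a (fun z => \sum_(i <- l) f i z).
Proof.
move=> Ff; elim: l => [|i l ih].
  have -> : (fun z => \sum_(i <- [::]) f i z) = fun=> 0 by apply/funext => z; rewrite big_nil.
  exact: Fspace_zero.
have -> : (fun z => \sum_(i <- i :: l) f i z) = (fun z => 1 * f i z + \sum_(i <- l) f i z).
  by apply/funext => z; rewrite big_cons mul1r.
exact: Fspace_lin (Ff i) ih.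
Qed.

Lemma Fspace_cast a m (e : a = m) f : @F a f -> @F m (fun z => f (castmx (erefl, esym e) z)).
Proof.
case: m / e => Ff; suff -> : (fun z : 'rV[C]_a => f (castmx (erefl, esym (erefl a)) z)) = f by [].
by apply/funext => z; rewrite castmx_id.
Qed.

Lemma Fspace_eq a f g : @F a f -> @F a g -> (forall z, generic tau z -> f z = g z) -> f = g.
Proof.
move=> Ff Fg fg; apply/funext; apply: (eq_generic tau_gt0 _ _ fg).
  by case: (differentiable_entire (let: And4 d _ _ _ := Ff in d)).
by case: (differentiable_entire (let: And4 d _ _ _ := Fg in d)).
Qed.

Local Notation dmul := (@dsum_mul R n tau eta).

Lemma Fspace_dmul u v : (forall a, @F a (u a)) -> (forall a, @F a (v a)) -> forall m,
  @F m (@dmul u v m).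
Proof.
move=> Fu Fv m; apply: Fspace_sum => k; apply: Fspace_cast.
by case: (star_spec tau_gt0 (Fu k) (Fv (m - k)%N)).
Qed.

Lemma generic_cast a m (e : a = m) (z : 'rV[C]_m) : generic tau z ->
  generic tau (castmx (erefl, esym e) z).
Proof. by case: m / e z => z; rewrite castmx_id. Qed.

(** At generic points [star] is given by its defining sum. *)
Lemma dmulE u v m z : (forall a, @F a (u a)) -> (forall a, @F a (v a)) -> generic tau z ->
  @dmul u v m z = \sum_(k < m.+1)
    (k`! * (m - k)`!)%:R^-1 * \sum_(s : 'S_m) pairing (u k) (v (m - k)%N) (col_perm s z) 0 0.
Proof.
move=> Fu Fv gz; apply: eq_bigr => k _.
have [_ ->] := star_spec tau_gt0 (Fu k) (Fv (m - k)%N); last exact: generic_cast.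
exact: star_sum_cast.
Qed.

(** At a generic point both sides expand into the sum of [triple] over the
    decompositions [m = a + b + d], with coefficients [1 / (a! b! d!)]; the factor
    [k!] from the absorbed permutations cancels the one in the outer product. *)
Lemma dmulA u v w : (forall a, @F a (u a)) -> (forall a, @F a (v a)) -> (forall a, @F a (w a)) ->
  dmul (dmul u v) w = dmul u (dmul v w).
Proof.
move=> Fu Fv Fw; apply: functional_extensionality_dep => m.
have Fuv := Fspace_dmul Fu Fv; have Fvw := Fspace_dmul Fv Fw.
apply: Fspace_eq; [exact: Fspace_dmul|exact: Fspace_dmul|move=> z gz].
pose T a b d := (a`! * b`! * d`!)%:R^-1 * \sum_(s : 'S_m) triple (u a) (v b) (w d) (col_perm s z).
have fact0 a : a`!%:R != 0 :> C by rewrite pnatr_eq0 -lt0n fact_gt0.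
have gs (s : 'S_m) : generic tau (col_perm s z) by exact: generic_col_perm.
rewrite (dmulE Fuv Fw gz) (dmulE Fu Fvw gz).
transitivity (\sum_(k < m.+1) \sum_(j < k.+1) T j (k - j)%N (m - k)%N).
  apply: eq_bigr => k _; have km : (k <= m)%N by rewrite -ltnS.
  have jk (j : 'I_k.+1) : (j + (k - j) = k)%N by rewrite subnKC// -ltnS.
  transitivity ((k`! * (m - k)`!)%:R^-1 * \sum_(j < k.+1) (j`! * (k - j)`!)%:R^-1 *
      (k`!%:R * \sum_(s : 'S_m) triple (u j) (v (k - j)%N) (w (m - k)%N) (col_perm s z))).
    apply: (f_equal (fun x => _ * x)).
    under [RHS]eq_bigr => j _ do rewrite -(nest_left _ _ _ _ (jk j) km) mulr_sumr.
    rewrite exchange_big /=; apply: eq_bigr => s _.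
    rewrite /pairing {1}/block (dmulE Fu Fv); last exact: generic_restr.
    by rewrite !mulr_suml; apply: eq_bigr => j _; rewrite !mulrA.
  rewrite mulr_sumr; apply: eq_bigr => j _; rewrite /T !natrM.
  by move: (\sum_(s : 'S_m) _) => X; field; rewrite !fact0.
rewrite sum_triangle; apply: eq_bigr => j _; have jm : (j <= m)%N by rewrite -ltnS.
have lk (l : 'I_(m - j).+1) : (l + (m - j - l) = m - j)%N by rewrite subnKC// -ltnS.
have jjm : (j + (m - j) <= m)%N by rewrite subnKC.
transitivity ((j`! * (m - j)`!)%:R^-1 * \sum_(l < (m - j).+1) (l`! * (m - j - l)`!)%:R^-1 *
    ((m - j)`!%:R * \sum_(s : 'S_m) triple (u j) (v l) (w (m - j - l)%N) (col_perm s z))).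
  rewrite mulr_sumr; apply: eq_bigr => l _; rewrite /T !natrM.
  by move: (\sum_(s : 'S_m) _) => X; field; rewrite !fact0.
apply: (f_equal (fun x => _ * x)).
under eq_bigr => l _ do rewrite -(nest_right _ _ _ _ (lk l) jjm) mulr_sumr.
rewrite exchange_big /=; apply: eq_bigr => s _.
rewrite /pairing [block (@dsum_mul _ _ _ _ _ _ _) _ _ _]/block (dmulE Fv Fw);
  last exact: generic_restr.
by rewrite mulr_sumr mulr_suml; apply: eq_bigr => l _; move: (\sum_(t : 'S_(m - j)) _) => X; ring.
Qed.

Lemma pairing_linl a b x (f f' : 'rV[C]_a -> C) (g : 'rV[C]_b -> C) m (y : 'rV[C]_m) :
  pairing (fun z => x * f z + f' z) g y 0 0 = x * pairing f g y 0 0 + pairing f' g y 0 0.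
Proof. by rewrite /pairing {1}/block !mulrDl !mulrA. Qed.

Lemma pairing_linr a b x (f : 'rV[C]_a -> C) (g g' : 'rV[C]_b -> C) m (y : 'rV[C]_m) :
  pairing f (fun z => x * g z + g' z) y 0 0 = x * pairing f g y 0 0 + pairing f g' y 0 0.
Proof. by rewrite /pairing [block (fun z => _) _ _ _]/block mulrDr mulrDl -!mulrA mulrCA. Qed.

Lemma dmul_linl x u u' v : (forall a, @F a (u a)) -> (forall a, @F a (u' a)) ->
  (forall a, @F a (v a)) ->
  dmul (lincomb x u u') v = lincomb x (dmul u v) (dmul u' v).
Proof.
move=> Fu Fu' Fv; apply: functional_extensionality_dep => m.
have Fl a : @F a (@lincomb R x u u' a) by exact: Fspace_lin.
apply: Fspace_eq => [||z gz]; first exact: Fspace_dmul.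
  by apply: Fspace_lin; exact: Fspace_dmul.
rewrite /lincomb (dmulE Fl Fv gz) (dmulE Fu Fv gz) (dmulE Fu' Fv gz) mulr_sumr -big_split.
apply: eq_bigr => k _ /=; under eq_bigr => s _ do rewrite pairing_linl.
by rewrite big_split /= -mulr_sumr mulrDr mulrCA.
Qed.

Lemma dmul_linr x u v v' : (forall a, @F a (u a)) -> (forall a, @F a (v a)) ->
  (forall a, @F a (v' a)) ->
  dmul u (lincomb x v v') = lincomb x (dmul u v) (dmul u v').
Proof.
move=> Fu Fv Fv'; apply: functional_extensionality_dep => m.
have Fl a : @F a (@lincomb R x v v' a) by exact: Fspace_lin.
apply: Fspace_eq => [||z gz]; first exact: Fspace_dmul.
  by apply: Fspace_lin; exact: Fspace_dmul.
rewrite /lincomb (dmulE Fu Fl gz) (dmulE Fu Fv gz) (dmulE Fu Fv' gz) mulr_sumr -big_split.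
apply: eq_bigr => k _ /=; under eq_bigr => s _ do rewrite pairing_linr.
by rewrite big_split /= -mulr_sumr mulrDr mulrCA.
Qed.

Lemma dsum_dmul u v : dsum n tau c eta u -> dsum n tau c eta v -> dsum n tau c eta (dmul u v).
Proof.
move=> [Fu [N1 u0]] [Fv [N2 v0]]; split; first exact: Fspace_dmul.
exists (N1 + N2)%N => m Nm; suff -> : @dmul u v m = fun=> 0 by [].
apply: Fspace_eq; [exact: Fspace_dmul|exact: Fspace_zero|move=> z gz].
rewrite dmulE// big1// => k _; rewrite big1 ?mulr0// => s _.
rewrite /pairing /block; have [kN|kN] := leqP N1 k; first by rewrite u0// !mul0r.
by rewrite v0 ?mulr0 ?mul0r//; lia.
Qed.

End Assoc.

Theorem proposition5 (R : realType) (n : nat) (tau c eta : Cplx R)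
    (Htau : (0 < complex.Im tau :> R)) :
  (forall (a b : nat) (f : 'rV[Cplx R]_a -> Cplx R) (g : 'rV[Cplx R]_b -> Cplx R),
     Fspace n tau c eta f -> Fspace n tau c eta g ->
     Fspace n tau c eta (star n tau eta f g) /\
     (forall z, generic tau z ->
        star n tau eta f g z = star_sum n tau eta f g z)) /\
  [/\ forall u v, dsum n tau c eta u -> dsum n tau c eta v ->
        dsum n tau c eta (dsum_mul n tau eta u v),
      forall (x : Cplx R) u u' v,
        dsum n tau c eta u -> dsum n tau c eta u' -> dsum n tau c eta v ->
        dsum_mul n tau eta (lincomb x u u') v =
        lincomb x (dsum_mul n tau eta u v) (dsum_mul n tau eta u' v),
      forall (x : Cplx R) u v v',
        dsum n tau c eta u -> dsum n tau c eta v -> dsum n tau c eta v' ->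
        dsum_mul n tau eta u (lincomb x v v') =
        lincomb x (dsum_mul n tau eta u v) (dsum_mul n tau eta u v') &
      forall u v w,
        dsum n tau c eta u -> dsum n tau c eta v -> dsum n tau c eta w ->
        dsum_mul n tau eta (dsum_mul n tau eta u v) w =
        dsum_mul n tau eta u (dsum_mul n tau eta v w)].
Proof.
split=> [a b f g Ff Fg|]; first exact: star_spec.
split.
- by move=> u v; exact: dsum_dmul.
- by move=> x u u' v [Fu _] [Fu' _] [Fv _]; exact: (dmul_linl Htau).
- by move=> x u v v' [Fu _] [Fv _] [Fv' _]; exact: (dmul_linr Htau).
by move=> u v w [Fu _] [Fv _] [Fw _]; exact: (dmulA Htau).
Qed.
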